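(* Assume (a.1)–(a.5). For $\varepsilon>0$ and $\beta\in\mathbb{R}$ let \[ K_{\varepsilon,\beta}(x)=\begin{cases}\dfrac{e^{i\gamma(x)}}{x^{1+i\beta}\psi(x)^{-i\beta}}, & \varepsilon\le x\le 1,\\[1ex] 0,&\text{otherwise},\end{cases} \] and $T_{\varepsilon,\beta}f=K_{\varepsilon,\beta}*f$. Then there exists a constant $A$, independent of $\varepsilon$ and $\beta$, such that for all $f\in L^1(\mathbb{R})$ and all $\alpha>0$, \[ |\{x\in\mathbb{R}:|T_{\varepsilon,\beta}f(x)|>\alpha\}|\le\frac{A(1+|\beta|)}{\alpha}\|f\|_{L^1(\mathbb{R})}. \]
   Context: Standing assumptions: $\gamma\in C^3((0,1])$ is real-valued with $\lim_{t\to0^+}|\gamma(t)|=\infty$, and $\psi\in C^2([0,1])$ is positive on $(0,1]$ with $\lim_{t\to0^+}\psi(t)=0$. There are constants $t_0,s_0,C>0$ such that: (a.1) $\gamma,\psi,\gamma',\gamma'',\psi'$ are all monotone; moreover $\gamma'(t)>0$ and $\gamma'$ is decreasing on $(0,1]$. (Hence $\gamma'$ has an inverse $\gamma'^{-1}(s)$ for $s\ge\gamma'(1)$.) (a.2) For $0<t<t_0$: $\left|\frac{\psi'(t)}{\psi(t)}\right|\le\frac12\left|\frac{\gamma'''(t)}{\gamma''(t)}\right|$. (a.3) For $s>s_0$: $|\gamma''(\gamma'^{-1}(2s))|\le C|\gamma''(\gamma'^{-1}(s))|$. (a.4) There exist $\epsilon>0$ and $A>1+\epsilon$ such that $\gamma'(t)\ge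 A\gamma'((1+\epsilon)t)$ for $0<t<t_0$. (a.5) There exists $1/2<\lambda<1$ such that $|\gamma''(t)|\le C\gamma'(t)^{2\lambda}$ for $0<t<t_0$. *)

(* Defs.v *)
From HB Require Import structures.
From mathcomp Require Import all_boot all_order all_algebra.
From mathcomp Require Import all_classical all_reals all_analysis.
Set Implicit Arguments. Unset Strict Implicit. Unset Printing Implicit Defensive.
Import Order.TTheory GRing.Theory Num.Theory.
Import numFieldNormedType.Exports.
Local Open Scope classical_set_scope.
Local Open Scope ring_scope.

(* f is C^k on D (an interval) with interior O: d 0 = f, d (j+1) is the
   derivative of d j at every point of O (j < k), and every d j (j <= k)
   is continuous on D (i.e. extends continuously to the endpoints in D). *)
Definition is_Ck_on {R : realType} (D O : set R) (k : nat) (f : R -> R)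
  (d : nat -> R -> R) : Prop :=
  d 0%N = f /\
  (forall j : nat, (j < k)%N -> forall x, O x -> is_derive x 1 (d j) (d j.+1 x)) /\
  (forall j : nat, (j <= k)%N -> {within D, continuous (d j)}).

Definition monotone_on {R : realType} (D : set R) (f : R -> R) : Prop :=
  {in D &, {homo f : x y / x <= y}} \/ {in D &, {homo f : x y / y <= x >-> x <= y}}.

(* phase of K_{eps,beta}: K(x) = exp(i*phase x)/x, since
   e^{i gamma(x)} x^{-1-i beta} psi(x)^{i beta}
     = x^{-1} exp(i (gamma x - beta ln x + beta ln psi x)) for x, psi x > 0 *)
Definition Kphase {R : realType} (gam psi : R -> R) (beta x : R) : R :=
  gam x + beta * (ln (psi x) - ln x).

Definition Kre {R : realType} (gam psi : R -> R) (eps beta x : R) : R :=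
  if (eps <= x) && (x <= 1) then cos (Kphase gam psi beta x) / x else 0.
Definition Kim {R : realType} (gam psi : R -> R) (eps beta x : R) : R :=
  if (eps <= x) && (x <= 1) then sin (Kphase gam psi beta x) / x else 0.

(* f = fr + i fi ; (T f)(x) = (K * f)(x) = \int K(y) f(x - y) dy *)
Definition Tre {R : realType} (gam psi : R -> R) (eps beta : R)
  (fr fi : R -> R) (x : R) : R :=
  Rintegral (@lebesgue_measure R) setT
    (fun y => Kre gam psi eps beta y * fr (x - y) - Kim gam psi eps beta y * fi (x - y)).
Definition Tim {R : realType} (gam psi : R -> R) (eps beta : R)
  (fr fi : R -> R) (x : R) : R :=
  Rintegral (@lebesgue_measure R) setT
    (fun y => Kre gam psi eps beta y * fi (x - y) + Kim gam psi eps beta y * fr (x - y)).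

Definition Tabs {R : realType} (gam psi : R -> R) (eps beta : R)
  (fr fi : R -> R) (x : R) : R :=
  Num.sqrt (Tre gam psi eps beta fr fi x ^+ 2 + Tim gam psi eps beta fr fi x ^+ 2).

(* Main.v *)
Require Import Defs.
From HB Require Import structures.
From mathcomp Require Import all_boot all_order all_algebra.
From mathcomp Require Import all_classical all_reals all_analysis.
From mathcomp Require Import measurable_realfun ring lra zify.
Import Order.TTheory GRing.Theory Num.Theory.
Import numFieldNormedType.Exports.
Local Open Scope classical_set_scope.
Local Open Scope ring_scope.

(** Put [g = gamma'] and [h = - gamma''].  Near the origin (a.2)-(a.4) give, for
    some integer [Q], [2 Q g(x) <= g(x / Q)] and [1/x + |psi'/psi| <= C h/g], so the
    full phase [th] has derivative [g + O(|beta| h/g)].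

    Two estimates on the kernel [k = exp(i th) / x] cut to [[eps, T]] are used, with
    Q-adic scales [l_n = T / Q^n] and [delta_n = 1 / g(l_n)].  The variation of [k]
    beyond distance [2 l_n] under a translation by [s <= delta_n] is
    [O(1 + |beta|)] in L^1.  Its autocorrelation at [u] is [O((1 + |beta|) / l_n)]
    when [delta_(n+1) < u <= delta_n]; this follows from one integration by
    parts, in which the oscillation compensates the size of the kernel.

    For a finite sum of point masses, stop at the largest Q-adic cell whose mass
    exceeds [alpha] times its length.  Outside a union of triples of heavy cells,
    each mass stopped at level [n] may be spread evenly over an interval of length
    [delta_n], with an error controlled in L^1 by the first estimate.  The spread
    masses are controlled in L^2 by the second one, since the stopping rule bounds
    their mass in every window.  Integrable functions are limits of point masses on
    a grid, and the part of the kernel on [[T, 1]] is bounded. *)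

(** * Translations and integration by parts *)

(** At distance [l] from the origin the phase has frequency [g l], so the kernel is stable only
    under translations by [1 / g l], a length much shorter than [l]. Smoothing a stopped mass over
    its whole cell is therefore not allowed, and smoothing over the shorter length leaves a function
    with no useful L^1 bound; only oscillation, through almost orthogonality in L^2, controls it.
    Growth stays linear in [|beta|] because both kernel estimates are affine in the perturbation
    constant [b], and the square integral of the smoothed part is linear in the autocorrelation, so
    Chebyshev's inequality involves the autocorrelation bound only to the first power. Cosine and
    sine parts travel as a pair: only the sum of their autocorrelations reduces to the cosine of a
    phase difference, a single one also contains the phase sum. Point masses make the stopping
    argument a matter of finite sums, and the even spreading itself is replaced by finitely many
    equally spaced copies. *)

Lemma lebesgue_measure_shift {R : realType} (a : R) (A : set (measurableTypeR R)) :
  measurable A ->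
  pushforward (@lebesgue_measure R)
    ((fun x => x + a) : measurableTypeR R -> measurableTypeR R) A = lebesgue_measure A.
Proof.
move=> mA.
pose phi : measurableTypeR R -> measurableTypeR R := fun x => x + a.
have mphi : measurable_fun [set: measurableTypeR R] phi.
  by apply: measurable_funD => //; exact: measurable_cst.
pose mphi' : {mfun measurableTypeR R >-> measurableTypeR R} :=
  HB.pack phi (isMeasurableFun.Build _ _ _ _ phi mphi).
change (pushforward (@lebesgue_measure R) mphi' A = lebesgue_measure A).
apply/esym/lebesgue_measure_unique => //= _ [[x y]] _ <-.
rewrite /pushforward /=.
have -> : phi @^-1` `]x, y] = `]x - a, y - a]%classic.
  by apply/seteqP; split => z /=; rewrite !in_itv/= ltrBlDr lerBrDr.
rewrite !lebesgue_measure_itv/= !lte_fin ltrD2r.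
by case: ifP => // _; rewrite -!EFinD; congr (_%:E); ring.
Qed.

Lemma ge0_integral_shift {R : realType} (f : R -> \bar R) (a : R) :
  measurable_fun setT f -> (forall x, 0 <= f x)%E ->
  (\int[@lebesgue_measure R]_x f (x + a)%R = \int[@lebesgue_measure R]_x f x)%E.
Proof.
move=> mf f0.
pose phi : measurableTypeR R -> measurableTypeR R := fun x => x + a.
have mphi : measurable_fun [set: measurableTypeR R] phi.
  by apply: measurable_funD => //; exact: measurable_cst.
have := @ge0_integral_pushforward _ _ _ _ R _ mphi lebesgue_measure setT f measurableT mf (fun y _ => f0 y).
rewrite preimage_setT => <-.
by apply: eq_measure_integral => //= A mA _; exact: lebesgue_measure_shift.
Qed.

Lemma integral_shift {R : realType} (f : R -> \bar R) (a : R) :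
  measurable_fun setT f ->
  (\int[@lebesgue_measure R]_x f (x + a)%R = \int[@lebesgue_measure R]_x f x)%E.
Proof.
move=> mf; have mfp := measurable_funepos mf.
have mfn := measurable_funeneg mf.
rewrite integralE [RHS]integralE; congr (_ - _)%E.
  rewrite -(ge0_integral_shift _ a mfp (funepos_ge0 f)).
  by apply: eq_integral => x _; rewrite !funeposE.
rewrite -(ge0_integral_shift _ a mfn (funeneg_ge0 f)).
by apply: eq_integral => x _; rewrite !funenegE.
Qed.

(* [v] is [H'] up to an error dominated by [D'], so its integral is the
   increment of [H] up to the increment of [D]. *)
Lemma le_integral_of_derive {R : realType} (c d : R) (v H H' D D' : R -> R) :
  c <= d ->
  (forall x, c <= x <= d -> {for x, continuous v}) ->
  (forall x, c <= x <= d -> is_derive x 1 H (H' x)) ->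
  (forall x, c <= x <= d -> is_derive x 1 D (D' x)) ->
  (forall x, c <= x <= d -> `|v x - H' x| <= D' x) ->
  `|\int[@lebesgue_measure R]_(x in `[c, d]) v x| <= `|H d - H c| + (D d - D c).
Proof.
rewrite le_eqVlt => /orP[/eqP <-|cd] cv dH dD vHD.
  by rewrite set_itv1 Rintegral_set1 !subrr !normr0 addr0.
have cvw : {within `[c, d], continuous v}.
  apply: continuous_in_subspaceT => x; rewrite inE/= in_itv/= => /cv; exact.
have iv : (@lebesgue_measure R).-integrable `[c, d] (EFin \o v).
  by apply: continuous_compact_integrable => //; exact: segment_compact.
pose P x := \int[@lebesgue_measure R]_(t in `[c, x]) v t.
have cP : {within `[c, d], continuous P}.
  exact: (parameterized_integral_continuous (ltW cd) iv).
have dP x : c < x < d -> is_derive x 1 P (v x).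
  move=> /andP[cx xd].
  have cvx : {for x, continuous v} by apply: cv; rewrite (ltW cx) (ltW xd).
  have [dP Pv] := continuous_FTC1_closed xd iv cx cvx.
  by rewrite -Pv derive1E; apply: derivableP.
have Pc : P c = 0 by rewrite /P set_itv1 Rintegral_set1.
(* Used with [e = 1] and [e = -1]: the mean value theorem for [e (P - H) - D], whose derivative is
   nonpositive. *)
have key (e : R) : `|e| = 1 -> e * (P d - (H d - H c)) <= D d - D c.
  move=> e1.
  pose F x := e * (P x - H x) - D x.
  have dF x : x \in `]c, d[ -> is_derive x 1 F (e * (v x - H' x) - D' x).
    rewrite in_itv/= => /andP[cx xd].
    have xcd : c <= x <= d by rewrite (ltW cx) (ltW xd).
    have dP' := dP x; rewrite cx xd in dP'.
    have := dP' isT; have := dH _ xcd; have := dD _ xcd => ? ? ?.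
    by apply: is_deriveB; apply: is_deriveZ.
  have cF : {within `[c, d], continuous F}.
    have cw (G G' : R -> R) : (forall x, c <= x <= d -> is_derive x 1 G (G' x)) ->
      {within `[c, d], continuous G}.
      move=> dG; apply: derivable_within_continuous => x; rewrite in_itv/= => /dG.
      by case.
    move=> x; apply: cvgB; last exact: (cw _ _ dD).
    by apply: cvgM; [exact: cvg_cst|apply: cvgB; [exact: cP|exact: (cw _ _ dH)]].
  have [x xcd] := MVT cd dF cF.
  have xcd' : c <= x <= d by move: xcd; rewrite in_itv/= => /andP[/ltW -> /ltW ->].
  rewrite /F Pc => E.
  have E2 : e * (P d - (H d - H c)) - (D d - D c) = (e * (v x - H' x) - D' x) * (d - c).
    by rewrite -E; ring.
  rewrite -subr_le0 E2; apply: mulr_le0_ge0; last by rewrite subr_ge0 ltW.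
  rewrite subr_le0; apply: le_trans (vHD _ xcd').
  by apply: le_trans (ler_norm _) _; rewrite normrM e1 mul1r.
have k1 := key 1 (normr1 _); have k2 := key (-1).
rewrite normrN normr1 in k2; have := k2 erefl => {}k2.
rewrite -[X in `|X|](subrK (H d - H c)) addrC.
apply: le_trans (ler_normD _ _) _; rewrite lerD2l ler_norml.
by move: k1 k2; rewrite -/(P d); lra.
Qed.

Lemma integral_scaled_indic_itv {R : realType} (a s c : R) : 0 <= c -> 0 <= s ->
  (\int[@lebesgue_measure R]_x (c * \1_`[a, (a + s)] x)%:E = (c * s)%:E)%E.
Proof.
move=> c0 s0.
under eq_integral do rewrite EFinM.
have mI : measurable_fun [set: R] (fun x : R => (\1_`[a, (a + s)] x : R)%:E).
  by apply/measurable_EFinP; exact: measurable_indic.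
rewrite (ge0_integralZl lebesgue_measure measurableT mI) ?lee_fin//.
rewrite integral_indic// setIT EFinM; congr (_ * _)%E.
have := lebesgue_measure_itv `[a, a + s]; rewrite /= => ->.
rewrite lte_fin ltrDl; case: ltP => s1; first by rewrite -EFinD addrC addKr.
by congr EFin; apply/eqP; rewrite eq_le s0 s1.
Qed.

(** * Oscillatory integrals with phase close to [gamma] *)

Lemma le_increment_of_derive {R : realType} (c d : R) (F F' G G' : R -> R) :
  c <= d ->
  (forall x, c <= x <= d -> is_derive x 1 F (F' x)) ->
  (forall x, c <= x <= d -> is_derive x 1 G (G' x)) ->
  (forall x, c <= x <= d -> F' x <= G' x) ->
  F d - F c <= G d - G c.
Proof.
rewrite le_eqVlt => /orP[/eqP <-|cd] dF dG FG; first by rewrite !subrr.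
pose H x := G x - F x.
have dH x : c <= x <= d -> is_derive x 1 H (G' x - F' x).
  by move=> xcd; have := dF _ xcd; have := dG _ xcd => ? ?; apply: is_deriveB.
have cH : {within `[c, d], continuous H}.
  apply: derivable_within_continuous => x; rewrite in_itv/= => /dH.
  by case.
have dH' x : x \in `]c, d[ -> is_derive x 1 H (G' x - F' x).
  by rewrite in_itv/= => /andP[/ltW cx /ltW xd]; apply: dH; rewrite cx.
have [x xcd E] := MVT cd dH' cH.
have xcd' : c <= x <= d by move: xcd; rewrite in_itv/= => /andP[/ltW -> /ltW ->].
suff : 0 <= H d - H c by rewrite /H; lra.
by rewrite E mulr_ge0 // subr_ge0 ?FG // ltW.
Qed.

Lemma exists_antiderivative {R : realType} (a b : R) (f : R -> R) :
  (forall x, a < x < b -> {for x, continuous f}) ->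
  forall c d, a < c -> d < b ->
  exists F : R -> R, forall x, c <= x <= d -> is_derive x 1 F (f x).
Proof.
move=> cf c d ac db.
have [dc|cd] := ltP d c.
  by exists f => x /andP[cx xd]; lra.
(* The interval is widened so that [c] and [d] become interior points, as the fundamental theorem of
   calculus requires. *)
pose a' := (a + c) / 2; pose b' := (d + b) / 2.
have fi : (@lebesgue_measure R).-integrable `[a', b'] (EFin \o f).
  apply: continuous_compact_integrable; first exact: segment_compact.
  apply: continuous_in_subspaceT => x; rewrite inE/= in_itv/= => xab.
  by apply: cf; rewrite /a' /b' in xab; lra.
exists (fun x => \int[@lebesgue_measure R]_(t in `[a', x]) f t) => x xcd.
have xb' : x < b' by rewrite /b'; lra.
have ax' : a' < x by rewrite /a'; lra.
have cfx : {for x, continuous f} by apply: cf; lra.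
have [dP <-] := continuous_FTC1_closed xb' fi ax' cfx.
by rewrite derive1E; apply: derivableP.
Qed.

Lemma is_derive_continuous {R : realType} (f : R -> R) (x l : R) :
  is_derive x 1 f l -> {for x, continuous f}.
Proof. by case => df _; apply/differentiable_continuous/derivable1_diffP. Qed.

Lemma is_derive_inv {R : realType} (f : R -> R) (x t : R) :
  is_derive x 1 f t -> f x != 0 ->
  is_derive x 1 (fun z => (f z)^-1) (- t / f x ^+ 2).
Proof.
move=> df fx; apply: (is_derive_eq (is_deriveV fx df)).
by rewrite /GRing.scale /= mulNr mulrC mulNr.
Qed.

Lemma is_derive_mul {R : realType} (f1 f2 : R -> R) (x t1 t2 : R) :
  is_derive x 1 f1 t1 -> is_derive x 1 f2 t2 ->
  is_derive x 1 (fun z => f1 z * f2 z) (f1 x * t2 + f2 x * t1).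
Proof. by move=> d1 d2; apply: is_deriveM. Qed.

Lemma is_derive_comp_shift {R : realType} (f : R -> R) (u x l : R) :
  is_derive (x + u) 1 f l -> is_derive x 1 (fun z => f (z + u)) l.
Proof.
move=> df; rewrite -[l]mulr1.
have ds : is_derive x 1 (fun z : R => z + u) (1 : R).
  by apply: (is_derive_eq (is_deriveD (is_derive_id x (1 : R)) (is_derive_cst u x 1))); rewrite addr0.
exact: (@is_derive1_comp _ f (fun z : R => z + u) x l 1 df ds).
Qed.

(* [g] and [h] play the roles of [gamma'] and [-gamma''] near the origin, and
   [th] is the full phase of the kernel, whose derivative differs from [g] by
   at most [b h / g] with [b] proportional to [|beta|].  The kernel will be cut
   at [T]; everything is assumed on a slightly longer interval. *)
Set Implicit Arguments.
Record admissible_phase {R : realType} (Q : nat) (T T' C0 b : R)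
    (g h th th' : R -> R) : Prop := AdmissiblePhase {
  phase_ratio : (2 <= Q)%N ;
  phase_derive : forall x : R, 0 < x < T' -> is_derive x 1 g (- h x) ;
  phase_gt0 : forall x : R, 0 < x < T' -> 0 < g x ;
  phase_ge0 : forall x : R, 0 < x < T' -> 0 <= h x ;
  phase_decr : forall x y : R, 0 < x -> x <= y -> y < T' -> h y <= h x ;
  phase_growth : forall x : R, 0 < x < T' -> 2 * Q%:R * g x <= g (x / Q%:R) ;
  phase_log : forall x : R, 0 < x < T' -> x^-1 <= C0 * (h x / g x) ;
  phase_derive_th : forall x : R, 0 < x < T' -> is_derive x 1 th (th' x) ;
  phase_perturbation :
    forall x : R, 0 < x < T' -> `|th' x - g x| <= b * (h x / g x) ;
  phase_C0_ge0 : 0 <= C0 ;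
  phase_b_ge0 : 0 <= b ;
  phase_cut : 0 < T < T' ;
  phase_cut_small : (T * g T)^-1 <= (2 * Q%:R)^-1 }.
Unset Implicit Arguments.

Definition trunc_kernel {R : realType} (T : R) (th tr : R -> R) (eps x : R) : R :=
  if (eps <= x) && (x <= T) then tr (th x) / x else 0.

Lemma measurable_trunc_kernel_continuous {R : realType} (T eps : R) (th tr : R -> R) :
  0 < eps -> (forall x : R, eps < x < T -> {for x, continuous th}) -> continuous tr ->
  measurable_fun setT (trunc_kernel T th tr eps).
Proof.
move=> e0 cth ctr.
have -> : trunc_kernel T th tr eps = ((fun x => tr (th x) / x) \_ `[eps, T]).
  apply/funext => x; rewrite patchE /trunc_kernel.
  case: ifPn => [xe|xe].
    by rewrite mem_set//= in_itv.
  by rewrite memNset//= in_itv/=; exact/negP.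
apply/(measurable_restrictT (fun x => tr (th x) / x)); first exact: measurable_itv.
apply: (@measurable_fun_itv_cc _ _ _ false true).
apply: subspace_continuous_measurable_fun; first exact: measurable_itv.
apply: continuous_in_subspaceT => x; rewrite inE/= in_itv/= => xe.
apply: continuousM.
  by apply: continuous_comp; [exact: cth|exact: ctr].
by apply: inv_continuous; rewrite gt_eqF//; lra.
Qed.

(** * Comparison of scales and the oscillatory integral *)

Section phase.
Context {R : realType} {Q : nat} {T T' C0 b : R} {g h th th' : R -> R}.
Hypothesis adm : admissible_phase Q T T' C0 b g h th th'.

Let Q2 := phase_ratio adm.
Let dg := phase_derive adm.
Let g0 := phase_gt0 adm.
Let h0 := phase_ge0 adm.
Let hdec := phase_decr adm.
Let gQ := phase_growth adm.
Let gP := phase_log adm.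
Let dth := phase_derive_th adm.
Let thP := phase_perturbation adm.
Let C0_ge0 := phase_C0_ge0 adm.
Let b_ge0 := phase_b_ge0 adm.
Let T_itv := phase_cut adm.
Let ET := phase_cut_small adm.

Local Notation q := (Q%:R : R).
Local Notation E x := ((x * g x)^-1).

Lemma q_ge2 : 2 <= q. Proof. by rewrite (ler_nat _ 2 Q). Qed.

Lemma g_dec x y : 0 < x -> x <= y -> y < T' -> g y <= g x.
Proof.
move=> x0 xy yT.
have := @le_increment_of_derive _ x y g (fun x => - h x) (cst 0) (cst 0) xy.
rewrite !subrr subr_le0; apply => z xzy.
- by apply: dg; lra.
- by rewrite oppr_le0 h0//; lra.
Qed.

Lemma g_incr x y : 0 < x -> x <= y -> y < T' ->
  (y - x) * h y <= g x - g y <= (y - x) * h x.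
Proof.
move=> x0 xy yT; apply/andP; split.
  have := @le_increment_of_derive _ x y (fun z => h y * z) (fun=> h y) (fun z => - g z) h xy.
  rewrite -mulrBr mulrC opprK [- g y + _]addrC; apply => z xzy.
  - by rewrite -[X in is_derive _ _ _ X]mulr1; apply: is_deriveZ.
  - rewrite -[X in is_derive _ _ _ X]opprK; have ? : is_derive z 1 g (- h z) by apply: dg; lra.
    exact: is_deriveN.
  - by apply: hdec; lra.
have := @le_increment_of_derive _ x y (fun z => - g z) h (fun z => h x * z) (fun=> h x) xy.
rewrite -mulrBr [h x * _]mulrC opprK [- g y + _]addrC; apply => z xzy.
- rewrite -[X in is_derive _ _ _ X]opprK; have ? : is_derive z 1 g (- h z) by apply: dg; lra.
  exact: is_deriveN.
- by rewrite -[X in is_derive _ _ _ X]mulr1; apply: is_deriveZ.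
- by apply: hdec; lra.
Qed.

Lemma E_gt0 x : 0 < x < T' -> 0 < E x.
Proof. by move=> xT; rewrite invr_gt0 mulr_gt0 ?g0//; case/andP: xT. Qed.

Lemma divq_itv x : 0 < x < T' -> 0 < x / q < T'.
Proof.
move=> /andP[x0 xT]; have q2 := q_ge2; have q0 : 0 < q by lra.
by rewrite divr_gt0//= ltr_pdivrMr//; nra.
Qed.

(** The growth hypothesis makes [x * g x] at least double from [x] to [x / q]; this is what makes
    the sums over scales geometric. *)
Lemma E_half x : 0 < x < T' -> E (x / q) <= E x / 2.
Proof.
move=> xT; have x0 : 0 < x by case/andP: xT.
have q2 := q_ge2; have q0 : 0 < q by lra.
have xqT := divq_itv _ xT; have xq0 : 0 < x / q by case/andP: xqT.
have gx := g0 _ xT; have gxq := g0 _ xqT.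
rewrite -invfM lef_pV2 ?posrE; do ?[exact: mulr_gt0]; last by rewrite !mulr_gt0.
have -> : x * g x * 2 = x / q * (2 * q * g x) by field; lra.
by rewrite ler_pM2l// gQ.
Qed.

Lemma exists_expr_ge x y : 0 < x -> exists n, y <= q ^+ n * x.
Proof.
move=> x0; have q2 := q_ge2.
exists (Num.truncn `|y / x|).+1.
rewrite -ler_pdivrMr//; apply: le_trans (ler_norm _) _.
apply: le_trans (ltW (truncnS_gt _)) _.
apply: le_trans (_ : (2 ^ (Num.truncn `|y / x|).+1)%:R <= _).
  by rewrite ler_nat ltnW// ltn_expl.
by rewrite natrX lerXn2r ?nnegrE//; lra.
Qed.

(** [x * g x] need not be monotone. Within one block of ratio [q] the decrease of [g] limits the
    loss to the factor [q]; every further block gains a factor 2 by [E_half], so losses do not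
    accumulate. *)
Lemma E_qmono x y : 0 < x -> x <= y -> y < T' -> E x <= q * E y.
Proof.
move=> x0; have q2 := q_ge2; have [n] := exists_expr_ge x y x0.
elim: n y => [|n IH] y yn xy yT.
  have -> : y = x by apply/eqP; rewrite eq_le xy andbT; rewrite expr0 mul1r in yn.
  by rewrite ler_peMl//; [rewrite ltW// E_gt0; lra|lra].
have y0 : 0 < y by lra.
have [yx|xy'] := leP y (q * x).
  have gy : 0 < g y by apply: g0; lra.
  have gx : 0 < g x by apply: g0; lra.
  rewrite -ler_pdivrMl; last by lra.
  rewrite -invfM lef_pV2 ?posrE ?mulr_gt0//; last by lra.
  rewrite mulrA; apply: ler_pM => //; try lra.
  exact: g_dec.
have yq : y / q < T'.
  by rewrite ltr_pdivrMr; [nra|lra].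
apply: le_trans (IH (y / q) _ _ yq) _.
- by rewrite ler_pdivrMr; [move: yn; rewrite exprSr; lra|lra].
- by rewrite ler_pdivlMr; lra.
have := E_half y; have := E_gt0 y.
have -> : 0 < y < T' by lra.
move=> /(_ isT) E0 /(_ isT) E1.
by rewrite ler_pM2l; lra.
Qed.

(** [g] is convex and drops by at least half between [x] and [q * x]. Comparing chords, its drop
    over [[x, x + u]] is at least the proportional share of that half; beyond [q * x] the whole half
    is available. This drop is the main part of the derivative of the phase difference. *)
Lemma phase_derivative_lower x u : 0 < x -> q * x < T' -> 0 < u -> x + u < T' ->
  u * g x <= 2 * q * (x + u) * (g x - g (x + u)).
Proof.
move=> x0 qx u0 xuT; have q2 := q_ge2.
have xT : 0 < x < T' by lra.
have gx := g0 _ xT.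
have qx0 : 0 < q * x by nra.
have gqx : 2 * q * g (q * x) <= g x.
  have := gQ (q * x); rewrite qx0 qx [q * x]mulrC mulfK; last by lra.
  exact.
have gqx0 : 0 < g (q * x) by apply: g0; lra.
have half : g (q * x) <= g x / 2 by nra.
have [qxu|xuq] := leP (q * x) (x + u).
  have := g_dec _ _ qx0 qxu xuT => gxu.
  have : g x / 2 <= g x - g (x + u) by lra.
  move=> H.
  have : 2 * q * u * (g x / 2) <= 2 * q * (x + u) * (g x - g (x + u)).
    by apply: ler_pM; nra.
  apply: le_trans.
  have : u * g x <= q * (u * g x) by rewrite ler_peMl//; [nra|lra].
  by lra.
have xu1 : x <= x + u by lra.
have /andP[l1 _] := g_incr _ _ x0 xu1 xuT.
have xu0 : 0 < x + u by lra.
have /andP[_ l2] := g_incr _ _ xu0 (ltW xuq) qx.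
set w := g x - g (x + u) in l1 *.
have h1 : 0 <= h (x + u) by apply: h0; lra.
have H1 : g x / 2 <= w + (q * x - (x + u)) * h (x + u) by rewrite /w; lra.
have uw : (x + u - x) * h (x + u) = u * h (x + u) by ring.
have H2 : u * (g x / 2) <= u * w + (q * x - (x + u)) * w.
  apply: le_trans (_ : u * (w + (q * x - (x + u)) * h (x + u)) <= _).
    by rewrite ler_pM2l.
  by nra.
have w0 : 0 <= w by nra.
have : u * (g x / 2) <= q * x * w by nra.
by nra.
Qed.

(** The derivative of [E] is [E h / g - 1 / (x^2 g)], so [E] plus a primitive [J] of [1 / (x^2 g)]
    is a primitive of [E h / g]. A block of ratio [q] ending at [y] adds at most [q * E y] to [J],
    and [E_half] sums the blocks to [2 q E]. The potential will absorb the errors of the integration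
    by parts. *)
Lemma exists_potential c d : 0 < c -> d < T' ->
  exists S : R -> R, forall x, c <= x <= d ->
    is_derive x 1 S (E x * (h x / g x)) /\ 0 <= S x <= (1 + 2 * q) * E x.
Proof.
move=> c0 dT; have q2 := q_ge2.
pose f x := (x ^+ 2 * g x)^-1.
have dE x : 0 < x < T' -> is_derive x 1 (fun z => (z * g z)^-1) (E x * (h x / g x) - f x).
  move=> xT; have gx := g0 _ xT; have dgx := dg _ xT.
  have ne : x * g x != 0 by rewrite mulf_neq0// gt_eqF//; lra.
  have dM := is_derive_mul _ _ _ _ _ (is_derive_id x (1 : R)) dgx.
  apply: (is_derive_eq (is_derive_inv _ _ _ dM ne)); rewrite /f /GRing.scale /=; field.
  by apply/andP; split; lra.
have [J dJ] : exists J : R -> R, forall x, c <= x <= d -> is_derive x 1 J (f x).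
  apply: (exists_antiderivative 0 T') => // x xT.
  have gx := g0 _ xT.
  apply: continuousV; first by rewrite mulf_neq0 ?expf_neq0// gt_eqF//; lra.
  apply: continuousM; first exact: exprn_continuous.
  by apply: is_derive_continuous; exact: dg.
have Jb x : c <= x <= d -> 0 <= J x - J c <= 2 * q * E x.
  move=> xcd; apply/andP; split.
    have := @le_increment_of_derive _ c x (cst 0) (cst 0) J f.
    rewrite subrr; apply; first by lra.
    + by move=> z zx; apply: dJ; lra.
    + move=> z zx; rewrite /= invr_ge0 mulr_ge0 ?sqr_ge0// ltW// g0//; lra.
  have [n] := exists_expr_ge c x c0.
  have step e y : c <= e -> e <= y -> y <= d -> y <= q * e -> J y - J e <= q * E y.
    move=> ce ey yd yqe.
    have gy : 0 < g y by apply: g0; lra.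
    apply: le_trans (_ : - (g y)^-1 * y^-1 - (- (g y)^-1 * e^-1) <= _).
      apply: (@le_increment_of_derive _ e y J f (fun z => - (g y)^-1 * z^-1)
        (fun z => (g y)^-1 * (z ^+ 2)^-1)) => // z zey.
      - by apply: dJ; lra.
      - have z0 : z != 0 by rewrite gt_eqF//; lra.
        have dV := is_derive_inv _ _ _ (is_derive_id z (1 : R)) z0.
        apply: (is_derive_eq (is_deriveZ (- (g y)^-1) dV)); rewrite /GRing.scale /=; field.
        by apply/andP; split => //; lra.
      - have gz : 0 < g z by apply: g0; lra.
        rewrite /f -invfM lef_pV2 ?posrE ?mulr_gt0 ?exprn_gt0//; try lra.
        rewrite mulrC ler_pM2l ?exprn_gt0//; last by lra.
        by apply: g_dec; lra.
    rewrite invfM mulrA mulrC -[_ * e^-1]mulrC mulrN mulrN opprK addrC.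
    have y0 : 0 < y by lra.
    have e0 : 0 < e by lra.
    have yi : 0 < y^-1 by rewrite invr_gt0.
    have gi : 0 < (g y)^-1 by rewrite invr_gt0.
    have : e^-1 <= q * y^-1.
      by rewrite ler_pdivlMr// mulrC ler_pdivrMr.
    by nra.
  elim: n x xcd => [|n IH] x xcd xn.
    have -> : x = c by rewrite expr0 mul1r in xn; lra.
    have Ec : 0 < E c by apply: E_gt0; lra.
    by rewrite subrr; nra.
  have x0 : 0 < x < T' by lra.
  have E0 := E_gt0 _ x0.
  have [xqc|cqx] := leP x (q * c).
    apply: le_trans (step c x _ _ _ xqc) _; try lra.
    by nra.
  have xqx : x / q <= x by rewrite ler_pdivrMr; nra.
  have cxq : c <= x / q by rewrite ler_pdivlMr; lra.
  have xqd : c <= x / q <= d by lra.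
  have xqn : x / q <= q ^+ n * c.
    by rewrite ler_pdivrMr; [rewrite exprSr in xn; lra|lra].
  have H1 := IH _ xqd xqn.
  have E1 := E_half _ x0.
  have xxq : x <= q * (x / q) by rewrite [q * _]mulrC divfK//; lra.
  have xd : x <= d by lra.
  have := step (x / q) x cxq xqx xd xxq.
  by nra.
exists (fun x => E x + (J x - J c)) => x xcd.
have x0 : 0 < x < T' by lra.
split; last by have := Jb _ xcd; have := E_gt0 _ x0; lra.
apply: (is_derive_eq (is_deriveD (dE _ x0) (is_deriveB (dJ _ xcd) (is_derive_cst (J c) x 1)))).
by rewrite subr0 subrK.
Qed.


(** The integrand is [r * w * cos Th] with [r = 1 / (x (x + u) w)], and [w] is the derivative of
    [Th] up to the perturbation; hence [sin Th * r] is an approximate primitive. The errors, due to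
    [r'] and to the perturbation, are dominated by the derivative of [Dd]. *)
Lemma oscillatory_integral_bound (c d u : R) :
  0 < c -> c <= d -> q * d < T' -> 0 < u -> d + u < T' ->
  `|\int[@lebesgue_measure R]_(x in `[c, d])
      (cos (th x - th (x + u)) / (x * (x + u)))| <=
  (4 * q ^+ 2 + 2 * q ^+ 2 * (4 * C0 + b) * (1 + 2 * q) * (q + 1)) / u * E (d + u).
Proof.
move=> c0 cd qd u0 duT; have q2 := q_ge2.
pose w x := g x - g (x + u).
pose w' x := - h x + h (x + u).
pose m x := x * (x + u) * w x.
pose r x := (m x)^-1.
(* [2 q] comes from [rb] and the other [q] from comparing [E x] with [E (x + u)]; [4 C0] pays for
   the part of [r] that may decrease, [b] for the perturbation of the phase. *)
pose K0 := 2 * q ^+ 2 * (4 * C0 + b).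
have [S HS] := exists_potential c (d + u) c0 duT.
have itv x : c <= x <= d -> [/\ 0 < x, 0 < x < T', 0 < x + u < T' & q * x < T'].
  by move=> xcd; split; nra.
have wlow x : c <= x <= d -> u * g x <= 2 * q * (x + u) * w x.
  by move=> /itv[x0 xT /andP[_ xu] qx]; apply: phase_derivative_lower.
have w0 x : c <= x <= d -> 0 < w x.
  move=> xcd; have := wlow _ xcd; have [x0 xT xu qx] := itv _ xcd.
  have := g0 _ xT; move=> gx wl.
  rewrite ltNge; apply/negP => wn.
  have : 0 < u * g x by apply: mulr_gt0.
  have : 2 * q * (x + u) * w x <= 0 by apply: mulr_ge0_le0 => //; nra.
  by lra.
have m0 x : c <= x <= d -> 0 < m x.
  by move=> xcd; have [x0 xT xu qx] := itv _ xcd; rewrite !mulr_gt0 ?w0//; lra.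
have rb x : c <= x <= d -> r x <= 2 * q / u * E x.
  move=> xcd; have [x0 xT xu qx] := itv _ xcd; have gx := g0 _ xT.
  rewrite /r -[2 * q / u]invrK -invfM lef_pV2 ?posrE ?m0//; last first.
    by rewrite mulr_gt0 ?invr_gt0 ?divr_gt0 ?mulr_gt0//; lra.
  rewrite invf_div mulrAC ler_pdivrMr; last by lra.
  have := wlow _ xcd; rewrite /m => wl.
  have : x * (u * g x) <= x * (2 * q * (x + u) * w x) by rewrite ler_pM2l.
  by lra.
have dw x : c <= x <= d -> is_derive x 1 w (w' x).
  move=> /itv[x0 xT xu qx]; rewrite /w' -[h (x + u)]opprK.
  exact: is_deriveB (dg _ xT) (is_derive_comp_shift _ _ _ _ (dg _ xu)).
pose m' x := (x + u + x) * w x + x * (x + u) * w' x.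
have dm x : c <= x <= d -> is_derive x 1 m (m' x).
  move=> xcd.
  have d1 : is_derive x 1 (fun z : R => z + u) (1 : R).
    exact: is_derive_comp_shift (is_derive_id (x + u) (1 : R)).
  have d2 := is_derive_mul _ _ _ _ _ (is_derive_id x (1 : R)) d1.
  apply: (is_derive_eq (is_derive_mul _ _ _ _ _ d2 (dw _ xcd))).
  by rewrite /m'; ring.
have dr x : c <= x <= d -> is_derive x 1 r (- m' x / m x ^+ 2).
  by move=> xcd; apply: is_derive_inv (dm _ xcd) _; rewrite gt_eqF// m0.
pose Th x := th x - th (x + u).
pose Th' x := th' x - th' (x + u).
have dTh x : c <= x <= d -> is_derive x 1 Th (Th' x).
  move=> /itv[x0 xT xu qx].
  exact: is_deriveB (dth _ xT) (is_derive_comp_shift _ _ _ _ (dth _ xu)).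
have dH x : c <= x <= d ->
    is_derive x 1 (fun z => sin (Th z) * r z)
      (sin (Th x) * (- m' x / m x ^+ 2) + r x * (cos (Th x) * Th' x)).
  move=> xcd; apply: is_derive_mul (dr _ xcd).
  exact: (@is_derive1_comp _ sin Th x _ _ (is_derive_sin _) (dTh _ xcd)).
pose Dd x := r x + K0 / u * (S x + S (x + u)).
pose e x := E x * (h x / g x).
have dD x : c <= x <= d ->
    is_derive x 1 Dd (- m' x / m x ^+ 2 + K0 / u * (e x + e (x + u))).
  move=> xcd; have xcd1 : c <= x <= d + u by lra.
  have xcd2 : c <= x + u <= d + u by lra.
  have [dS1 _] := HS _ xcd1; have [dS2 _] := HS _ xcd2.
  apply: is_deriveD (dr _ xcd) _; apply: is_deriveZ.
  exact: is_deriveD dS1 (is_derive_comp_shift _ _ _ _ dS2).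
have cv x : c <= x <= d ->
    {for x, continuous (fun x => cos (th x - th (x + u)) / (x * (x + u)))}.
  move=> xcd; have [x0 xT xu qx] := itv _ xcd.
  apply: continuousM.
    apply: continuous_comp; last exact: continuous_cos.
    exact: is_derive_continuous (dTh _ xcd).
  apply: continuousV; first by rewrite mulf_neq0// gt_eqF//; lra.
  apply: continuousM; first exact: cvg_id.
  by apply: continuousD; [exact: cvg_id|exact: cvg_cst].
have err x : c <= x <= d ->
    `|cos (th x - th (x + u)) / (x * (x + u)) -
      (sin (Th x) * (- m' x / m x ^+ 2) + r x * (cos (Th x) * Th' x))| <=
    - m' x / m x ^+ 2 + K0 / u * (e x + e (x + u)).
  move=> xcd; have [x0 xT xu _] := itv _ xcd.
  have mx := m0 _ xcd; have wx := w0 _ xcd.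
  have rx : 0 < r x by rewrite invr_gt0.
  have xu0 : 0 < x + u by case/andP: xu.
  have -> : cos (th x - th (x + u)) / (x * (x + u)) = r x * (cos (Th x) * w x).
    by rewrite /r /m /Th; field; rewrite (gt_eqF xu0) (gt_eqF x0) (gt_eqF wx).
  have -> : r x * (cos (Th x) * w x) -
      (sin (Th x) * (- m' x / m x ^+ 2) + r x * (cos (Th x) * Th' x)) =
      r x * (cos (Th x) * (w x - Th' x)) - sin (Th x) * (- m' x / m x ^+ 2) by ring.
  apply: le_trans (ler_normB _ _) _.
  rewrite !normrM (ger0_norm (ltW rx)).
  have cs : `|cos (Th x)| <= 1 by rewrite ler_norml cos_geN1 cos_le1.
  have sn : `|sin (Th x)| <= 1 by rewrite ler_norml sin_geN1 sin_le1.
  have w'x : w' x <= 0.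
    by rewrite /w' addrC subr_le0; apply: hdec; [|rewrite lerDl ltW|case/andP: xu].
  pose A := r x * (2 / x).
  (* The part of [m'] containing [w' <= 0] makes [r] increase, so it is kept as [r'] itself and
     integrates exactly. Only the other part [p] is estimated; passing from [r'] to its absolute
     value costs it twice, whence [2 * A]. *)
  have mb : `|- m' x| * `|(m x ^+ 2)^-1| <= - m' x / m x ^+ 2 + 2 * A.
    pose p := (x + u + x) * w x; pose n := x * (x + u) * w' x.
    have p0 : 0 <= p by rewrite mulr_ge0 ?ltW// addr_gt0.
    have n0 : n <= 0 by rewrite mulr_ge0_le0// ltW// mulr_gt0.
    have m'E : m' x = p + n by [].
    have i0 : 0 <= (m x ^+ 2)^-1 by rewrite invr_ge0 sqr_ge0.
    have pr : p * r x <= 2 / x.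
      have -> : p * r x = (x + u + x) / (x * (x + u)).
        by rewrite /p /r /m; field; rewrite (gt_eqF xu0) (gt_eqF x0) (gt_eqF wx).
      rewrite ler_pdivrMr ?mulr_gt0//.
      have -> : 2 / x * (x * (x + u)) = 2 * (x + u) by field; rewrite (gt_eqF x0).
      by lra.
    have pA : p * (m x ^+ 2)^-1 <= A.
      have -> : p * (m x ^+ 2)^-1 = r x * (p * r x) by rewrite /r expr2 invfM; ring.
      by rewrite /A ler_pM2l.
    have : `|- m' x| <= p - n by rewrite m'E ler_norml; lra.
    rewrite (ger0_norm i0) => mpn.
    apply: le_trans (ler_wpM2r i0 mpn) _.
    by rewrite m'E; lra.
  pose qx := h x / g x; pose qu := h (x + u) / g (x + u).
  have gx := g0 _ xT; have gu := g0 _ xu.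
  have qx0 : 0 <= qx by rewrite divr_ge0 ?h0// ltW.
  have qu0 : 0 <= qu by rewrite divr_ge0 ?h0// ltW.
  have wTh : `|w x - Th' x| <= b * qx + b * qu.
    have -> : w x - Th' x = (th' (x + u) - g (x + u)) - (th' x - g x).
      by rewrite /w /Th'; ring.
    apply: le_trans (ler_normB _ _) _.
    by rewrite addrC lerD ?thP.
  have A0 : A <= r x * (2 * C0 * qx).
    by rewrite /A ler_pM2l// -mulrA ler_pM2l// gP.
  have t1 : r x * (`|cos (Th x)| * `|w x - Th' x|) <= r x * (b * qx + b * qu).
    rewrite ler_pM2l//; apply: le_trans wTh.
    by rewrite ler_piMl.
  have t2 : `|sin (Th x)| * (`|- m' x| * `|(m x ^+ 2)^-1|) <=
      - m' x / m x ^+ 2 + 2 * A.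
    by apply: le_trans mb; rewrite ler_piMl// mulr_ge0.
  have Ex := E_gt0 _ xT; have Eu := E_gt0 _ xu.
  have Exu : E x <= q * E (x + u).
    by apply: E_qmono x0 _ _; [rewrite lerDl ltW|case/andP: xu].
  have t3 : r x * (2 * (2 * C0 * qx) + (b * qx + b * qu)) <=
      K0 / u * (e x + e (x + u)).
    apply: le_trans (_ : r x * ((4 * C0 + b) * (qx + qu)) <= _).
      by rewrite ler_pM2l//; have := mulr_ge0 C0_ge0 qu0; lra.
    apply: le_trans (_ : 2 * q / u * E x * ((4 * C0 + b) * (qx + qu)) <= _).
      by rewrite ler_wpM2r ?rb// mulr_ge0// ?addr_ge0// mulr_ge0.
    have -> : 2 * q / u * E x * ((4 * C0 + b) * (qx + qu)) =
        2 * q * (4 * C0 + b) / u * (E x * (qx + qu)) by ring.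
    have -> : K0 / u * (e x + e (x + u)) =
        2 * q * (4 * C0 + b) / u * (q * (e x + e (x + u))) by rewrite /K0; ring.
    apply: ler_wpM2l.
      by rewrite divr_ge0 ?(ltW u0)// mulr_ge0// ?addr_ge0// mulr_ge0//; lra.
    rewrite /e -/qx -/qu.
    have e1 := ler_wpM2r qu0 Exu.
    have e2 : E x * qx <= q * (E x * qx).
      by rewrite ler_peMl//; [rewrite mulr_ge0// ltW|lra].
    by lra.
  by lra.
have := le_integral_of_derive _ _ _ _ _ _ _ cd cv dH dD err.
move=> /le_trans; apply.
have dcd : c <= d <= d by rewrite cd lexx.
have ccd : c <= c <= d by rewrite cd lexx.
have rc : 0 < r c by rewrite invr_gt0 m0.
have rd : 0 < r d by rewrite invr_gt0 m0.
have [x0 xT xu qx] := itv _ dcd.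
have Ed := E_gt0 _ xT; have Eu := E_gt0 _ xu.
have Edu : E d <= q * E (d + u) by apply: E_qmono x0 _ duT; rewrite lerDl ltW.
(* The [r c] appearing here cancels against the increment of [Dd], so only values at [d] and [d + u]
   survive. *)
have nH : `|sin (Th d) * r d - sin (Th c) * r c| <= r d + r c.
  apply: le_trans (ler_normB _ _) _; rewrite !normrM (gtr0_norm rc) (gtr0_norm rd).
  by apply: lerD; rewrite ler_piMl ?(ltW rc) ?(ltW rd)// ler_norml sin_geN1 sin_le1.
have Sn : forall x, c <= x <= d + u -> 0 <= S x <= (1 + 2 * q) * E x.
  by move=> x /HS[].
have ddu : d <= d + u by rewrite lerDl ltW.
have ccu : c <= c + u by rewrite lerDl ltW.
have /andP[Sd0 Sd] : 0 <= S d <= (1 + 2 * q) * E d by apply: Sn; rewrite cd.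
have /andP[Su0 Su] : 0 <= S (d + u) <= (1 + 2 * q) * E (d + u).
  by apply: Sn; rewrite lexx (le_trans cd).
have /andP[Sc0 _] : 0 <= S c <= (1 + 2 * q) * E c.
  by apply: Sn; rewrite lexx (le_trans cd).
have /andP[Scu0 _] : 0 <= S (c + u) <= (1 + 2 * q) * E (c + u).
  by apply: Sn; rewrite ccu lerD2r.
have Ku : 0 <= K0 / u.
  apply: divr_ge0 (ltW u0); apply: mulr_ge0; last by rewrite addr_ge0// mulr_ge0.
  by rewrite mulr_ge0// sqr_ge0.
have SS : S d + S (d + u) <= (1 + 2 * q) * (q + 1) * E (d + u).
  have : (1 + 2 * q) * E d <= (1 + 2 * q) * (q * E (d + u)) by rewrite ler_pM2l//; lra.
  by lra.
have rd2 : r d <= 2 * q / u * (q * E (d + u)).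
  apply: le_trans (rb _ dcd) _; apply: ler_wpM2l Edu.
  by rewrite divr_ge0 ?(ltW u0)//; lra.
have SS2 := ler_wpM2l Ku SS.
have Kc1 := mulr_ge0 Ku Sc0; have Kc2 := mulr_ge0 Ku Scu0.
have -> : (4 * q ^+ 2 + 2 * q ^+ 2 * (4 * C0 + b) * (1 + 2 * q) * (q + 1)) / u * E (d + u)
  = 2 * (2 * q / u * (q * E (d + u))) + K0 / u * ((1 + 2 * q) * (q + 1) * E (d + u)).
  by rewrite /K0; ring.
rewrite /Dd; lra.
Qed.

Lemma E_le1 x : 0 < x -> x <= T -> E x <= 1.
Proof.
move=> x0 xT; have q2 := q_ge2; have /andP[T0 TT] := T_itv.
apply: le_trans (E_qmono _ _ x0 xT TT) _.
apply: le_trans (ler_wpM2l _ ET) _; first by lra.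
by rewrite invfM mulrCA divff; lra.
Qed.

(** * Variation of the kernel under translation *)

Section trigonometric_factor.
Variables tr tr' : R -> R.
Hypothesis dtr : forall y : R, is_derive y 1 tr (tr' y).
Hypothesis tr1 : forall y, `|tr y| <= 1.
Hypothesis tr'1 : forall y, `|tr' y| <= 1.

(** Since [1/z <= C0 h/g] and [E z <= 1], each term of the derivative of [tr (th z) / z] is a
    multiple of [h z]. The kernel thus varies no faster than the monotone function [g], whose
    increments telescope. *)
Lemma kernel_increment (x y : R) : 0 < x -> x <= y -> y <= T ->
  `|tr (th y) / y - tr (th x) / x| <= (2 * C0 + b) * (g x - g y).
Proof.
move=> x0 xy yT; have q2 := q_ge2; have /andP[T0 TT] := T_itv.
pose k z := tr (th z) / z.
pose k' z := tr (th z) * (- 1 / z ^+ 2) + z^-1 * (tr' (th z) * th' z).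
have dk z : x <= z <= y -> is_derive z 1 k (k' z).
  move=> xzy; have z0 : z != 0 by rewrite gt_eqF//; lra.
  have zT : 0 < z < T' by lra.
  apply: is_derive_mul (is_derive_inv _ _ _ (is_derive_id z (1 : R)) z0).
  exact: (@is_derive1_comp _ tr th z _ _ (dtr _) (dth _ zT)).
have k'b z : x <= z <= y -> `|k' z| <= (2 * C0 + b) * h z.
  move=> xzy; have zT : 0 < z < T' by lra.
  have gz := g0 _ zT; have hz := h0 _ zT.
  have z0 : 0 < z by lra.
  have zi : 0 < z^-1 by rewrite invr_gt0.
  have gi : 0 < (g z)^-1 by rewrite invr_gt0.
  have Ez : E z <= 1 by apply: E_le1; lra.
  have zC := gP _ zT; have tz := thP _ zT.
  have th'z : `|th' z| <= g z + b * (h z / g z).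
    rewrite -[th' z](subrK (g z)).
    by apply: le_trans (ler_normD _ _) _; rewrite (gtr0_norm gz); lra.
  apply: le_trans (_ : z^-1 * z^-1 + z^-1 * (g z + b * (h z / g z)) <= _).
    apply: le_trans (ler_normD _ _) _; rewrite !normrM.
    have zi2 : 0 <= (z ^+ 2)^-1 by rewrite invr_ge0 sqr_ge0.
    rewrite normrN normr1 mul1r (gtr0_norm zi) (ger0_norm zi2).
    apply: lerD; first by rewrite expr2 invfM ler_piMl// mulr_ge0// ltW.
    rewrite ler_pM2l//; apply: le_trans th'z.
    by rewrite ler_piMl.
  have e1 : z^-1 * z^-1 <= C0 * h z.
    apply: le_trans (ler_wpM2l (ltW zi) zC) _.
    have -> : z^-1 * (C0 * (h z / g z)) = C0 * h z * E z by rewrite invfM; ring.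
    by rewrite ler_piMr// mulr_ge0.
  have e2 : z^-1 * g z <= C0 * h z.
    rewrite -ler_pdivlMr//; apply: le_trans zC _.
    by rewrite mulrA.
  have e3 : z^-1 * (b * (h z / g z)) <= b * h z.
    have -> : z^-1 * (b * (h z / g z)) = b * h z * E z by rewrite invfM; ring.
    by rewrite ler_piMr// mulr_ge0.
  by rewrite mulrDr; lra.
have dG z : x <= z <= y ->
    is_derive z 1 (fun z => - (2 * C0 + b) * g z) ((2 * C0 + b) * h z).
  move=> xzy; have zT : 0 < z < T' by lra.
  apply: (is_derive_eq (is_deriveZ (- (2 * C0 + b)) (dg _ zT))).
  by rewrite /GRing.scale /= mulrNN.
have i1 := @le_increment_of_derive _ x y _ _ _ _ xy dk dG.
have dkN z : x <= z <= y -> is_derive z 1 (fun z => - k z) (- k' z).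
  by move=> /dk dkz; exact: is_deriveN.
have i2 := @le_increment_of_derive _ x y _ _ _ _ xy dkN dG.
have {}i1 := i1 (fun z zxy => le_trans (ler_norm _) (k'b z zxy)).
have {}i2 : - k y - - k x <= - (2 * C0 + b) * g y - - (2 * C0 + b) * g x.
  apply: i2 => z zxy; apply: le_trans (ler_norm _) _.
  by rewrite normrN; exact: k'b.
by rewrite -/(k y) -/(k x) ler_norml; lra.
Qed.

Lemma trunc_kernel_le (eps x : R) : 0 < eps ->
  `|trunc_kernel T th tr eps x| <= if eps <= x then x^-1 else 0.
Proof.
move=> e0; rewrite /trunc_kernel; case: (leP eps x) => /= [ex|_]; last by rewrite normr0.
have x0 : 0 < x^-1 by rewrite invr_gt0; lra.
case: ifP => _; last by rewrite normr0 ltW.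
by rewrite normrM (gtr0_norm x0) ler_piMl// ltW.
Qed.

Lemma measurable_trunc_kernel (eps : R) : 0 < eps ->
  measurable_fun setT (trunc_kernel T th tr eps).
Proof.
move=> e0; have /andP[T0 TT] := T_itv.
apply: measurable_trunc_kernel_continuous => // [x xe|x].
  have xT : 0 < x < T' by lra.
  exact: is_derive_continuous (dth _ xT).
exact: is_derive_continuous (dtr x).
Qed.

(** When both points lie in [[eps, T]] the difference is at most [(2 C0 + b) G], and [G] integrates
    to at most [s * g l <= 1]. The extra 2 pays for the jumps at [eps] and at [T]: each is felt on
    an interval of length [s <= l], where the kernel is at most [1 / l]. *)
Lemma trunc_kernel_modulus (eps l s : R) : 0 < eps -> 0 < l -> l <= T ->
  0 <= s -> s <= l -> s * g l <= 1 ->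
  (\int[@lebesgue_measure R]_v (if 2 * l <= v then
     `|trunc_kernel T th tr eps v - trunc_kernel T th tr eps (v - s)| else 0)%:E
    <= (2 * C0 + b + 2)%:E)%E.
Proof.
move=> e0 l0 lT s0 sl sg; have /andP[T0 TT] := T_itv.
have lT' : 0 < l < T' by lra.
have gl := g0 _ lT'.
pose K := trunc_kernel T th tr eps.
pose G (v : R) := g (v - s) - g v.
pose F1 (v : R) : R := (2 * C0 + b) * ((G \_ `[2 * l, T]) v).
pose F2 (v : R) : R := l^-1 * \1_`[eps, eps + s] v.
pose F3 (v : R) : R := l^-1 * \1_`[T, T + s] v.
have li : 0 < l^-1 by rewrite invr_gt0.
have CB : 0 <= 2 * C0 + b by rewrite addr_ge0// mulr_ge0.
have G0 v : 2 * l <= v <= T -> 0 <= G v.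
  by move=> lvT; rewrite /G subr_ge0; apply: g_dec; lra.
have F10 v : 0 <= F1 v.
  rewrite /F1 mulr_ge0// patchE; case: ifPn => //; rewrite inE/= in_itv/=.
  exact: G0.
have F20 v : 0 <= F2 v by rewrite /F2 mulr_ge0 ?(ltW li)// indicE.
have F30 v : 0 <= F3 v by rewrite /F3 mulr_ge0 ?(ltW li)// indicE.
have bd v : (if 2 * l <= v then `|K v - K (v - s)| else 0) <= F1 v + F2 v + F3 v.
  case: ifPn => [lv|_]; last by rewrite !addr_ge0.
  have lvs : l <= v - s by lra.
  have Kl w : l <= w -> `|K w| <= l^-1.
    move=> lw; apply: le_trans (trunc_kernel_le _ _ e0) _.
    apply: le_trans (_ : w^-1 <= _).
      by case: ifP => // _; rewrite invr_ge0; lra.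
    by rewrite lef_pV2 ?posrE//; lra.
  have Klo w : ~~ ((eps <= w) && (w <= T)) -> K w = 0.
    by rewrite /K /trunc_kernel => /negbTE ->.
  have [/andP[ev vT]|vo] := boolP ((eps <= v) && (v <= T)).
    have [evs|vse] := leP eps (v - s).
      apply: le_trans (_ : F1 v <= _); last by rewrite -addrA lerDl addr_ge0.
      rewrite /F1 patchE mem_set/=; last by rewrite in_itv/= lv vT.
      rewrite /K /trunc_kernel ev vT evs/= ifT; last by lra.
      by apply: kernel_increment; lra.
    apply: le_trans (_ : F2 v <= _); last by rewrite addrAC lerDr addr_ge0.
    rewrite (Klo (v - s)); last by apply/negP => /andP[]; lra.
    rewrite subr0 /F2 indicE mem_set ?mulr1; first by apply: Kl; lra.
    by rewrite /= in_itv/=; lra.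
  rewrite (Klo v)// sub0r normrN.
  have [/andP[evs vsT]|vso] := boolP ((eps <= v - s) && (v - s <= T)); last first.
    by rewrite (Klo (v - s))// normr0 !addr_ge0.
  apply: le_trans (_ : F3 v <= _); last by rewrite lerDr addr_ge0.
  rewrite /F3 indicE mem_set ?mulr1; first by apply: Kl; lra.
  rewrite /= in_itv/=; move: vo; rewrite negb_and -!ltNge => /orP[]; lra.
have mK := measurable_trunc_kernel _ e0.
have mdiff : measurable_fun setT (fun v => `|K v - K (v - s)|).
  apply: measurableT_comp => //; apply: measurable_funB => //.
  apply: (measurableT_comp mK) => //.
  by apply: measurable_funB => //; exact: measurable_cst.
have cG v : 2 * l <= v <= T -> {for v, continuous G}.
  move=> lvT; apply: continuousB; last first.
    by apply: is_derive_continuous; apply: dg; lra.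
  apply: is_derive_continuous; apply: is_derive_comp_shift.
  by apply: dg; lra.
have iG : (@lebesgue_measure R).-integrable `[2 * l, T] (EFin \o G).
  apply: continuous_compact_integrable; first exact: segment_compact.
  by apply: continuous_in_subspaceT => x; rewrite inE/= in_itv/=; exact: cG.
have mG : measurable_fun setT (G \_ `[2 * l, T]).
  apply/(measurable_restrictT G); first exact: measurable_itv.
  by move/integrableP : iG => [/measurable_EFinP].
have mF1 : measurable_fun setT F1 by apply: measurable_funM => //; exact: measurable_cst.
have mF2 : measurable_fun setT F2.
  by apply: measurable_funM => //; exact: measurable_indic.
have mF3 : measurable_fun setT F3.
  by apply: measurable_funM => //; exact: measurable_indic.
have IG : \int[@lebesgue_measure R]_(v in `[2 * l, T]) G v <= 1.
  have [Tl|lT2] := ltP T (2 * l).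
    by rewrite set_itv_ge ?bnd_simp -?ltNge// Rintegral_set0.
  apply: le_trans (ler_norm _) _.
  (* The increment [g (v - s) - g v] is at most [s * h (v - s)], which is the derivative of
     [- s * g (v - s)]. *)
  have := @le_integral_of_derive _ (2 * l) T G (cst 0) (cst 0)
    (fun v => - s * g (v - s)) (fun v => s * h (v - s)) lT2 cG.
  move=> le_int; apply: (le_trans (le_int _ _ _)).
  - move=> x xl; apply: (is_derive_eq (is_deriveZ (- s) (is_derive_comp_shift g (- s) x _ (dg (x - s) _)))).
      by lra.
    by rewrite /GRing.scale/= mulrNN.
  - move=> x xl; rewrite subr0 ger0_norm ?G0//.
    have x1 : 0 < x - s by lra.
    have x2 : x - s <= x by rewrite gerBl.
    have x3 : x < T' by case/andP: xl => _ xT; exact: le_lt_trans xT TT.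
    by have /andP[_] := g_incr _ _ x1 x2 x3; rewrite (_ : x - (x - s) = s)//; ring.
  have gT : 0 <= g (T - s) by rewrite ltW// g0//; lra.
  have gg : g (2 * l - s) <= g l by apply: g_dec; lra.
  rewrite /cst subrr normr0 add0r mulNr mulNr opprK.
  by have := ler_wpM2l s0 gg; have := mulr_ge0 s0 gT; lra.
apply: le_trans (_ : \int[@lebesgue_measure R]_v (F1 v + F2 v + F3 v)%:E <= _)%E.
  apply: ge0_le_integral => //.
  - by move=> v _; rewrite lee_fin; case: ifP.
  - apply/measurable_EFinP; apply: measurable_fun_ifT => //.
    by apply: measurable_fun_ler => //; exact: measurable_cst.
  - apply/measurable_EFinP; apply: measurable_funD => //.
    exact: measurable_funD.
  - by move=> v _; rewrite lee_fin; exact: bd.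
under eq_integral do rewrite !EFinD.
have E2 : (\int[@lebesgue_measure R]_v (F2 v)%:E <= 1%:E)%E.
  rewrite integral_scaled_indic_itv ?(ltW li)// lee_fin.
  by rewrite mulrC ler_pdivrMr// mul1r.
have E3 : (\int[@lebesgue_measure R]_v (F3 v)%:E <= 1%:E)%E.
  rewrite integral_scaled_indic_itv ?(ltW li)// lee_fin.
  by rewrite mulrC ler_pdivrMr// mul1r.
have E1 : (\int[@lebesgue_measure R]_v (F1 v)%:E <= (2 * C0 + b)%:E)%E.
  under eq_integral do rewrite EFinM.
  have Gp v : setT v -> (0 <= ((G \_ `[2 * l, T]) v)%:E)%E.
    move=> _; rewrite lee_fin patchE; case: ifPn => //; rewrite inE/= in_itv/=.
    exact: G0.
  have mGE : measurable_fun setT (fun v => ((G \_ `[2 * l, T]) v)%:E).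
    exact/measurable_EFinP.
  rewrite (ge0_integralZl lebesgue_measure measurableT mGE)//.
  rewrite -[leRHS]mule1; apply: lee_wpmul2l; first by rewrite lee_fin.
  have iGT : (@lebesgue_measure R).-integrable setT (EFin \o (G \_ `[2 * l, T])).
    by rewrite -restrict_EFin -integrable_mkcond.
  rewrite -[X in (X <= _)%E]fineK; last exact: (integrable_fin_num measurableT iGT).
  by move: IG; rewrite Rintegral_mkcond lee_fin.
have m1 : measurable_fun setT (fun v => (F1 v)%:E) by exact/measurable_EFinP.
have m2 : measurable_fun setT (fun v => (F2 v)%:E) by exact/measurable_EFinP.
have m3 : measurable_fun setT (fun v => (F3 v)%:E) by exact/measurable_EFinP.
have p12 v : setT v -> (0 <= (F1 v)%:E + (F2 v)%:E)%E.
  by move=> _; rewrite adde_ge0// lee_fin.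
have p1 v : setT v -> (0 <= (F1 v)%:E)%E by rewrite lee_fin.
have p2 v : setT v -> (0 <= (F2 v)%:E)%E by rewrite lee_fin.
have p3 v : setT v -> (0 <= (F3 v)%:E)%E by rewrite lee_fin.
rewrite (ge0_integralD lebesgue_measure measurableT p12 (emeasurable_funD m1 m2) p3 m3).
rewrite (ge0_integralD lebesgue_measure measurableT p1 m1 p2 m2).
rewrite [leRHS](_ : _ = ((2 * C0 + b)%:E + 1%:E + 1%:E)%E); last first.
  by rewrite -!EFinD; congr EFin; ring.
exact: (leeD (leeD E1 E2) E3).
Qed.

End trigonometric_factor.

End phase.

(** * Autocorrelation of the truncated kernel *)

(** Real part of the autocorrelation of the complex kernel [exp(i th) / x]; the two products combine
    into the cosine of the phase difference. *)
Definition autocorr {R : realType} (T : R) (th : R -> R) (eps u : R) : R :=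
  \int[@lebesgue_measure R]_x
    (trunc_kernel T th cos eps x * trunc_kernel T th cos eps (x + u) +
     trunc_kernel T th sin eps x * trunc_kernel T th sin eps (x + u)).

Section autocorrelation.
Context {R : realType} {Q : nat} {T T' C0 b : R} {g h th th' : R -> R}.
Hypothesis adm : admissible_phase Q T T' C0 b g h th th'.

Let g0 := phase_gt0 adm.
Let dth := phase_derive_th adm.
Let C0_ge0 := phase_C0_ge0 adm.
Let b_ge0 := phase_b_ge0 adm.
Let T_itv := phase_cut adm.

Local Notation q := (Q%:R : R).
Local Notation E x := ((x * g x)^-1).

Lemma autocorrE (eps u : R) : 0 < eps -> 0 <= u ->
  autocorr T th eps u = \int[@lebesgue_measure R]_(x in `[eps, T - u])
    (cos (th x - th (x + u)) / (x * (x + u))).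
Proof.
move=> e0 u0; rewrite Rintegral_mkcond; apply: eq_Rintegral => x _.
rewrite patchE /trunc_kernel.
have [|] := boolP (x \in (`[eps, T - u]%classic : set R)).
  rewrite inE/= in_itv/= lerBrDr => /andP[ex xuT].
  rewrite ex xuT (_ : x <= T) /=; last by lra.
  rewrite (_ : eps <= x + u) /=; last by lra.
  by rewrite cosB invfM; ring.
rewrite notin_setE/= in_itv/= lerBrDr => /negP xn.
case: ifPn => [/andP[ex xT]|_]; last by rewrite !mul0r addr0.
have -> : (eps <= x + u) && (x + u <= T) = false.
  by apply/negbTE; apply: contra xn => /andP[_ ->]; rewrite ex.
by rewrite !mulr0 addr0.
Qed.

Lemma autocorrN (eps u : R) : 0 < eps -> autocorr T th eps (- u) = autocorr T th eps u.
Proof.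
move=> e0; rewrite /autocorr /Rintegral; congr fine.
pose f x := (trunc_kernel T th cos eps x * trunc_kernel T th cos eps (x + - u) +
     trunc_kernel T th sin eps x * trunc_kernel T th sin eps (x + - u))%:E.
have mc := measurable_trunc_kernel adm cos _ (fun y => is_derive_cos y) eps e0.
have ms := measurable_trunc_kernel adm sin _ (fun y => is_derive_sin y) eps e0.
have mshift (k : R -> R) : measurable_fun setT k -> measurable_fun setT (fun x : R => k (x + - u)).
  move=> mk; apply: (measurableT_comp mk) => //.
  by apply: measurable_funD => //; exact: measurable_cst.
have mf : measurable_fun setT f.
  apply/measurable_EFinP; apply: measurable_funD.
    exact: (measurable_funM mc (mshift _ mc)).
  exact: (measurable_funM ms (mshift _ ms)).
rewrite -[LHS](integral_shift f u mf); apply: eq_integral => x _.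
by rewrite /f addrK; congr EFin; ring.
Qed.

Lemma continuous_autocorr_integrand (u x : R) : 0 < x -> 0 <= u -> x + u < T' ->
  {for x, continuous (fun x => cos (th x - th (x + u)) / (x * (x + u)))}.
Proof.
move=> x0 u0 xu.
have xT : 0 < x < T' by lra.
have xuT : 0 < x + u < T' by lra.
apply: continuousM.
  apply: continuous_comp; last exact: continuous_cos.
  apply: is_derive_continuous.
  exact: is_deriveB (dth _ xT) (is_derive_comp_shift _ _ _ _ (dth _ xuT)).
apply: continuousV; first by rewrite mulf_neq0// gt_eqF//; lra.
apply: continuousM; first exact: cvg_id.
by apply: continuousD; [exact: cvg_id|exact: cvg_cst].
Qed.

Lemma autocorr_tail (d u : R) : 0 < d -> 0 <= u ->
  `|\int[@lebesgue_measure R]_(x in `[d, T - u])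
      (cos (th x - th (x + u)) / (x * (x + u)))| <= d^-1.
Proof.
move=> d0 u0; have /andP[T0 TT] := T_itv.
have di : 0 < d^-1 by rewrite invr_gt0.
have [Td|dT] := ltP (T - u) d.
  by rewrite set_itv_ge ?bnd_simp -?ltNge// Rintegral_set0 normr0 ltW.
have cv x : d <= x <= T - u ->
    {for x, continuous (fun x => cos (th x - th (x + u)) / (x * (x + u)))}.
  by move=> xd; apply: continuous_autocorr_integrand => //; lra.
have dD x : d <= x <= T - u -> is_derive x 1 (fun z : R => - z^-1) ((x ^+ 2)^-1).
  move=> xd; have x0 : x != 0 by rewrite gt_eqF//; lra.
  apply: (is_derive_eq (is_deriveN (is_derive_inv _ _ _ (is_derive_id x (1 : R)) x0))).
  by rewrite mulN1r opprK.
have := @le_integral_of_derive _ d (T - u) _ (cst 0) (cst 0) _ _ dT cv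
  (fun x _ => is_derive_cst (0 : R) x 1) dD.
move=> le_int; apply: (le_trans (le_int _)); last first.
  rewrite /cst subrr normr0 add0r opprK addrC lerBlDr lerDl invr_ge0; lra.
move=> x xd; rewrite subr0 normrM.
have x0 : 0 < x by lra.
have i0 : 0 < (x * (x + u))^-1 by rewrite invr_gt0 mulr_gt0//; lra.
rewrite (gtr0_norm i0); apply: le_trans (_ : (x * (x + u))^-1 <= _).
  by rewrite ler_piMl ?(ltW i0)// ler_norml cos_geN1 cos_le1.
rewrite lef_pV2 ?posrE ?mulr_gt0 ?exprn_gt0//; last by lra.
by rewrite expr2 ler_pM2l//; lra.
Qed.

Lemma autocorr_le_inv (eps u : R) : 0 < eps -> `|autocorr T th eps u| <= eps^-1.
Proof.
move=> e0; have [u0|u0] := leP 0 u; first by rewrite autocorrE//; exact: autocorr_tail.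
by rewrite -autocorrN// autocorrE ?oppr_ge0 ?(ltW u0)//; apply: autocorr_tail; lra.
Qed.

Lemma autocorr_eq0 (eps u : R) : 0 < eps -> T < `|u| -> autocorr T th eps u = 0.
Proof.
move=> e0; wlog u0 : u / 0 <= u.
  move=> H Tu; have [u0|u0] := leP 0 u; first exact: H.
  by rewrite -autocorrN//; apply: H; rewrite ?normrN//; lra.
rewrite ger0_norm// => Tu; rewrite autocorrE//.
by rewrite set_itv_ge ?Rintegral_set0// bnd_simp -ltNge; lra.
Qed.

(** The integral is split at [rho / q]. Above it, absolute values give [q / rho]. Below it, the
    oscillatory bound applies up to a point [d] with [d + u <= rho], which the alternative on [rho]
    and [u] ensures; the factor [1 / (u * g rho)], at most 1, leaves the order [1 / rho]. *)
Lemma autocorr_bound (eps rho u : R) : 0 < eps -> 0 < rho -> rho <= T -> 0 < u ->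
  1 <= u * g rho -> rho = T \/ u <= rho - rho / q ->
  `|autocorr T th eps u| <=
    (q * (4 * q ^+ 2 + 2 * q ^+ 2 * (4 * C0 + b) * (1 + 2 * q) * (q + 1)) + q) / rho.
Proof.
move=> e0 r0 rT u0 ug ru; have /andP[T0 TT] := T_itv; have q2 := q_ge2 adm.
set K := (4 * q ^+ 2 + _).
have rT' : 0 < rho < T' by lra.
have gr := g0 _ rT'.
have K0 : 0 <= K.
  rewrite addr_ge0 ?mulr_ge0 ?sqr_ge0 ?addr_ge0 ?mulr_ge0//; lra.
rewrite autocorrE ?(ltW u0)//.
pose v x := cos (th x - th (x + u)) / (x * (x + u)); rewrite -/v.
have q0 : 0 < q by lra.
have rq : (rho / q)^-1 = q / rho by rewrite invf_div.
have rq0 : 0 < rho / q by rewrite divr_gt0.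
have rqT : q * (rho / q) = rho by rewrite mulrC divfK// gt_eqF.
have tail d : rho / q <= d -> `|\int[@lebesgue_measure R]_(x in `[d, T - u]) v x| <= q / rho.
  move=> rd; apply: le_trans (autocorr_tail d u _ (ltW u0)) _; first by lra.
  by rewrite -rq lef_pV2 ?posrE//; lra.
have head d : eps <= d -> d <= rho / q -> d <= T - u ->
    `|\int[@lebesgue_measure R]_(x in `[eps, d]) v x| <= q * K / rho.
  move=> ed dr dT.
  have qd : q * d <= rho by rewrite -rqT ler_pM2l.
  have dur : d + u <= rho by case: ru => [->|]; lra.
  apply: le_trans (oscillatory_integral_bound adm eps d u e0 ed _ u0 _) _; try lra.
  rewrite -/K.
  have d0 : 0 < d + u by lra.
  have Ed := E_qmono adm _ _ d0 dur (le_lt_trans rT TT).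
  have Ku : 0 <= K / u by rewrite divr_ge0// ltW.
  apply: le_trans (ler_wpM2l Ku Ed) _.
  have -> : K / u * (q * E rho) = q * K / rho * (u * g rho)^-1.
    by field; apply/and3P; split; lra.
  rewrite ler_piMr//; first by rewrite divr_ge0 ?(ltW r0)// mulr_ge0// ltW.
  by rewrite invf_le1//; lra.
have qr : 0 <= q / rho by rewrite divr_ge0 ?(ltW r0)// ltW.
have qKr : 0 <= q * K / rho by rewrite divr_ge0 ?(ltW r0)// mulr_ge0// ltW.
have -> : (q * K + q) / rho = q * K / rho + q / rho by rewrite mulrDl.
have [er|re] := ltP (rho / q) eps.
  apply: le_trans (tail eps _) _; first exact: ltW.
  by rewrite lerDr.
have [Tr|rTu] := leP (T - u) (rho / q).
  have [eT|Te] := leP eps (T - u).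
    by apply: le_trans (head _ _ _ _) _ => //; rewrite lerDl.
  by rewrite set_itv_ge ?bnd_simp -?ltNge// Rintegral_set0 normr0 addr_ge0.
have iv : (@lebesgue_measure R).-integrable `[eps, T - u] (EFin \o v).
  apply: continuous_compact_integrable; first exact: segment_compact.
  apply: continuous_in_subspaceT => x; rewrite inE/= in_itv/= => xe.
  by apply: continuous_autocorr_integrand; lra.
have ab1 : ((BLeft eps : itv_bound R) <= BRight (rho / q))%O by rewrite bnd_simp.
have ab2 : (BRight (rho / q) <= (BRight (T - u) : itv_bound R))%O by rewrite bnd_simp ltW.
have := Rintegral_itvB iv ab1 ab2.
rewrite Rintegral_itv_obnd_cbnd; last first.
  by apply: integrableS iv => //; apply: subset_itvr; rewrite bnd_simp.
move=> split_eq; rewrite -[X in `|X|](subrK (\int[@lebesgue_measure R]_(x in `[eps, rho / q]) v x)).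
rewrite split_eq addrC; apply: le_trans (ler_normD _ _) _.
by apply: lerD; [apply: head => //; rewrite ltW|exact: tail].
Qed.

End autocorrelation.

(** * Stopping cells *)

Lemma floor_divn {R : realType} (q : nat) (x y : R) : (0 < q)%N ->
  Num.floor x = Num.floor y -> Num.floor (x / q%:R) = Num.floor (y / q%:R).
Proof.
move=> q0 xy; apply/esym/floor_def.
have q0' : 0 < q%:R :> R by rewrite ltr0n.
have /andP[h1 h2] := floor_itv (x / q%:R).
rewrite ler_pdivlMr// ltr_pdivrMr//.
rewrite ler_pdivlMr// in h1; rewrite ltr_pdivrMr// in h2.
have e (m : int) : m%:~R * q%:R = (m * q%:Z)%:~R :> R by rewrite intrM.
rewrite !e in h1 h2 *; apply/andP; split.
  by rewrite -floor_ge_int -xy floor_ge_int.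
by rewrite -floor_lt_int -xy floor_lt_int.
Qed.

Lemma sum_indicator_progression {R : realType} (P : nat) (w s r : R) :
  0 < s -> 0 <= r ->
  \sum_(p < P) (`|w + p%:R * s| <= r)%R%:R <= 2 * r / s + 1.
Proof.
move=> s0 r0.
pose a (p : nat) := `|w + p%:R * s| <= r.
have [/hasP[p0' _ ap0']|/hasPn na] := boolP (has a (iota 0 P)); last first.
  rewrite big1 ?addr_ge0 ?divr_ge0 ?mulr_ge0 ?(ltW s0)// => p _.
  by have := na p; rewrite mem_iota/= add0n ltn_ord => /(_ isT)/negbTE; rewrite /a => ->.
have [p0 ap0 p0min] := ex_minnP (ex_intro a p0' ap0').
pose K := Num.truncn (2 * r / s).
have aK p : a p -> (p0 <= p < p0 + K.+1)%N.
  move=> ap; rewrite p0min//= ltnNge; apply/negP => p0K.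
  have : (p%:R - p0%:R) * s <= 2 * r.
    by move: ap ap0; rewrite /a !ler_norml; lra.
  rewrite -ler_pdivlMr//; apply/negP; rewrite -ltNge.
  apply: lt_le_trans (truncnS_gt _) _.
  by rewrite -/K lerBrDl -natrD ler_nat.
have -> : \sum_(p < P) (`|w + p%:R * s| <= r)%R%:R = (count a (iota 0 P))%:R :> R.
  transitivity (\sum_(0 <= p < P) (a p)%:R : R); first by rewrite big_mkord.
  rewrite -sum1_count [in RHS]big_mkcond natr_sum /index_iota subn0.
  by apply: eq_bigr => p _; case: (a p).
apply: le_trans (_ : K.+1%:R <= _); last first.
  by rewrite -natr1 lerD2r truncn_le divr_ge0 ?mulr_ge0// ltW.
rewrite ler_nat -size_filter -[leqRHS](size_iota p0).
apply: uniq_leq_size; first by rewrite filter_uniq// iota_uniq.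
by move=> p; rewrite mem_filter => /andP[/aK ? _]; rewrite mem_iota.
Qed.

Section stopping_cells.
Context {R : realType} {I : finType}.
Variables (Q : nat) (T : R) (y c : I -> R) (alpha : R) (N : nat).
Hypothesis Q2 : (2 <= Q)%N.
Hypothesis T0 : 0 < T.
Hypothesis alpha0 : 0 < alpha.

Definition scale (n : nat) : R := T / Q%:R ^+ n.

Definition cell (n : nat) (x : R) : int := Num.floor (x / scale n).

Definition cell_mass (n : nat) (j : int) : R :=
  \sum_(i | cell n (y i) == j) `|c i|.

Definition heavy (i : I) (n : nat) : bool :=
  alpha * scale n < cell_mass n (cell n (y i)).

(* The level of the largest heavy cell containing the point, and [N.+1] when
   none of the cells of levels [0..N] around it is heavy. *)
Definition level (i : I) : nat := find (heavy i) (iota 0 N.+1).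

Lemma scale_gt0 n : 0 < scale n.
Proof. by rewrite divr_gt0// exprn_gt0// ltr0n; exact: ltnW. Qed.

Lemma scaleS n : scale n = Q%:R * scale n.+1.
Proof.
have q0 : Q%:R != 0 :> R by rewrite pnatr_eq0 -lt0n; exact: ltnW.
by rewrite /scale exprS; field; rewrite q0 expf_neq0.
Qed.

Lemma cell_coarsen m n x z : (n <= m)%N -> cell m x = cell m z -> cell n x = cell n z.
Proof.
move=> /subnK <-; elim: (m - n)%N => // k IH; rewrite addSn => H; apply: IH.
rewrite /cell; have s0 := scale_gt0 (k + n).+1; have q0 : (0 < Q)%N := ltnW Q2.
have e (v : R) : v / scale (k + n) = v / scale (k + n).+1 / Q%:R.
  by rewrite scaleS invfM mulrA mulrAC.
by rewrite !e; exact: floor_divn.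
Qed.

Lemma level_le i : (level i <= N.+1)%N.
Proof. by rewrite -[leqRHS](size_iota 0); exact: find_size. Qed.

Lemma heavy_level i : (level i <= N)%N -> heavy i (level i).
Proof.
move=> iN; have hs : has (heavy i) (iota 0 N.+1) by rewrite has_find size_iota ltnS.
by have := nth_find 0%N hs; rewrite nth_iota ?ltnS.
Qed.

Lemma light_before_level i n : (n < level i)%N -> ~~ heavy i n.
Proof.
move=> ni; have := before_find 0%N ni; rewrite nth_iota; first by move=> ->.
exact: leq_trans ni (level_le i).
Qed.

Lemma eq_heavy i j n : cell n (y i) = cell n (y j) -> heavy i n = heavy j n.
Proof. by rewrite /heavy => ->. Qed.

(** Heaviness depends only on the cell, and a common cell remains common at all coarser levels, so
    both points see the same pattern of heavy and light cells down to the stopping level. *)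
Lemma eq_level i j : (level i <= N)%N ->
  cell (level i) (y i) = cell (level i) (y j) -> level j = level i.
Proof.
move=> iN ij; have eqh n : (n <= level i)%N -> heavy i n = heavy j n.
  by move=> ni; apply: eq_heavy; exact: cell_coarsen ij.
apply/eqP; rewrite eqn_leq; apply/andP; split.
  rewrite leqNgt; apply/negP => /light_before_level/negP; apply.
  by rewrite -eqh// heavy_level.
rewrite leqNgt; apply/negP => ji.
have jN : (level j <= N)%N := leq_trans (ltnW ji) iN.
by have := light_before_level _ _ ji; rewrite eqh ?heavy_level// ltnW.
Qed.

Definition heavy_cells : seq (nat * int) :=
  undup [seq (level i, cell (level i) (y i)) | i <- enum I & (level i <= N)%N].

Lemma mem_heavy_cells i : (level i <= N)%N ->
  (level i, cell (level i) (y i)) \in heavy_cells.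
Proof.
move=> iN; rewrite mem_undup; apply/mapP; exists i => //.
by rewrite mem_filter iN mem_enum.
Qed.

(** By [eq_level] every point of a stopping cell stops exactly there. The selected cells, though of
    various levels, therefore carry disjoint masses. *)
Lemma sum_heavy_cells :
  alpha * \sum_(p <- heavy_cells) scale p.1 <= \sum_i `|c i|.
Proof.
pose pr i := (level i, cell (level i) (y i)).
rewrite mulr_sumr.
apply: le_trans (_ : \sum_(p <- heavy_cells) \sum_(i | pr i == p) `|c i| <= _).
  rewrite big_seq [leRHS]big_seq; apply: ler_sum => p.
  rewrite mem_undup => /mapP[i]; rewrite mem_filter => /andP[iN _] ->.
  apply: le_trans (ltW (heavy_level _ iN)) _.
  rewrite /cell_mass big_mkcond [leRHS]big_mkcond /=; apply: ler_sum => j _.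
  case: eqP => [ji|_]; last by case: ifP.
  by rewrite /pr (eq_level i j) -?ji// ji eqxx.
under eq_bigr do rewrite big_mkcond /=.
rewrite exchange_big /=; apply: ler_sum => i _.
rewrite -big_mkcond /= big_const_seq; set k := count _ _.
have : (k <= 1)%N.
  have -> : k = count_mem (pr i) heavy_cells by apply: eq_count => p /=; rewrite eq_sym.
  by rewrite count_uniq_mem ?undup_uniq//; case: (_ \in _).
by case: k => [|[|//]] _ /=; rewrite ?addr0.
Qed.

(** A point that has not stopped at level [n] or before lies in a light cell of level [n]; that cell
    contains the one considered and is [Q] times as long. *)
Lemma cell_mass_light n j :
  \sum_(i | (n < level i)%N && (cell n.+1 (y i) == j)) `|c i| <=
  alpha * Q%:R * scale n.+1.
Proof.
have [i0 /andP[ni0 /eqP ci0]|no] := pickP (fun i => (n < level i)%N && (cell n.+1 (y i) == j)); last first.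
  rewrite big_pred0// mulr_ge0 ?(ltW (scale_gt0 _))// mulr_ge0//; exact: ltW.
rewrite -mulrA -scaleS.
have := light_before_level _ _ ni0; rewrite /heavy -leNgt; apply: le_trans.
rewrite /cell_mass big_mkcond [leRHS]big_mkcond /=; apply: ler_sum => i _.
case: ifP => [/andP[_ /eqP cij]|_]; last by case: ifP.
by rewrite (@cell_coarsen n.+1 n (y i) (y i0)) ?eqxx// cij.
Qed.

(** The window is covered by [k.+1] consecutive cells of level [n.+1]; the summand [2 * scale n.+1]
    pays for rounding at both ends. *)
Lemma window_mass n (z rho : R) : 0 <= rho ->
  \sum_(i | (n < level i)%N && (`|y i - z| <= rho)) `|c i| <=
  alpha * Q%:R * (2 * rho + 2 * scale n.+1).
Proof.
move=> r0; set s := scale n.+1; have s0 : 0 < s := scale_gt0 _.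
pose a := cell n.+1 (z - rho); pose b := cell n.+1 (z + rho).
have ab : a <= b by apply: le_floor; rewrite ler_pM2r ?invr_gt0//; lra.
pose k := `|b - a|%N.
have kE : k%:Z = b - a by rewrite /k gez0_abs// subr_ge0.
apply: le_trans (_ : \sum_(t < k.+1)
    \sum_(i | (n < level i)%N && (cell n.+1 (y i) == a + t%:Z)) `|c i| <= _).
  under [leRHS]eq_bigr do rewrite big_mkcond.
  rewrite exchange_big /= big_mkcond /=; apply: ler_sum => i _.
  case: ifP => [/andP[ni iz]|_]; last first.
    by apply: sumr_ge0 => t _; case: ifP.
  have ai : a <= cell n.+1 (y i).
    by apply: le_floor; rewrite ler_pM2r ?invr_gt0//; move: iz; rewrite ler_norml; lra.
  have ib : cell n.+1 (y i) <= b.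
    by apply: le_floor; rewrite ler_pM2r ?invr_gt0//; move: iz; rewrite ler_norml; lra.
  have tk : (`|cell n.+1 (y i) - a| < k.+1)%N.
    by rewrite ltnS -lez_nat gez0_abs ?subr_ge0// kE lerD2r.
  have ca : a + `|cell n.+1 (y i) - a|%N%:Z = cell n.+1 (y i).
    by rewrite gez0_abs ?subr_ge0//; lia.
  rewrite (bigD1 (Ordinal tk))//= ni ca eqxx /=.
  by rewrite lerDl; apply: sumr_ge0 => t _; case: ifP.
apply: le_trans (_ : \sum_(t < k.+1) alpha * Q%:R * s <= _).
  by apply: ler_sum => t _; exact: cell_mass_light.
rewrite sumr_const card_ord -[leLHS]mulr_natr -[leLHS]mulrA.
rewrite ler_pM2l ?mulr_gt0// ?ltr0n; last by lia.
have ka : (k%:R : R) = b%:~R - a%:~R by rewrite -intrB -kE.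
have b1 : b%:~R <= (z + rho) / s by exact: floor_le.
have a1 : (z - rho) / s < a%:~R + 1 by rewrite -[_ + 1]intrD1; exact: floorD1_gt.
have -> : 2 * rho + 2 * s = s * ((z + rho) / s - ((z - rho) / s - 1) + 1).
  by field; lra.
by rewrite ler_pM2l// -natr1 ka; lra.
Qed.

End stopping_cells.

(** * Spreading the point masses *)

Section smoothed_pairs.
Context {R : realType} {I : finType}.
Variables (Q : nat) (T : R) (y c : I -> R) (alpha : R) (N : nat).
Variables (delta : nat -> R) (P : nat).
Hypothesis Q2 : (2 <= Q)%N.
Hypothesis T0 : 0 < T.
Hypothesis alpha0 : 0 < alpha.
Hypothesis delta_gt0 : forall n, 0 < delta n.
Hypothesis delta_step : forall n, 2 * Q%:R * delta n.+1 <= delta n.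
Hypothesis delta_top : 2 * Q%:R * delta 0%N <= T.
Hypothesis P0 : (0 < P)%N.
Hypothesis PN : delta 0%N <= P%:R * delta N.+1.

Local Notation lev := (level Q T y c alpha N).
Local Notation sc := (scale Q T).
Local Notation rho n := (delta n / sc n).

(** Level 0 receives the radius [T] because the autocorrelation is only known to be of order [1 / T]
    for [u] between [delta 0] and [T]. *)
Definition box_radius (n : nat) : R := if n is 0%N then T else delta n.

(** Shape of the majorant of the autocorrelation. The last index [N.+1] also serves all smaller [u],
    where the cut at [eps] bounds the autocorrelation. *)
Definition box_profile (u : R) : R :=
  \sum_(0 <= n < N.+2) (sc n)^-1 * (`|u| <= box_radius n)%R%:R.

(** Discrete form of spreading a mass evenly over a length [delta (lev i)]. The number [P] of copies
    is the same for all points, and [PN] keeps every spacing below [delta N.+1], hence below every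
    box radius in use. *)
Definition shift_of (i : I) (p : nat) : R := p%:R * (delta (lev i) / P%:R).

Definition averaged_profile (i j : I) : R :=
  (\sum_(p < P) \sum_(r < P)
    box_profile ((y i + shift_of i p) - (y j + shift_of j r))) / P%:R ^+ 2.

Let q2 : 2 <= Q%:R :> R. Proof. by rewrite (ler_nat _ 2 Q). Qed.
Let s0 n : 0 < sc n. Proof. exact: scale_gt0. Qed.
Let PR0 : 0 < P%:R :> R. Proof. by rewrite ltr0n. Qed.

Lemma delta_le m n : (m <= n)%N -> delta n <= delta m.
Proof.
elim: n => [|n IH]; first by rewrite leqn0 => /eqP ->.
rewrite leq_eqVlt => /orP[/eqP -> //|]; rewrite ltnS => /IH; apply: le_trans.
by have := delta_step n; have := delta_gt0 n.+1; have := q2; nra.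
Qed.

Lemma rho_gt0 n : 0 < rho n. Proof. exact: divr_gt0. Qed.

Lemma rho_half n : rho n.+1 <= rho n - rho n.+1.
Proof.
have q2' := q2.
have q0 : 0 < Q%:R :> R by lra.
have -> : rho n = delta n / Q%:R / sc n.+1.
  by rewrite (scaleS Q T Q2 n); field; rewrite !gt_eqF.
rewrite lerBrDr -mulrDl ler_pM2r ?invr_gt0//.
by rewrite ler_pdivlMr//; have := delta_step n; lra.
Qed.

Lemma delta_le_box n : delta n <= box_radius n.
Proof.
have q2' := q2.
case: n => [|n] //=; apply: le_trans delta_top.
by rewrite ler_peMl ?(ltW (delta_gt0 _))//; lra.
Qed.

Lemma sum_rho m n : (m <= n)%N -> \sum_(m.+1 <= k < n.+1) rho k <= rho m - rho n.
Proof.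
elim: n => [|n IH]; first by rewrite leqn0 => /eqP ->; rewrite big_geq// subrr.
rewrite leq_eqVlt => /orP[/eqP ->|]; first by rewrite big_geq// subrr.
rewrite ltnS => mn; rewrite big_nat_recr//=; have := IH mn; have := rho_half n; lra.
Qed.

Lemma sum_box_radius m : \sum_(0 <= n < m.+1) (sc n)^-1 * box_radius n <= 2.
Proof.
rewrite big_nat_recl//= {1}/scale expr0 divr1 mulVf ?gt_eqF//.
have -> : \sum_(0 <= i < m) (sc i.+1)^-1 * delta i.+1 = \sum_(1 <= k < m.+1) rho k.
  by rewrite big_add1 /=; apply: eq_bigr => k _; rewrite mulrC.
have := sum_rho 0 m (leq0n m); have := rho_gt0 m.
have : rho 0 <= 1.
  rewrite ler_pdivrMr// mul1r {1}/scale expr0 divr1.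
  exact: (delta_le_box 0).
lra.
Qed.

Lemma sum_scale_ratio m : \sum_(0 <= n < m.+1) (sc n)^-1 * sc m <= 2.
Proof.
have q2' := q2.
elim: m => [|m IH]; first by rewrite big_nat1 mulVf ?gt_eqF//; lra.
rewrite big_nat_recr//= mulVf ?gt_eqF//.
have : \sum_(0 <= n < m.+1) (sc n)^-1 * sc m.+1 <= 1.
  rewrite -(@ler_pM2l _ Q%:R); last by lra.
  rewrite mulr_sumr (eq_bigr (fun n => (sc n)^-1 * sc m)).
    by apply: le_trans IH _; lra.
  by move=> n _; rewrite mulrCA -(scaleS Q T Q2).
by lra.
Qed.

Lemma shift_of_bounds i p : (p < P)%N -> 0 <= shift_of i p <= delta (lev i).
Proof.
move=> pP; rewrite /shift_of mulrA; apply/andP; split.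
  by rewrite divr_ge0 ?(ltW PR0)// mulr_ge0// ltW.
by rewrite ler_pdivrMr// mulrC ler_pM2l// ler_nat ltnW.
Qed.

Lemma box_profileN u : box_profile (- u) = box_profile u.
Proof. by rewrite /box_profile; under eq_bigr do rewrite normrN. Qed.

Lemma averaged_profileC i j : averaged_profile i j = averaged_profile j i.
Proof.
rewrite /averaged_profile exchange_big /=; congr (_ / _).
apply: eq_bigr => p _; apply: eq_bigr => r _.
by rewrite -box_profileN opprB.
Qed.

(** Put [m = lev i]. Boxes with [n <= m] have radius at least the length of the shifts, so shifting
    at most doubles the radius. For [n > m], at most a fraction [3 delta_n / delta_m] of the copies
    of [i] meets the box; after division by [l_n] these fractions sum geometrically to 3 times the
    term of index [m]. Hence 4 = 1 + 3. *)
Lemma averaged_profile_le i j : (lev i <= lev j)%N ->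
  averaged_profile i j <=
  4 * \sum_(0 <= n < (lev i).+1) (sc n)^-1 * (`|y i - y j| <= 2 * box_radius n)%R%:R.
Proof.
move=> ij; set m := lev i; have mN : (m <= N.+1)%N by exact: level_le.
pose D := y i - y j.
pose A n : R := (\sum_(p < P) \sum_(r < P)
   (`|(y i + shift_of i p) - (y j + shift_of j r)| <= box_radius n)%R%:R) / P%:R ^+ 2.
pose X n : R := (`|D| <= 2 * box_radius n)%R%:R.
have X0 n : 0 <= X n by exact: ler0n.
have dj : delta (lev j) <= delta m by exact: delta_le.
have dist p r : (p < P)%N -> (r < P)%N ->
    `|D| <= `|(y i + shift_of i p) - (y j + shift_of j r)| + delta m.
  move=> pP rP; have := shift_of_bounds i p pP; have := shift_of_bounds j r rP.
  rewrite -/m => b1 b2.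
  have -> : D = (y i + shift_of i p - (y j + shift_of j r)) + (shift_of j r - shift_of i p).
    by rewrite /D; ring.
  by apply: le_trans (ler_normD _ _) _; rewrite lerD2l ler_norml; lra.
have -> : averaged_profile i j = \sum_(0 <= n < N.+2) (sc n)^-1 * A n.
  rewrite /averaged_profile /A.
  under [RHS]eq_bigr do rewrite mulrA mulr_sumr.
  rewrite -mulr_suml; congr (_ / _).
  rewrite [RHS]exchange_big /=; apply: eq_bigr => p _.
  under [RHS]eq_bigr do rewrite mulr_sumr.
  by rewrite [RHS]exchange_big.
have P20 : 0 < P%:R ^+ 2 :> R by rewrite exprn_gt0.
have Asmall n : (n <= m)%N -> A n <= X n.
  move=> nm; rewrite /A ler_pdivrMr//.
  apply: le_trans (_ : \sum_(p < P) \sum_(r < P) X n <= _); last first.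
    by rewrite !sumr_const !card_ord -mulrnA -[leLHS]mulr_natr natrM expr2.
  apply: ler_sum => p _; apply: ler_sum => r _.
  rewrite /X ler_nat; have hd := dist p r (ltn_ord p) (ltn_ord r).
  case: leP => //= h1; case: leP => //= h2.
  by have := delta_le n m nm; have := delta_le_box n; lra.
have Alarge n : (m < n)%N -> (n <= N.+1)%N -> A n <= 3 * delta n / delta m * X m.
  move=> mn nN.
  have bn : box_radius n = delta n by case: n mn nN.
  have dn : delta n <= delta m by apply: delta_le; exact: ltnW.
  have [Dm|mD] := leP `|D| (2 * box_radius m); last first.
    have -> : A n = 0.
      rewrite /A big1 ?mul0r// => p _; rewrite big1// => r _.
      have hd := dist p r (ltn_ord p) (ltn_ord r); rewrite bn; case: leP => // h1.
      by have := delta_le_box m; lra.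
    by rewrite mulr_ge0// divr_ge0 ?(ltW (delta_gt0 _))// mulr_ge0// ltW.
  rewrite /X Dm mulr1 /A ler_pdivrMr//.
  apply: le_trans (_ : \sum_(r < P) (2 * delta n / (delta m / P%:R) + 1) <= _).
    rewrite exchange_big /=; apply: ler_sum => r _; rewrite bn.
    have := @sum_indicator_progression _ P (y i - (y j + shift_of j r))
      (delta m / P%:R) (delta n) _ (ltW (delta_gt0 n)).
    move=> /(_ (divr_gt0 (delta_gt0 m) PR0)); apply: le_trans.
    apply: ler_sum => p _; rewrite /shift_of -/m.
    by rewrite [y i + _]addrC -addrA [_ + (y i - _)]addrC.
  rewrite sumr_const card_ord -[leLHS]mulr_natr.
  (* The spacing is at most [delta n], so the additive 1 of the count is absorbed and the factor 2
     becomes 3. *)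
  have one : 1 <= delta n / delta m * P%:R.
    rewrite mulrAC ler_pdivlMr// mul1r.
    have d1 : delta m <= delta 0%N by exact: delta_le.
    have d2 : delta N.+1 <= delta n by exact: delta_le.
    apply: le_trans d1 _; apply: le_trans PN _.
    by rewrite mulrC ler_pM2r.
  have -> : 2 * delta n / (delta m / P%:R) = 2 * (delta n / delta m * P%:R).
    by field; rewrite !gt_eqF.
  by rewrite expr2 [leRHS]mulrA ler_pM2r//; lra.
rewrite (big_cat_nat (n := m.+1)) //=.
apply: le_trans (_ : \sum_(0 <= n < m.+1) (sc n)^-1 * X n +
   \sum_(m.+1 <= n < N.+2) 3 * X m / delta m * rho n <= _).
  apply: lerD.
    rewrite !big_nat; apply: ler_sum => n nm.
    by rewrite ler_pM2l ?invr_gt0//; apply: Asmall; lia.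
  rewrite !big_nat; apply: ler_sum => n nm.
  have -> : 3 * X m / delta m * rho n = (sc n)^-1 * (3 * delta n / delta m * X m) by ring.
  by rewrite ler_pM2l ?invr_gt0//; apply: Alarge; lia.
have Sm : (sc m)^-1 * X m <= \sum_(0 <= n < m.+1) (sc n)^-1 * X n.
  rewrite big_nat_recr//= lerDr; apply: sumr_ge0 => n _.
  by rewrite mulr_ge0// invr_ge0 ltW.
rewrite -mulr_sumr.
have := sum_rho m N.+1 mN; have rN := rho_gt0 N.+1 => sr.
have c0 : 0 <= 3 * X m / delta m by rewrite divr_ge0 ?mulr_ge0// ltW.
have sr2 : \sum_(m.+1 <= k < N.+2) rho k <= rho m by lra.
have {}sr := ler_wpM2l c0 sr2.
have e3 : 3 * X m / delta m * rho m = 3 * ((sc m)^-1 * X m).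
  by field; rewrite !gt_eqF.
by rewrite /X in Sm sr e3 *; lra.
Qed.

(** Points of level at least [m] have not stopped at level [m.-1], which exists as [m > 0], so
    [window_mass] bounds their mass near [y i]. The two geometric sums are at most 2 each, and 48 is
    4 times [4 * 2 + 2 * 2]. *)
Lemma sum_averaged_profile_above i : (0 < lev i)%N ->
  \sum_(j | (lev i <= lev j)%N) `|c j| * averaged_profile i j <= 48 * (alpha * Q%:R).
Proof.
have q2' := q2.
set m := lev i => m0.
have aQ : 0 < alpha * Q%:R by rewrite mulr_gt0//; lra.
apply: le_trans (_ : \sum_(j | (m <= lev j)%N)
   4 * \sum_(0 <= n < m.+1) (sc n)^-1 *
     (`|c j| * (`|y i - y j| <= 2 * box_radius n)%R%:R) <= _).
  apply: ler_sum => j mj.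
  apply: le_trans (ler_wpM2l (normr_ge0 _) (averaged_profile_le i j mj)) _.
  rewrite mulrCA ler_pM2l// mulr_sumr -/m le_eqVlt; apply/orP; left; apply/eqP.
  by apply: eq_bigr => n _; rewrite mulrCA.
rewrite -mulr_sumr exchange_big /=.
have win n : (n < m.+1)%N ->
    \sum_(j | (m <= lev j)%N) (sc n)^-1 *
       (`|c j| * (`|y i - y j| <= 2 * box_radius n)%R%:R) <=
    alpha * Q%:R * (4 * ((sc n)^-1 * box_radius n) + 2 * ((sc n)^-1 * sc m)).
  move=> nm; rewrite -mulr_sumr.
  have r0 : 0 <= 2 * box_radius n.
    by rewrite mulr_ge0// (le_trans (ltW (delta_gt0 n)))// delta_le_box.
  have := window_mass Q T y c alpha N Q2 T0 alpha0 m.-1 (y i) (2 * box_radius n) r0.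
  rewrite prednK// => w.
  have -> : alpha * Q%:R * (4 * ((sc n)^-1 * box_radius n) + 2 * ((sc n)^-1 * sc m)) =
    (sc n)^-1 * (alpha * Q%:R * (2 * (2 * box_radius n) + 2 * sc m)) by ring.
  rewrite ler_pM2l ?invr_gt0//; apply: le_trans w.
  rewrite big_mkcond [leRHS]big_mkcond /=; apply: ler_sum => j _.
  case: (m <= lev j)%N => //=; rewrite distrC.
  by case: (`|y j - y i| <= _); rewrite ?mulr1 ?mulr0.
apply: le_trans (_ : 4 * \sum_(0 <= n < m.+1) alpha * Q%:R *
  (4 * ((sc n)^-1 * box_radius n) + 2 * ((sc n)^-1 * sc m)) <= _).
  by rewrite ler_pM2l// !big_nat; apply: ler_sum => n /andP[_]; exact: win.
rewrite -mulr_sumr big_split /= -!mulr_sumr.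
have := sum_box_radius m; have := sum_scale_ratio m.
set s1 := \sum_(_ <= _ < _) _; set s2 := \sum_(_ <= _ < _) _ => h1 h2.
rewrite [leLHS]mulrCA [leRHS]mulrC ler_pM2l//; lra.
Qed.

(** Each pair is charged to its point of smaller level, whose copies are spread more widely; the
    symmetry of [averaged_profile] doubles 48. *)
Lemma sum_averaged_profile :
  \sum_(i | (0 < lev i)%N) \sum_(j | (0 < lev j)%N)
    `|c i| * `|c j| * averaged_profile i j <=
  96 * (alpha * Q%:R) * \sum_i `|c i|.
Proof.
pose a i j := `|c i| * `|c j| * averaged_profile i j.
have a0 i j : 0 <= a i j.
  rewrite /a !mulr_ge0// ?invr_ge0 ?exprn_ge0// ?ler0n//.
  apply: sumr_ge0 => p _; apply: sumr_ge0 => r _; apply: sumr_ge0 => n _.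
  by rewrite mulr_ge0// invr_ge0 ltW.
have aC i j : a i j = a j i by rewrite /a averaged_profileC [`|c i| * _]mulrC.
pose S1 := \sum_(i | (0 < lev i)%N) \sum_(j | (lev i <= lev j)%N) a i j.
have S1b : S1 <= 48 * (alpha * Q%:R) * \sum_i `|c i|.
  rewrite mulr_sumr /S1 big_mkcond /=; apply: ler_sum => i _.
  have aQ : 0 <= alpha * Q%:R by rewrite mulr_ge0// ltW.
  case: ifP => [li|_]; last by rewrite mulr_ge0// mulr_ge0.
  rewrite /a; under eq_bigr do rewrite -mulrA.
  rewrite -mulr_sumr mulrC ler_wpM2r//; exact: sum_averaged_profile_above.
suff : \sum_(i | (0 < lev i)%N) \sum_(j | (0 < lev j)%N) a i j <= S1 + S1 by lra.
apply: le_trans (_ : S1 + \sum_(i | (0 < lev i)%N) \sum_(j | (0 < lev j)%N && (lev j <= lev i)%N) a i j <= _).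
  rewrite -big_split /=; apply: ler_sum => i i0.
  rewrite [X in _ <= X + _]big_mkcond [X in _ <= _ + X]big_mkcond [leLHS]big_mkcond /=.
  rewrite -big_split /=; apply: ler_sum => j _.
  have [ij|ji] := leqP (lev i) (lev j).
    case: ifP => j0 /=; last by rewrite addr0.
    by rewrite lerDl; case: ifP.
  by case: ifP => j0 /=; rewrite ?(ltnW ji) add0r.
rewrite lerD2l (exchange_big_dep (fun j => (0 < lev j)%N)) /=; last first.
  by move=> i j _ /andP[].
apply: ler_sum => j j0; rewrite big_mkcond [leRHS]big_mkcond /=.
apply: ler_sum => i _; rewrite j0 /= aC.
by case: (0 < lev i)%N => //=; case: ifP.
Qed.

End smoothed_pairs.

(** * Weak type estimate for point masses *)

Lemma integrable_bounded_support {R : realType} (f : R -> R) (M a b : R) :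
  measurable_fun setT f -> 0 <= M -> (forall x, `|f x| <= M) ->
  (forall x, ~~ (a <= x <= b) -> f x = 0) ->
  (@lebesgue_measure R).-integrable setT (EFin \o f).
Proof.
move=> mf M0 fM f0.
have iI := integrableZl measurableT M (@integrable_indic_itv R a b true false).
apply: le_integrable iI => //; first exact/measurable_EFinP.
move=> x _ /=; rewrite lee_fin indicE.
have [xab|xab] := boolP (a <= x <= b); last by rewrite f0// normr0.
by rewrite mem_set ?mulr1 ?(ger0_norm M0)//= in_itv.
Qed.

Lemma markov_real {R : realType} (g : R -> R) (a b : R) :
  measurable_fun setT g -> (forall x, 0 <= g x) -> 0 < a ->
  (\int[@lebesgue_measure R]_x (g x)%:E <= b%:E)%E ->
  (@lebesgue_measure R [set x | (a <= g x)%R] <= (b / a)%:E)%E.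
Proof.
move=> mg g0 a0 ib.
have mgE : measurable_fun [set: R] (EFin \o g) by exact/measurable_EFinP.
have := @le_integral_abse _ _ _ (@lebesgue_measure R) _ measurableT _ a mgE a0.
rewrite setTI => H.
have -> : [set x | a <= g x] = [set x | (a%:E <= `|(EFin \o g) x|)%E].
  by apply/seteqP; split => x /=; rewrite lee_fin ger0_norm.
rewrite mulrC EFinM lee_pdivlMl//.
apply: le_trans H _; apply: le_trans ib.
by rewrite le_eqVlt; apply/orP; left; apply/eqP; apply: eq_integral => x _ /=; rewrite ger0_norm.
Qed.

Lemma measure_bigsetU_itv_le {R : realType} (J : Type) (s : seq J) (a b : J -> R) :
  (forall j, a j <= b j) ->
  (@lebesgue_measure R (\big[setU/set0]_(j <- s) `[a j, b j]%classic) <=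
    (\sum_(j <- s) (b j - a j))%:E)%E.
Proof.
move=> ab; elim: s => [|j s IH]; first by rewrite !big_nil measure0.
rewrite !big_cons EFinD.
have mU : measurable (\big[setU/set0]_(j <- s) `[a j, b j]%classic).
  by apply: bigsetU_measurable => i _; exact: measurable_itv.
have mI : measurable (`[a j, b j]%classic : set R) by exact: measurable_itv.
apply: le_trans (measureU2 lebesgue_measure mI mU) _.
apply: leeD => //.
have := lebesgue_measure_itv `[a j, b j]; rewrite /= => ->.
rewrite lte_fin; case: ltP => // _; by rewrite lee_fin subr_ge0.
Qed.

Lemma measurable_fun_shift {R : realType} (k : R -> R) (z : R) :
  measurable_fun setT k -> measurable_fun setT (fun x : R => k (x - z)).
Proof.
move=> mk; apply: (measurableT_comp mk) => //.
by apply: measurable_funD => //; exact: measurable_cst.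
Qed.

Section weak_type_point_masses.
Context {R : realType} {I : finType}.
Variables (Q : nat) (T eps B : R) (y c : I -> R) (alpha : R) (N : nat).
Variables (delta : nat -> R) (k1 k2 : R -> R).
Hypothesis Q2 : (2 <= Q)%N.
Hypothesis T0 : 0 < T.
Hypothesis alpha0 : 0 < alpha.
Hypothesis eps0 : 0 < eps.
Hypothesis B0 : 0 <= B.
Hypothesis N_eps : 2 * scale Q T N <= eps.
Hypothesis delta_gt0 : forall n, 0 < delta n.
Hypothesis delta_step : forall n, 2 * Q%:R * delta n.+1 <= delta n.
Hypothesis delta_top : 2 * Q%:R * delta 0%N <= T.
Hypothesis mk1 : measurable_fun setT k1.
Hypothesis mk2 : measurable_fun setT k2.
Hypothesis k1_le : forall x, `|k1 x| <= eps^-1.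
Hypothesis k2_le : forall x, `|k2 x| <= eps^-1.
Hypothesis k1_supp : forall x, ~~ (eps <= x <= T) -> k1 x = 0.
Hypothesis k2_supp : forall x, ~~ (eps <= x <= T) -> k2 x = 0.
Hypothesis modulus : forall n s, (n <= N.+1)%N -> 0 <= s -> s <= delta n ->
  (\int[@lebesgue_measure R]_v
    (if (2 * scale Q T n <= v)%R then `|k1 v - k1 (v - s)| else 0)%:E <= B%:E)%E.
Hypothesis correlation : forall u,
  `|\int[@lebesgue_measure R]_x (k1 x * k1 (x + u) + k2 x * k2 (x + u))| <=
  B * box_profile Q T N delta u.

Local Notation lev := (level Q T y c alpha N).
Local Notation sc := (scale Q T).
Local Notation mu := (@lebesgue_measure R).

Lemma integrable_product_shift (k : R -> R) (z z' : R) :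
  measurable_fun setT k -> (forall x, `|k x| <= eps^-1) ->
  (forall x, ~~ (eps <= x <= T) -> k x = 0) ->
  mu.-integrable setT (EFin \o (fun x => k (x - z) * k (x - z'))).
Proof.
move=> mk kle ks.
have ei : 0 <= eps^-1 by rewrite invr_ge0 ltW.
apply: (@integrable_bounded_support _ _ (eps^-1 * eps^-1) (eps + z) (T + z)).
- by apply: measurable_funM; exact: measurable_fun_shift.
- exact: mulr_ge0.
- by move=> x; rewrite normrM ler_pM.
- move=> x xz; rewrite ks ?mul0r//.
  by apply: contra xz; rewrite lerBrDr lerBlDr.
Qed.

Lemma correlation_shift (z z' : R) :
  `|\int[mu]_x (k1 (x - z) * k1 (x - z') + k2 (x - z) * k2 (x - z'))| <=
  B * box_profile Q T N delta (z - z').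
Proof.
apply: le_trans (correlation (z - z')).
rewrite le_eqVlt; apply/orP; left; apply/eqP; congr `|_|; congr fine.
pose f x := (k1 (x - z) * k1 (x - z') + k2 (x - z) * k2 (x - z'))%:E.
have mf : measurable_fun setT f.
  apply/measurable_EFinP; apply: measurable_funD.
    by apply: measurable_funM; exact: measurable_fun_shift.
  by apply: measurable_funM; exact: measurable_fun_shift.
rewrite -(integral_shift f z mf); apply: eq_integral => x _.
by rewrite /f addrK -addrA.
Qed.

(** Expanding the squares gives a quadratic form in the autocorrelation; adding the squares of both
    components is what makes [correlation] applicable. *)
Lemma square_integral_le (J : finType) (w z : J -> R) :
  (\int[mu]_x ((\sum_q w q * k1 (x - z q)) ^+ 2 + (\sum_q w q * k2 (x - z q)) ^+ 2)%:E
   <= (B * \sum_q \sum_r `|w q| * `|w r| * box_profile Q T N delta (z q - z r))%:E)%E.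
Proof.
pose F q r x := w q * w r * (k1 (x - z q) * k1 (x - z r) + k2 (x - z q) * k2 (x - z r)).
have iF0 q r : mu.-integrable setT (EFin \o
    (fun x => k1 (x - z q) * k1 (x - z r) + k2 (x - z q) * k2 (x - z r))).
  have := integrableD measurableT
    (integrable_product_shift k1 (z q) (z r) mk1 k1_le k1_supp)
    (integrable_product_shift k2 (z q) (z r) mk2 k2_le k2_supp).
  by apply: eq_integrable => // x _ /=; rewrite EFinD.
have iF q r : mu.-integrable setT (EFin \o F q r).
  have := integrableZl measurableT (w q * w r) (iF0 q r).
  by apply: eq_integrable => // x _ /=; rewrite /F EFinM.
have -> : (\int[mu]_x ((\sum_q w q * k1 (x - z q)) ^+ 2 +
     (\sum_q w q * k2 (x - z q)) ^+ 2)%:E =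
   \int[mu]_x (\sum_(p : J * J) (F p.1 p.2 x)%:E))%E.
  apply: eq_integral => x _; rewrite sumEFin; congr EFin.
  rewrite -(pair_bigA _ (fun q r => F q r x)) /= !expr2 !mulr_suml -big_split /=.
  apply: eq_bigr => q _; rewrite !mulr_sumr -big_split /=.
  by apply: eq_bigr => r _; rewrite /F; ring.
rewrite (integral_sum measurableT (fun p : J * J => iF p.1 p.2)).
have -> : (\sum_(p : J * J) \int[mu]_x (F p.1 p.2 x)%:E =
  (\sum_(p : J * J) \int[mu]_x F p.1 p.2 x)%R%:E)%E.
  rewrite -sumEFin; apply: eq_bigr => p _.
  by rewrite fineK//; exact: (integrable_fin_num measurableT (iF p.1 p.2)).
rewrite lee_fin -(pair_bigA _ (fun q r => \int[mu]_x F q r x)) /= mulr_sumr.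
apply: ler_sum => q _; rewrite mulr_sumr; apply: ler_sum => r _.
rewrite /F RintegralZl//; apply: le_trans (ler_norm _) _.
rewrite !normrM mulrCA ler_wpM2l ?mulr_ge0//.
exact: correlation_shift.
Qed.

(** Large enough for [PN]. It depends on [eps] through [N], but does not enter the final
    constant. *)
Let P := (Num.truncn (delta 0%N / delta N.+1)).+1.
Local Notation sh := (shift_of Q T y c alpha N delta P).

Let PN : delta 0%N <= P%:R * delta N.+1.
Proof. by rewrite -ler_pdivrMr// ltW// truncnS_gt. Qed.

(** Each stopping cell is removed together with the two cells to its right only, because the kernel
    vanishes on the negative half-line. *)
Definition exceptional_set : set R :=
  \big[setU/set0]_(p <- heavy_cells Q T y c alpha N)
    `[p.2%:~R * sc p.1, p.2%:~R * sc p.1 + 3 * sc p.1]%classic.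

Lemma measurable_exceptional_set : measurable exceptional_set.
Proof. by apply: bigsetU_measurable => i _; exact: measurable_itv. Qed.

Lemma exceptional_set_le :
  (mu exceptional_set <= (3 / alpha * \sum_i `|c i|)%:E)%E.
Proof.
apply: le_trans (measure_bigsetU_itv_le _ _ _ _ _) _.
  by move=> p; rewrite lerDl mulr_ge0// ltW// scale_gt0.
rewrite lee_fin; under eq_bigr do rewrite addrC addKr.
rewrite -mulr_sumr mulrAC ler_pdivlMr// -mulrA ler_pM2l// mulrC.
exact: sum_heavy_cells.
Qed.

Lemma exceptional_setP (i : I) (x : R) : (lev i <= N)%N ->
  ~ exceptional_set x -> 0 <= x - y i -> 2 * sc (lev i) <= x - y i.
Proof.
move=> iN xO xy; rewrite leNgt; apply/negP => xy2; apply: xO.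
have s0 : 0 < sc (lev i) by exact: scale_gt0.
rewrite /exceptional_set -bigcup_seq /=.
exists (lev i, cell Q T (lev i) (y i)); first exact: mem_heavy_cells.
rewrite /= in_itv/=.
have := floor_itv (y i / sc (lev i)).
rewrite ler_pdivlMr// ltr_pdivrMr// -/(cell Q T (lev i) (y i)) intrD mulrDl mul1r.
lra.
Qed.

Let mass : R := \sum_i `|c i|.

Let PR0 : 0 < P%:R :> R. Proof. by rewrite ltr0n. Qed.

(** Masses stopped at level 0 are dropped: off the exceptional set they lie to the right of [x] or
    at distance at least [2 T] from it, outside the support of the kernel. *)
Definition smoothed_weight (q : I * 'I_P) : R :=
  if (0 < lev q.1)%N then c q.1 / P%:R else 0.

Local Notation w := smoothed_weight.
Local Notation z q := (y q.1 + sh q.1 q.2).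

Lemma sum_smoothed_profile :
  \sum_q \sum_r `|w q| * `|w r| * box_profile Q T N delta (z q - z r) <=
  96 * (alpha * Q%:R) * mass.
Proof.
have := sum_averaged_profile Q T y c alpha N delta P Q2 T0 alpha0 delta_gt0
  delta_step delta_top (ltn0Sn _) PN.
apply: le_trans; rewrite le_eqVlt; apply/orP; left; apply/eqP.
rewrite -(pair_bigA _ (fun i p => \sum_r `|w (i, p)| * `|w r| *
  box_profile Q T N delta (z (i, p) - z r))) /= [RHS]big_mkcond /=.
apply: eq_bigr => i _.
under eq_bigr => p _ do rewrite -(pair_bigA _ (fun j r => `|w (i, p)| * `|w (j, r)| *
  box_profile Q T N delta (z (i, p) - z (j, r)))) /=.
rewrite exchange_big /=; case: ifPn => [li|/negbTE li]; last first.
  by rewrite big1// => j _; rewrite big1// => p _; rewrite big1// => r _;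
    rewrite /w /= li normr0 !mul0r.
rewrite [RHS]big_mkcond /=; apply: eq_bigr => j _.
case: ifPn => [lj|/negbTE lj]; last first.
  by rewrite big1// => p _; rewrite big1// => r _; rewrite /w /= lj normr0 mulr0 mul0r.
rewrite /averaged_profile mulrA mulrAC mulr_sumr; apply: eq_bigr => p _.
rewrite mulr_sumr; apply: eq_bigr => r _.
rewrite /w /= li lj !normrM (gtr0_norm (_ : 0 < P%:R^-1 :> R)) ?invr_gt0//.
by field; rewrite gt_eqF.
Qed.

Lemma sum_smoothed_weight : \sum_q `|w q| <= mass.
Proof.
rewrite -(pair_bigA _ (fun i p => `|w (i, p)|)) /=; apply: ler_sum => i _.
rewrite /w /= sumr_const card_ord; case: ifP => _; last by rewrite normr0 mul0rn.
rewrite normrM (gtr0_norm (_ : 0 < P%:R^-1 :> R)) ?invr_gt0//.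
by rewrite -[leLHS]mulr_natr divfK ?gt_eqF.
Qed.

Definition local_modulus (n : nat) (s v : R) : R :=
  if 2 * sc n <= v then `|k1 v - k1 (v - s)| else 0.

Lemma local_modulus_ge0 n s v : 0 <= local_modulus n s v.
Proof. by rewrite /local_modulus; case: ifP. Qed.

Lemma measurable_local_modulus n s : measurable_fun setT (local_modulus n s).
Proof.
apply: measurable_fun_ifT => //.
  by apply: measurable_fun_ler => //; exact: measurable_cst.
apply: measurableT_comp => //; apply: measurable_funB => //.
exact: measurable_fun_shift.
Qed.

(** Replacing a mass by its copies costs [k1 v - k1 (v - s)] with [v = x - y i]. If
    [v < 2 * sc (lev i)], both values vanish: for a stopped point the exceptional set excludes
    [0 <= v], and at level [N.+1] the choice of [N] puts [v] below [eps]. *)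
Lemma sum_le_smoothed (x : R) : ~ exceptional_set x ->
  `|\sum_i c i * k1 (x - y i)| <= `|\sum_q w q * k1 (x - z q)| +
    \sum_q `|w q| * local_modulus (lev q.1) (sh q.1 q.2) (x - y q.1).
Proof.
move=> xO.
have klt v : v < eps -> k1 v = 0.
  by move=> ve; apply: k1_supp; rewrite negb_and -ltNge ve.
have sN : sc N.+1 <= sc N.
  have q2 : 2 <= Q%:R :> R by rewrite (ler_nat _ 2 Q).
  rewrite (scaleS Q T Q2 N) ler_peMl ?(ltW (scale_gt0 _ _ _ _ _))//; lra.
have sh0 i (p : 'I_P) : 0 <= sh i p.
  by have /andP[] := shift_of_bounds Q T y c alpha N delta P delta_gt0 (ltn0Sn _) i p (ltn_ord p).
have hv i (p : 'I_P) : `|k1 (x - y i) - k1 (x - y i - sh i p)| <=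
    local_modulus (lev i) (sh i p) (x - y i).
  have s0 := sh0 i p; rewrite /local_modulus.
  case: (leP (2 * sc (lev i)) (x - y i)) => // vs.
  have ve : x - y i < eps.
    have [v0|v0] := ltP (x - y i) 0; first exact: lt_trans v0 eps0.
    have [iN|Ni] := leqP (lev i) N.
      by have := exceptional_setP i x iN xO v0; lra.
    have lN : lev i = N.+1 by apply/eqP; rewrite eqn_leq Ni level_le.
    by rewrite lN in vs; have := N_eps; lra.
  rewrite !klt ?subrr ?normr0//; lra.
have -> : \sum_i c i * k1 (x - y i) = \sum_q w q * k1 (x - y q.1).
  rewrite -(pair_bigA _ (fun i p => w (i, p) * k1 (x - y i))) /=.
  apply: eq_bigr => i _; rewrite -mulr_suml /w /= sumr_const card_ord.
  case: ifPn => [_|]; first by rewrite (_ : c i / P%:R *+ P = c i)// -[LHS]mulr_natr divfK ?gt_eqF.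
  rewrite -leqNgt leqn0 => /eqP l0; rewrite mul0rn mul0r.
  have [v0|v0] := ltP (x - y i) 0.
    by rewrite klt ?mulr0//; exact: lt_trans v0 eps0.
  have iN : (lev i <= N)%N by rewrite l0.
  have := exceptional_setP i x iN xO v0; rewrite l0 /scale expr0 divr1 => vT.
  by rewrite k1_supp ?mulr0// negb_and -!ltNge; apply/orP; right; have := T0; lra.
have -> : \sum_q w q * k1 (x - y q.1) = \sum_q w q * k1 (x - z q) +
    \sum_q w q * (k1 (x - y q.1) - k1 (x - y q.1 - sh q.1 q.2)).
  rewrite -big_split /=; apply: eq_bigr => q _.
  have e : x - z q = x - y q.1 - sh q.1 q.2 by ring.
  by rewrite e; ring.
apply: le_trans (ler_normD _ _) _; rewrite lerD2l.
apply: le_trans (ler_norm_sum _ _ _) _; apply: ler_sum => q _.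
by rewrite normrM ler_wpM2l.
Qed.

(** The 3 is the exceptional set, [2 B] is Markov's inequality for the L^1 remainder at height
    [alpha / 2], and [384 Q B], four times [96 Q B], is the same inequality for the squares at
    height [alpha^2 / 4]. *)
Theorem weak_type_point_masses :
  (mu [set x | (alpha < `|\sum_i c i * k1 (x - y i)|)%R] <=
    ((3 + (2 + 384 * Q%:R) * B) / alpha * \sum_i `|c i|)%:E)%E.
Proof.
rewrite -/mass.
have mass0 : 0 <= mass by exact: sumr_ge0.
pose f x := \sum_i c i * k1 (x - y i).
pose S1 x := \sum_q w q * k1 (x - z q).
pose S2 x := \sum_q w q * k2 (x - z q).
pose G x := \sum_q `|w q| * local_modulus (lev q.1) (sh q.1 q.2) (x - y q.1).
pose H x := S1 x ^+ 2 + S2 x ^+ 2.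
have msum (J : finType) (a b : J -> R) (k : J -> R -> R) :
    (forall q, measurable_fun setT (k q)) ->
    measurable_fun setT (fun x : R => \sum_q a q * k q (x - b q)).
  move=> mk; apply: measurable_sum => q.
  apply: measurable_funM; first exact: measurable_cst.
  exact: (measurable_fun_shift (k q) (b q) (mk q)).
have mf : measurable_fun setT f by exact: (msum I c y (fun=> k1)).
have mS1 : measurable_fun setT S1.
  exact: (msum _ w (fun q => z q) (fun=> k1)).
have mS2 : measurable_fun setT S2.
  exact: (msum _ w (fun q => z q) (fun=> k2)).
have mG : measurable_fun setT G.
  apply: (msum _ (fun q => `|w q|) (fun q => y q.1)
    (fun q => local_modulus (lev q.1) (sh q.1 q.2))) => q.
  exact: measurable_local_modulus.
have mH : measurable_fun setT H by apply: measurable_funD; exact: measurable_funX.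
have G0 x : 0 <= G x.
  by apply: sumr_ge0 => q _; rewrite mulr_ge0// local_modulus_ge0.
have H0 x : 0 <= H x by rewrite addr_ge0 ?sqr_ge0.
have a2 : 0 < alpha / 2 by rewrite divr_gt0.
have a4 : 0 < alpha ^+ 2 / 4 by rewrite divr_gt0 ?exprn_gt0.
have iG : (\int[mu]_x (G x)%:E <= (B * mass)%:E)%E.
  have mq q : measurable_fun setT (fun x : R =>
      (`|w q| * local_modulus (lev q.1) (sh q.1 q.2) (x - y q.1))%:E).
    apply/measurable_EFinP; apply: measurable_funM; first exact: measurable_cst.
    apply: (measurable_fun_shift (local_modulus _ _)).
    exact: measurable_local_modulus.
  rewrite (_ : \int[mu]_x (G x)%:E = \sum_q \int[mu]_x
     (`|w q| * local_modulus (lev q.1) (sh q.1 q.2) (x - y q.1))%:E)%E; last first.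
    rewrite -(ge0_integral_sum mu measurableT mq); last first.
      by move=> q x _; rewrite lee_fin mulr_ge0// local_modulus_ge0.
    by apply: eq_integral => x _; rewrite sumEFin.
  apply: le_trans (_ : (\sum_q (`|w q| * B)%:E <= _)%E); last first.
    by rewrite sumEFin lee_fin -mulr_suml mulrC ler_wpM2l// sum_smoothed_weight.
  apply: lee_sum => q _.
  under eq_integral do rewrite EFinM.
  have mL : measurable_fun setT (fun v : R => (local_modulus (lev q.1) (sh q.1 q.2) v)%:E).
    by apply/measurable_EFinP; exact: measurable_local_modulus.
  have mLs : measurable_fun setT (fun x : R =>
      (local_modulus (lev q.1) (sh q.1 q.2) (x - y q.1))%:E).
    apply/measurable_EFinP; apply: (measurable_fun_shift (local_modulus _ _)).
    exact: measurable_local_modulus.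
  rewrite (ge0_integralZl mu measurableT mLs) ?lee_fin//; last first.
    by move=> x _; rewrite lee_fin local_modulus_ge0.
  rewrite EFinM lee_wpmul2l ?lee_fin//.
  rewrite (ge0_integral_shift _ (- y q.1) mL); last first.
    by move=> v; rewrite lee_fin local_modulus_ge0.
  have /andP[s0 s1] := shift_of_bounds Q T y c alpha N delta P delta_gt0 (ltn0Sn _) q.1 q.2 (ltn_ord _).
  exact: modulus (level_le _ _ _ _ _ _ _) s0 s1.
have iH : (\int[mu]_x (H x)%:E <= (B * (96 * (alpha * Q%:R) * mass))%:E)%E.
  apply: le_trans (square_integral_le _ w (fun q => z q)) _.
  by rewrite lee_fin ler_wpM2l// sum_smoothed_profile.
have mO := measurable_exceptional_set.
have mGs : measurable [set x | (alpha / 2 <= G x)%R].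
  by rewrite -[X in measurable X]setTI; apply: measurable_fun_ler => //; exact: measurable_cst.
have mHs : measurable [set x | (alpha ^+ 2 / 4 <= H x)%R].
  by rewrite -[X in measurable X]setTI; apply: measurable_fun_ler => //; exact: measurable_cst.
have sub : [set x | (alpha < `|f x|)%R] `<=`
    exceptional_set `|` [set x | (alpha / 2 <= G x)%R] `|` [set x | (alpha ^+ 2 / 4 <= H x)%R].
  move=> x /= fx.
  have [xO|xO] := pselect (exceptional_set x); first by left; left.
  have [Gx|Gx] := leP (alpha / 2) (G x); first by left; right.
  right; have := sum_le_smoothed x xO; rewrite -/(f x) -/(G x) -/(S1 x) => fS.
  have aS : alpha / 2 <= `|S1 x| by lra.
  have : (alpha / 2) ^+ 2 <= `|S1 x| ^+ 2 by rewrite lerXn2r// nnegrE ltW.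
  rewrite real_normK ?num_real// /H => h; have := sqr_ge0 (S2 x).
  by rewrite expr_div_n in h; lra.
have mU := measurableU _ _ (measurableU _ _ mO mGs) mHs.
have mfs : measurable [set x | (alpha < `|f x|)%R].
  rewrite -[X in measurable X]setTI; apply: measurable_fun_ltr => //.
  exact: measurableT_comp.
apply: le_trans (le_measure mu _ _ sub) _; rewrite ?inE//.
apply: le_trans (measureU2 mu (measurableU _ _ mO mGs) mHs) _.
apply: le_trans (leeD (measureU2 mu mO mGs) (markov_real H _ _ mH H0 a4 iH)) _.
apply: le_trans (leeD (leeD exceptional_set_le (markov_real G _ _ mG G0 a2 iG)) (lexx _)) _.
rewrite -!EFinD lee_fin -/mass le_eqVlt; apply/orP; left; apply/eqP.
by field; rewrite gt_eqF.
Qed.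

End weak_type_point_masses.

(** * From point masses to integrable functions *)

Lemma ge0_integral_oppr {R : realType} (f : R -> \bar R) :
  measurable_fun setT f -> (forall x, 0 <= f x)%E ->
  (\int[@lebesgue_measure R]_x f (- x)%R = \int[@lebesgue_measure R]_x f x)%E.
Proof.
move=> mf f0.
pose phi : measurableTypeR R -> measurableTypeR R := -%R.
have mphi : measurable_fun [set: measurableTypeR R] phi by exact: oppr_measurable.
have := @ge0_integral_pushforward _ _ _ _ R _ mphi lebesgue_measure setT f measurableT mf (fun y _ => f0 y).
rewrite preimage_setT => <-.
by apply: eq_measure_integral => //= A mA _; exact: lebesgue_measureN.
Qed.

Lemma integral_reflect {R : realType} (f : R -> \bar R) (a : R) :
  measurable_fun setT f ->
  (\int[@lebesgue_measure R]_x f (a - x)%R = \int[@lebesgue_measure R]_x f x)%E.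
Proof.
move=> mf.
have ge0 (u : R -> \bar R) : measurable_fun setT u -> (forall x, 0 <= u x)%E ->
    (\int[@lebesgue_measure R]_x u (a - x)%R = \int[@lebesgue_measure R]_x u x)%E.
  move=> mu u0; have mua : measurable_fun setT (fun x : R => u (x + a)).
    apply: (measurableT_comp mu) => //.
    by apply: measurable_funD => //; exact: measurable_cst.
  rewrite -(ge0_integral_shift u a mu u0) -(ge0_integral_oppr _ mua) //.
  by apply: eq_integral => x _; rewrite addrC.
have mfp := measurable_funepos mf; have mfn := measurable_funeneg mf.
rewrite integralE [RHS]integralE; congr (_ - _)%E.
  rewrite -(ge0 _ mfp (funepos_ge0 f)).
  by apply: eq_integral => x _; rewrite !funeposE.
rewrite -(ge0 _ mfn (funeneg_ge0 f)).
by apply: eq_integral => x _; rewrite !funenegE.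
Qed.

(** Fatou's lemma for sets: [E] is the increasing union of the parts whose points belong to [F n]
    from a fixed index on. *)
Lemma measure_eventually_le {R : realType} (E : set R) (F : nat -> set R) (b : \bar R) :
  measurable E -> (forall n, measurable (F n)) ->
  (forall x, E x -> \forall n \near \oo, F n x) ->
  (forall n, @lebesgue_measure R (F n) <= b)%E ->
  (@lebesgue_measure R E <= b)%E.
Proof.
move=> mE mF EF Fb.
pose G m := E `&` \bigcap_(n in [set n | (m <= n)%N]) F n.
have mG m : measurable (G m).
  by apply: measurableI => //; apply: bigcap_measurable => //; exists m => /=.
have UG : \bigcup_m G m = E.
  apply/seteqP; split => x; first by case=> m _ [].
  by move=> Ex; have [m _ mx] := EF _ Ex; exists m => //; split => // n /= /mx.
have ndG : nondecreasing_seq G.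
  move=> m n mn; apply/subsetPset => x [Ex Fx]; split => // p /= np.
  by apply: Fx => /=; exact: leq_trans np.
have mUG : measurable (\bigcup_m G m) by rewrite UG.
have := nondecreasing_cvg_mu (mu := @lebesgue_measure R) mG mUG ndG.
rewrite UG => cvgG.
rewrite -(cvg_lim _ cvgG)//; apply: lime_le; first by apply/cvg_ex; eexists; exact: cvgG.
apply: nearW => m; apply: le_trans (Fb m); apply: le_measure; rewrite ?inE; [exact: mG|exact: mF|].
move=> x [_ Fx]; exact: (Fx m (leqnn m)).
Qed.

(** * Approximation of a convolution by point masses on a grid *)

Section grid_approximation.
Context {R : realType}.
Variables (k f : R -> R) (M p1 p2 : R).
Hypothesis mk : measurable_fun setT k.
Hypothesis kM : forall v, `|k v| <= M.
Hypothesis kc : forall v, v != p1 -> v != p2 -> {for v, continuous k}.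
Hypothesis intf : (@lebesgue_measure R).-integrable setT (EFin \o f).

Local Notation mu := (@lebesgue_measure R).

Definition node (n j : nat) : R := j%:R / n.+1%:R - n.+1%:R.

Definition node_cell (n j : nat) : set R := `[node n j, node n j + n.+1%:R^-1[%classic.

Definition node_count (n : nat) : nat := (2 * n.+1 * n.+1)%N.

(** The kernel is sampled at the nodes while [f] enters through exact integrals over the cells, so
    convergence rests on the continuity of [k] and the integrability of [f]. *)
Definition node_mass (n : nat) (j : 'I_(node_count n)) : R :=
  \int[mu]_y (f \_ (node_cell n j)) y.

Lemma node_cell_inj n (j j' : nat) y : node_cell n j y -> node_cell n j' y -> j = j'.
Proof.
rewrite /node_cell /= !in_itv/= /node => /andP[a1 a2] /andP[b1 b2].
have n0 : 0 < n.+1%:R :> R by rewrite ltr0n.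
have lt (i i' : nat) : (i%:R : R) / n.+1%:R - n.+1%:R < i'%:R / n.+1%:R - n.+1%:R + n.+1%:R^-1 -> (i <= i')%N.
  move=> h; rewrite -ltnS -(ltr_nat R) -(@ltr_pM2r _ n.+1%:R^-1) ?invr_gt0//.
  by rewrite -[i'.+1%:R]natr1 mulrDl mul1r -(ltrD2r (- n.+1%:R)) [ltRHS]addrAC.
apply/eqP; rewrite eqn_leq !lt//; [exact: le_lt_trans b1 a2|exact: le_lt_trans a1 b2].
Qed.

Lemma node_cell_ex n y : - n.+1%:R <= y -> y < n.+1%:R ->
  exists j : 'I_(node_count n), node_cell n j y.
Proof.
move=> y1 y2; have n0 : 0 < n.+1%:R :> R by rewrite ltr0n.
have v0 : 0 <= (y + n.+1%:R) * n.+1%:R by rewrite mulr_ge0//; lra.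
have vlt : (Num.truncn ((y + n.+1%:R) * n.+1%:R) < node_count n)%N.
  by rewrite truncn_lt_nat// /node_count !natrM ltr_pM2r//; lra.
exists (Ordinal vlt); rewrite /node_cell /= in_itv/= /node.
have /andP[t1 t2] := truncn_itv v0.
set t := Num.truncn _ in t1 t2 *.
rewrite -ltr_pdivlMr// -[t.+1%:R]natr1 mulrDl mul1r in t2.
rewrite -ler_pdivrMr// in t1.
by rewrite lerBlDr t1 addrAC ltrBrDr.
Qed.

Lemma sum_node_cell (V : nat -> R) n y (j : 'I_(node_count n)) : node_cell n j y ->
  \sum_(i < node_count n) (cst (V i) \_ (node_cell n i)) y = V j.
Proof.
move=> yj; rewrite (bigD1 j)//= patchE mem_set// big1 ?addr0// => i ij.
rewrite patchE memNset// => yi; move/eqP: ij; apply.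
exact/val_inj/(node_cell_inj n _ _ y).
Qed.

Lemma sum_node_cell_out (V : nat -> R) n y :
  ~ (exists j : 'I_(node_count n), node_cell n j y) ->
  \sum_(i < node_count n) (cst (V i) \_ (node_cell n i)) y = 0.
Proof.
move=> no; rewrite big1// => i _; rewrite patchE memNset// => yi.
by apply: no; exists i.
Qed.

Let H n x y : R := \sum_(j < node_count n) (cst (k (x - node n j)) \_ (node_cell n j)) y.

Let M0 : 0 <= M. Proof. exact: le_trans (normr_ge0 _) (kM 0). Qed.

Lemma grid_kernel_le n x y : `|H n x y| <= M.
Proof.
have [[j yj]|no] := pselect (exists j : 'I_(node_count n), node_cell n j y).
  by rewrite /H (sum_node_cell (fun j => k (x - node n j)) _ _ _ yj).
by rewrite /H (sum_node_cell_out (fun j => k (x - node n j)) _ _ no) normr0.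
Qed.

Lemma grid_kernel_cvg x y : {for x - y, continuous k} ->
  H n x y @[n --> \oo] --> k (x - y).
Proof.
move=> cxy; apply/cvgrPdist_lt => e e0.
move/cvgrPdist_lt : cxy => /(_ e e0) [d /= d0 dk].
near=> n.
have n0 : 0 < n.+1%:R :> R by rewrite ltr0n.
have yn : `|y| < n.+1%:R.
  apply: lt_le_trans (_ : n%:R <= _); last by rewrite ler_nat.
  by near: n; exact: nbhs_infty_gtr.
have nd : n.+1%:R^-1 < d.
  rewrite -[d]invrK ltf_pV2 ?posrE ?invr_gt0//.
  apply: lt_le_trans (_ : n%:R <= _); last by rewrite ler_nat.
  by near: n; exact: nbhs_infty_gtr.
have [||j yj] := node_cell_ex n y.
- by move: yn; rewrite ltr_norml; lra.
- by move: yn; rewrite ltr_norml; lra.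
rewrite /H (sum_node_cell (fun j => k (x - node n j)) _ _ _ yj).
apply: dk => /=; move: yj; rewrite /node_cell /= in_itv/= => /andP[y1 y2].
rewrite (_ : x - y - (x - node n j) = node n j - y); last by ring.
by rewrite ltr_norml; move: nd y1 y2; move: (n.+1%:R^-1) => a; lra.
Unshelve. all: by end_near. Qed.

Lemma integrable_node_piece n (j : nat) :
  mu.-integrable setT (EFin \o (f \_ (node_cell n j))).
Proof.
have mC : measurable (node_cell n j) by exact: measurable_itv.
by rewrite -restrict_EFin -integrable_mkcond//; apply: integrableS intf.
Qed.

Lemma measurable_grid_kernel n x : measurable_fun setT (H n x).
Proof.
apply: measurable_sum => j; apply/(measurable_restrictT (cst _)).
  exact: measurable_itv.
exact: measurable_cst.
Qed.

Lemma integral_grid_kernel n x :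
  (\int[mu]_y (H n x y * f y)%:E =
   (\sum_(j < node_count n) node_mass n j * k (x - node n j))%:E)%E.
Proof.
have iP (j : 'I_(node_count n)) : mu.-integrable setT
    (fun y => ((k (x - node n j))%:E * ((f \_ (node_cell n j)) y)%:E)%E).
  exact: (integrableZl measurableT _ (integrable_node_piece n j)).
have -> : (\int[mu]_y (H n x y * f y)%:E = \int[mu]_y
    \sum_(j < node_count n) ((k (x - node n j))%:E * ((f \_ (node_cell n j)) y)%:E))%E.
  apply: eq_integral => y _; rewrite /H mulr_suml -sumEFin.
  apply: eq_bigr => j _; rewrite -EFinM; congr EFin; rewrite !patchE.
  by case: ifP; rewrite ?mul0r ?mulr0.
rewrite (integral_sum measurableT iP) -sumEFin; apply: eq_bigr => j _.
rewrite (integralZl measurableT (integrable_node_piece n j)) mulrC EFinM.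
congr (_ * _)%E; rewrite /node_mass /Rintegral fineK//.
exact: (integrable_fin_num measurableT (integrable_node_piece n j)).
Qed.

Lemma sum_node_mass n :
  ((\sum_(j < node_count n) `|node_mass n j|)%:E <= \int[mu]_y `|f y|%:E)%E.
Proof.
have mP (j : 'I_(node_count n)) :
    measurable_fun setT (fun y => `|(f \_ (node_cell n j)) y|%:E).
  have /integrableP[/measurable_EFinP mp _] := integrable_node_piece n j.
  by apply/measurable_EFinP; exact: measurableT_comp.
have mf : measurable_fun setT (fun y => `|f y|%:E).
  have /integrableP[/measurable_EFinP mf _] := intf.
  by apply/measurable_EFinP; exact: measurableT_comp.
rewrite -sumEFin.
apply: le_trans (_ : (\sum_(j < node_count n) \int[mu]_y `|(f \_ (node_cell n j)) y|%:E <= _)%E).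
  apply: lee_sum => j _; rewrite EFin_normr_Rintegral//; last exact: integrable_node_piece.
  have /integrableP[mp _] := integrable_node_piece n j.
  exact: (le_abse_integral mu measurableT mp).
rewrite -(ge0_integral_sum mu measurableT mP); last by move=> j y _; rewrite lee_fin.
apply: ge0_le_integral => //.
- by move=> y _; apply: sume_ge0 => j _; rewrite lee_fin.
- exact: emeasurable_sum.
move=> y _; rewrite sumEFin lee_fin.
have [[j yj]|no] := pselect (exists j : 'I_(node_count n), node_cell n j y).
  rewrite (bigD1 j)//= patchE mem_set// big1 ?addr0// => i ij.
  rewrite patchE memNset ?normr0// => yi; move/eqP: ij; apply.
  exact/val_inj/(node_cell_inj n _ _ y).
rewrite big1// => j _; rewrite patchE memNset ?normr0// => yj.
by apply: no; exists j.
Qed.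

(** Dominated convergence with majorant [M * |f|]: the step kernel converges for every [y] other
    than [x - p1] and [x - p2]. The limit exists at every [x], not merely almost everywhere. *)
Lemma grid_convolution_cvg x :
  \sum_(j < node_count n) node_mass n j * k (x - node n j) @[n --> \oo] -->
  \int[mu]_y (k (x - y) * f y).
Proof.
have mf : measurable_fun setT f by have /integrableP[/measurable_EFinP] := intf.
have mkx : measurable_fun setT (fun y : R => k (x - y)).
  apply: (measurableT_comp mk) => //.
  by apply: measurable_funB => //; exact: measurable_cst.
have mF n : measurable_fun setT (fun y => (H n x y * f y)%:E).
  apply/measurable_EFinP; apply: measurable_funM => //.
  exact: measurable_grid_kernel.
have mG : measurable_fun setT (fun y : R => (k (x - y) * f y)%:E).
  by apply/measurable_EFinP; exact: measurable_funM.
have cvgF : {ae mu, forall y, setT y ->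
    (H n x y * f y)%:E @[n --> \oo] --> (k (x - y) * f y)%:E}.
  exists [set x - p1; x - p2]; split.
  - by apply: measurableU; exact: measurable_set1.
  - by apply: countable_lebesgue_measure0; exact/finite_set_countable/finite_set2.
  move=> y /= ncv; apply: contrapT => yp; apply: ncv => _.
  apply: cvg_EFin; first by apply: nearW.
  apply: cvgM; last exact: cvg_cst.
  apply: grid_kernel_cvg; apply: kc; apply/eqP => e; apply: yp; [left|right];
    by rewrite -e opprB addrC subrK.
have iMf : mu.-integrable setT (fun y => (M%:E * `|f y|%:E)%E).
  apply: integrableZl => //.
  by have := integrable_abse intf.
have dom : {ae mu, forall y n, setT y -> (`|(H n x y * f y)%:E| <= M%:E * `|f y|%:E)%E}.
  apply: aeW => y n _; rewrite -EFinM lee_fin normrM ler_wpM2r//.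
  exact: grid_kernel_le.
have [iG _ cvgI] := @dominated_convergence _ (measurableTypeR R) R mu setT measurableT
  (fun n y => (H n x y * f y)%:E) (fun y => (k (x - y) * f y)%:E) _ mF mG cvgF iMf dom.
have fG : (\int[mu]_y (k (x - y) * f y)%:E)%E \is a fin_num.
  exact: (integrable_fin_num measurableT iG).
have cE : (\sum_(j < node_count n) node_mass n j * k (x - node n j))%:E @[n --> \oo] -->
    (\int[mu]_y (k (x - y) * f y))%:E.
  rewrite /Rintegral fineK//; apply: cvg_trans cvgI; apply: near_eq_cvg.
  by apply: nearW => n /=; rewrite integral_grid_kernel.
exact: (fine_cvg cE).
Qed.

Theorem weak_type_of_point_masses (A alpha : R) :
  0 < alpha -> 0 <= A ->
  (forall n (y c : 'I_n -> R) (a : R), 0 < a ->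
    (mu [set x | (a < `|\sum_i c i * k (x - y i)|)%R] <=
      (A / a * \sum_i `|c i|)%:E)%E) ->
  (mu [set x | (alpha < `|\int[mu]_y (k (x - y) * f y)|)%R] <=
    (A / alpha)%:E * \int[mu]_y `|f y|%:E)%E.
Proof.
move=> a0 A0 WP.
pose F n (x : R) := \sum_(j < node_count n) node_mass n j * k (x - node n j).
have mF n : measurable_fun setT (F n).
  apply: measurable_sum => j; apply: measurable_funM; first exact: measurable_cst.
  exact: measurable_fun_shift.
pose G (x : R) := \int[mu]_y (k (x - y) * f y).
have mG : measurable_fun setT G.
  by apply: (measurable_fun_cvg mF) => x _; exact: grid_convolution_cvg.
have mS (u : R -> R) : measurable_fun setT u -> measurable [set x | (alpha < `|u x|)%R].
  move=> mu'; rewrite -[X in measurable X]setTI; apply: measurable_fun_ltr => //.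
  exact: measurableT_comp.
apply: (@measure_eventually_le _ _ (fun n => [set x | (alpha < `|F n x|)%R])).
- exact: mS.
- by move=> n; exact: mS.
- move=> x /= ax.
  have cn : `|F n x| @[n --> \oo] --> `|G x|.
    by apply: cvg_norm; exact: grid_convolution_cvg.
  exact: cvgr_gt cn _ ax.
move=> n; apply: le_trans (WP _ (fun j : 'I_(node_count n) => node n j) (node_mass n) alpha a0) _.
rewrite EFinM lee_wpmul2l ?lee_fin ?divr_ge0 ?(ltW a0)//.
exact: sum_node_mass.
Qed.

End grid_approximation.

(** * Consequences of the hypotheses on [gamma] and [psi] *)

Lemma nondecreasing_derive_ge0 {R : realType} (f : R -> R) (a b x l : R) :
  a < x < b -> (forall u v, a < u -> u <= v -> v < b -> f u <= f v) ->
  is_derive x 1 f l -> 0 <= l.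
Proof.
move=> /andP[ax xb] fmono dfx.
have := @derive_val _ _ _ _ _ _ _ dfx => <-.
apply: limr_ge; first exact: (@ex_derive _ _ _ _ _ _ _ dfx).
near=> h.
have h0 : h != 0 by near: h; exact: nbhs_dnbhs_neq.
have hx1 : `|h| < x - a by near: h; apply: dnbhs0_lt; rewrite subr_gt0.
have hx2 : `|h| < b - x by near: h; apply: dnbhs0_lt; rewrite subr_gt0.
rewrite /GRing.scale /= mulr1.
move: hx1 hx2; rewrite !ltr_norml => /andP[l1 l2] /andP[l3 l4].
move: h0; rewrite neq_lt => /orP[h0|h0].
  by rewrite nmulr_rge0 ?invr_lt0// subr_le0; apply: fmono; lra.
by rewrite pmulr_rge0 ?invr_gt0// subr_ge0; apply: fmono; lra.
Unshelve. all: by end_near. Qed.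

Lemma exists_expr_gt {R : realType} (x M : R) : 1 < x -> exists n, M < x ^+ n.
Proof.
move=> x1; have x10 : 0 < x - 1 by lra.
pose n := (Num.truncn (`|M| / (x - 1))).+1.
exists n; apply: le_lt_trans (ler_norm M) _.
have nM : `|M| < n%:R * (x - 1) by rewrite -ltr_pdivrMr// truncnS_gt.
suff : 1 + n%:R * (x - 1) <= x ^+ n by lra.
elim: n {nM} => [|n IH]; first by rewrite expr0 mul0r addr0.
rewrite exprS -natr1.
have : x * (1 + n%:R * (x - 1)) <= x * x ^+ n by rewrite ler_pM2l//; lra.
have : 0 <= n%:R * (x - 1) ^+ 2 by rewrite mulr_ge0 ?sqr_ge0.
by rewrite expr2; nra.
Qed.

Lemma mem_itv01 {R : realType} (x : R) : 0 < x -> x <= 1 -> x \in (`]0, 1]%classic : set R).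
Proof. by move=> x0 x1; rewrite inE/= in_itv/= x0. Qed.

Section phase_from_hypotheses.
Context {R : realType}.
Variables (gam psi : R -> R) (dg dp : nat -> R -> R) (t0 s0 C : R).
Hypothesis Hg : is_Ck_on `]0, 1] `]0, 1[ 3 gam dg.
Hypothesis Hp : is_Ck_on `[0, 1] `]0, 1[ 2 psi dp.
Hypothesis Hppos : forall t : R, 0 < t <= 1 -> 0 < psi t.
Hypothesis Hplim : psi @ at_right 0 --> 0.
Hypothesis Ht0 : 0 < t0.
Hypothesis HC : 0 < C.
Hypothesis Hm_p : monotone_on `]0, 1] psi.
Hypothesis Hm_g2 : monotone_on `]0, 1] (dg 2%N).
Hypothesis Hm_p1 : monotone_on `]0, 1] (dp 1%N).
Hypothesis Hg1pos : forall t : R, 0 < t <= 1 -> 0 < dg 1%N t.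
Hypothesis Hg1dec : {in `]0, 1] &, {homo dg 1%N : x y / x < y >-> y < x}}.
Hypothesis Ha2 : forall t : R, 0 < t < t0 -> t <= 1 ->
     `|dp 1%N t / psi t| <= 2^-1 * `|dg 3%N t / dg 2%N t|.
Hypothesis Ha3 : forall s t1 t2 : R, s0 < s -> 0 < t1 <= 1 -> 0 < t2 <= 1 ->
     dg 1%N t1 = s -> dg 1%N t2 = 2 * s ->
     `|dg 2%N t2| <= C * `|dg 2%N t1|.
Hypothesis Ha4 : exists eps0 A0 : R, 0 < eps0 /\ 1 + eps0 < A0 /\
     forall t : R, 0 < t < t0 -> (1 + eps0) * t <= 1 ->
       A0 * dg 1%N ((1 + eps0) * t) <= dg 1%N t.

Local Notation g := (dg 1%N).
Local Notation h := (fun x => - dg 2%N x).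

Lemma gam_derive (x : R) : 0 < x < 1 -> is_derive x 1 gam (g x).
Proof.
by move=> x01; have [<- [d _]] := Hg; apply: d => //=; rewrite in_itv/=.
Qed.

Lemma dg_derive (j : nat) (x : R) : (j < 3)%N -> 0 < x < 1 ->
  is_derive x 1 (dg j) (dg j.+1 x).
Proof.
by move=> j3 x01; have [_ [d _]] := Hg; apply: d => //=; rewrite in_itv/=.
Qed.

Lemma psi_derive (x : R) : 0 < x < 1 -> is_derive x 1 psi (dp 1%N x).
Proof.
by move=> x01; have [<- [d _]] := Hp; apply: d => //=; rewrite in_itv/=.
Qed.

Lemma g_noninc (x y : R) : 0 < x -> x <= y -> y <= 1 -> g y <= g x.
Proof.
move=> x0; rewrite le_eqVlt => /orP[/eqP -> //|xy] y1; apply: ltW.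
by apply: Hg1dec => //; rewrite in_itv/=; lra.
Qed.

Lemma h_ge0 (x : R) : 0 < x < 1 -> 0 <= h x.
Proof.
move=> x01.
apply: (@nondecreasing_derive_ge0 _ (fun z => - g z) 0 1 x) => //.
  by move=> u v u0 uv v1; rewrite lerN2; apply: g_noninc => //; exact: ltW.
exact: is_deriveN (dg_derive 1%N x isT x01).
Qed.

(** With [r = 1 + eps0], iterating (a.4) [k] times multiplies [g] by [A0^k] while dividing the
    argument by [r^k]. As [A0 > r], some [k] has [A0^k > 4 r^k]; an integer [Q] between [r^k] and
    [2 r^k] then satisfies [2 Q <= A0^k], and monotonicity passes from [x / r^k] to [x / Q]. An
    integer ratio is needed for cells to nest. *)
Lemma g_growth_ratio : exists (Q : nat) (t1 : R), [/\ (2 <= Q)%N, 0 < t1, t1 < 1, t1 < t0 &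
  forall x, 0 < x -> x <= t1 -> 2 * Q%:R * g x <= g (x / Q%:R)].
Proof.
have [e [A0 [e0 [eA H]]]] := Ha4.
have [r rE] : exists r, r = 1 + e by exists (1 + e).
have r1 : 1 < r by lra.
have [k Hk] : exists k, 4 < (A0 / r) ^+ k.
  by apply: exists_expr_gt; rewrite ltr_pdivlMr; lra.
pose Q := (Num.truncn (r ^+ k)).+1.
have rk1 : 1 <= r ^+ k by apply: exprn_ege1; lra.
have rkQ : r ^+ k <= Q%:R by apply: ltW; exact: truncnS_gt.
have rk0 : 0 <= r ^+ k by lra.
have Qrk : Q%:R <= 2 * r ^+ k.
  have t : (Num.truncn (r ^+ k))%:R <= r ^+ k by rewrite truncn_le.
  by rewrite /Q -natr1; lra.
have Q2 : (2 <= Q)%N by rewrite ltnS truncn_gt0.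
have t00 := Ht0.
pose t1 := Num.min (t0 / 2) (1 / 2).
have t1t : t1 <= t0 / 2 by rewrite ge_min lexx.
have t11 : t1 <= 1 / 2 by rewrite ge_min lexx orbT.
have t10 : 0 < t1 by rewrite lt_min; apply/andP; split; lra.
exists Q, t1; split => //; try lra.
move=> x x0 xt.
have iter m : A0 ^+ m * g x <= g (x / r ^+ m) /\ 0 < x / r ^+ m <= x.
  elim: m => [|m [IH /andP[I1 I2]]]; first by rewrite !expr0 divr1 mul1r x0 !lexx.
  have e1 : x / r ^+ m.+1 = x / r ^+ m / r by rewrite exprS; field; rewrite expf_neq0 ?gt_eqF//; lra.
  have e2 : (1 + e) * (x / r ^+ m / r) = x / r ^+ m by rewrite -rE; field; rewrite expf_neq0 ?gt_eqF//; lra.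
  have I3 : 0 < x / r ^+ m / r by rewrite divr_gt0//; lra.
  have I4 : x / r ^+ m / r <= x / r ^+ m by rewrite ler_pdivrMr; nra.
  rewrite e1; split; last by rewrite I3 (le_trans I4).
  apply: le_trans (H _ _ _); last 2 first.
  - by rewrite I3; lra.
  - by rewrite e2; lra.
  by rewrite e2 exprS -mulrA ler_pM2l//; lra.
have [I1 /andP[I2 I3]] := iter k.
have gx : 0 < g x by apply: Hg1pos; lra.
have Ak : 2 * Q%:R <= A0 ^+ k.
  have -> : A0 ^+ k = (A0 / r) ^+ k * r ^+ k.
    by rewrite -exprMn divfK// gt_eqF//; lra.
  have : 4 * r ^+ k <= (A0 / r) ^+ k * r ^+ k by rewrite ler_wpM2r// ltW.
  by lra.
apply: le_trans (_ : A0 ^+ k * g x <= _); first by rewrite ler_pM2r.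
apply: le_trans I1 _.
have q0 : 0 < Q%:R :> R by rewrite ltr0n.
apply: g_noninc; [by rewrite divr_gt0| |lra].
by rewrite ler_pM2l// lef_pV2 ?posrE//; lra.
Qed.

Lemma g_growth_iter (Q : nat) (t1 : R) : (0 < Q)%N -> t1 <= 1 ->
  (forall x, 0 < x -> x <= t1 -> 2 * Q%:R * g x <= g (x / Q%:R)) ->
  forall n x, 0 < x -> x <= t1 ->
  (2 * Q%:R) ^+ n * g x <= g (x / Q%:R ^+ n) /\ 0 < x / Q%:R ^+ n <= x.
Proof.
move=> Q0 t11 H n x x0 xt; have q1 : 1 <= Q%:R :> R by rewrite ler1n.
have [q qE] : exists q : R, q = Q%:R by exists Q%:R.
rewrite -qE in q1 H *.
elim: n => [|n [IH /andP[I1 I2]]]; first by rewrite !expr0 divr1 mul1r x0 !lexx.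
have e1 : x / q ^+ n.+1 = x / q ^+ n / q.
  by rewrite exprS; field; rewrite expf_neq0 ?gt_eqF//; lra.
have I3 : 0 < x / q ^+ n / q by rewrite divr_gt0//; lra.
have I4 : x / q ^+ n / q <= x / q ^+ n by rewrite ler_pdivrMr; nra.
rewrite e1; split; last by rewrite I3 (le_trans I4).
apply: le_trans (H _ I1 _); last by lra.
rewrite exprS -mulrA ler_pM2l//; lra.
Qed.

Lemma h_noninc (x y : R) : 0 < x -> x <= y -> y < 1 -> h y <= h x.
Proof.
case: Hm_g2 => mono x0 xy y1.
  by rewrite lerN2; apply: mono => //; apply: mem_itv01; lra.
(* If [h] were nondecreasing it would be bounded near 0, hence so would [g], against its growth
   along [t1 / Q^n]. *)
exfalso.
have [Q [t1 [Q2 t10 t11 _ growth]]] := g_growth_ratio.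
have Q0 : (0 < Q)%N by exact: ltnW.
have q2 : 2 <= Q%:R :> R by rewrite (ler_nat _ 2 Q).
have gt1 : 0 < g t1 by apply: Hg1pos; lra.
pose M := g t1 + h t1 * t1.
have [n Mn] : exists n, M / g t1 < (2 * Q%:R) ^+ n by apply: exists_expr_gt; lra.
have [G1 /andP[z0 zt]] := g_growth_iter Q t1 Q0 (ltW t11) growth n t1 t10 (lexx _).
move: G1 z0 zt; set z := t1 / _ => G1 z0 zt.
rewrite ltr_pdivrMr// in Mn.
have ht0 : 0 <= h t1 by apply: h_ge0; lra.
have inc : - g t1 - (- g z) <= h t1 * t1 - h t1 * z.
  apply: (@le_increment_of_derive _ z t1 (fun u => - g u) h (fun u => h t1 * u) (fun=> h t1) zt).
  - by move=> u uz; apply: is_deriveN; apply: dg_derive => //; lra.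
  - by move=> u uz; rewrite -[X in is_derive _ _ _ X]mulr1; apply: is_deriveZ.
  - by move=> u uz; rewrite lerN2; apply: mono; [apply: mem_itv01; lra|apply: mem_itv01; lra|lra].
have := mulr_ge0 ht0 (ltW z0).
by rewrite /M in Mn; lra.
Qed.

Lemma psi_nondec (x y : R) : 0 < x -> x <= y -> y <= 1 -> psi x <= psi y.
Proof.
case: Hm_p => mono x0 xy y1.
  by apply: mono => //; apply: mem_itv01; lra.
(* A nonincreasing [psi] would stay above [psi 1 > 0], which contradicts its limit 0 at the
   origin. *)
exfalso; have p1 : 0 < psi 1 by apply: Hppos; lra.
have : psi 1 <= 0.
  rewrite -(cvg_lim _ Hplim)//; apply: limr_ge; first exact: cvgP Hplim.
  near=> t; apply: mono.
  - exact: mem_itv01.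
  - by apply: mem_itv01; near: t; [exact: nbhs_right_gt|exact: nbhs_right_le].
  - by near: t; apply: nbhs_right_le.
by lra.
Unshelve. all: by end_near. Qed.

Lemma dpsi_ge0 (x : R) : 0 < x < 1 -> 0 <= dp 1%N x.
Proof.
move=> x01; apply: (@nondecreasing_derive_ge0 _ psi 0 1 x) => //.
  by move=> u v u0 uv v1; apply: psi_nondec => //; exact: ltW.
exact: psi_derive.
Qed.

(** Cleared of denominators, (a.2) says exactly that the derivative of [psi^2 h] is nonpositive; its
    constant 1/2 matches the square. *)
Lemma psi_sqr_h_noninc (x y : R) : 0 < x -> x <= y -> y < 1 -> y < t0 ->
  (forall z, x <= z <= y -> 0 < h z) ->
  psi y ^+ 2 * h y <= psi x ^+ 2 * h x.
Proof.
move=> x0 xy y1 yt hpos; rewrite -subr_le0 -[leRHS](subrr 0).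
have d3 z : x <= z <= y -> 0 <= dg 3%N z.
  move=> zxy; have z01 : 0 < z < 1 by lra.
  apply: (@nondecreasing_derive_ge0 _ (dg 2%N) 0 1 z) => //; last exact: dg_derive.
  by move=> u v u0 uv v1; rewrite -lerN2; exact: h_noninc.
apply: (@le_increment_of_derive _ x y (fun z => psi z ^+ 2 * h z)
  (fun z => psi z ^+ 2 * - dg 3%N z + h z * (2 * psi z * dp 1%N z)) (cst 0) (cst 0) xy).
- move=> z zxy; have z01 : 0 < z < 1 by lra.
  apply: is_derive_mul; last exact: is_deriveN (dg_derive 2%N z isT z01).
  apply: (is_derive_eq (is_derive_mul _ _ _ _ _ (psi_derive z z01) (psi_derive z z01))).
  by ring.
move=> z zxy; have z01 : 0 < z < 1 by lra.
have hz := hpos z zxy; have pz : 0 < psi z by apply: Hppos; lra.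
have dz := d3 z zxy; have p'z := dpsi_ge0 z z01.
have zt : 0 < z < t0 by lra.
have := Ha2 z zt (ltW (proj2 (andP z01))).
have -> : `|dp 1%N z / psi z| = dp 1%N z / psi z by rewrite ger0_norm// divr_ge0// ltW.
have -> : `|dg 3%N z / dg 2%N z| = dg 3%N z / h z.
  rewrite (_ : _ / dg 2%N z = - (dg 3%N z / h z)); last by rewrite invrN mulrN opprK.
  by rewrite normrN ger0_norm// divr_ge0// ltW.
rewrite ler_pdivrMr// mulrAC mulrA ler_pdivlMr// => a2.
have /= k : psi z * (dp 1%N z * h z) <= psi z * (2^-1 * dg 3%N z * psi z).
  by rewrite ler_pM2l//=; move: a2 => /=; lra.
by rewrite /= expr2; lra.
Qed.

Lemma g_increment_le (x y : R) : 0 < x -> x <= y -> y < 1 ->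
  g x - g y <= h x * (y - x).
Proof.
move=> x0 xy y1.
have inc : - g y - (- g x) <= h x * y - h x * x.
  apply: (@le_increment_of_derive _ x y (fun u => - g u) h (fun u => h x * u) (fun=> h x) xy).
  - by move=> u uz; apply: is_deriveN; apply: dg_derive => //; lra.
  - by move=> u uz; rewrite -[X in is_derive _ _ _ X]mulr1; apply: is_deriveZ.
  - by move=> u uz; apply: h_noninc; lra.
by move: inc => /=; lra.
Qed.

(* For convex [psi], [psi'(x)] is at most the slope of [psi] over [[x, y]] with
   [g y = g x / 2]; there (a.2) and (a.3) keep [psi] from growing by more than
   a constant factor, while [y - x >= g x / (2 h x)]. *)
Lemma dpsi_convex_bound (x tau : R) :
  {in `]0, 1] &, {homo dp 1%N : x y / x <= y}} ->
  0 < x -> x <= tau -> tau < 1 -> tau < t0 ->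
  (forall z, 0 < z -> z <= tau -> 0 < h z) ->
  2 * s0 < g x -> 2 * g tau <= g x ->
  dp 1%N x * g x <= 2 * (1 + C) * psi x * h x.
Proof.
move=> mono x0 xt t1 tt0 hpos gs gt.
have C00 := HC.
have x01 : 0 < x < 1 by lra.
have cg : {within `[x, tau], continuous g}.
  apply: derivable_within_continuous => z; rewrite in_itv/= => zx.
  have z01 : 0 < z < 1 by lra.
  by have [] := dg_derive 1%N z isT z01.
have gpos : 0 < g x by apply: Hg1pos; lra.
have gxt : g tau <= g x by apply: g_noninc; lra.
have minE : Num.min (g x) (g tau) = g tau by rewrite minElt; case: ltP => //; lra.
have maxE : Num.max (g x) (g tau) = g x by rewrite maxElt; case: ltP => //; lra.
have mid : Num.min (g x) (g tau) <= g x / 2 <= Num.max (g x) (g tau).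
  by rewrite minE maxE; lra.
have [y] := IVT xt cg mid.
rewrite in_itv/= => /andP[xy yt] gy.
have y01 : 0 < y <= 1 by lra.
have hxy : h x <= C * h y.
  have s0y : s0 < g y by rewrite gy; lra.
  have x01' : 0 < x <= 1 by lra.
  have gxy : g x = 2 * g y by rewrite gy; lra.
  have := Ha3 _ _ _ s0y y01 x01' erefl gxy.
  have hx := hpos x x0 xt; have hy := hpos y (lt_le_trans x0 xy) yt.
  by rewrite -normrN -[`|dg 2%N y|]normrN !gtr0_norm.
have hx := hpos x x0 xt; have hy := hpos y (lt_le_trans x0 xy) yt.
have y1 : y < 1 by lra.
have yt0 : y < t0 by lra.
have sq : psi y ^+ 2 * h y <= psi x ^+ 2 * h x.
  by apply: psi_sqr_h_noninc => // z zxy; apply: hpos; lra.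
have px : 0 < psi x by apply: Hppos; lra.
have py : 0 < psi y by apply: Hppos.
(* The bound [C <= (1 + C)^2] replaces a square root of [C]. *)
have sq2 : psi y ^+ 2 <= ((1 + C) * psi x) ^+ 2.
  have s1 : psi y ^+ 2 * h y <= psi x ^+ 2 * (C * h y).
    by apply: le_trans sq _; rewrite ler_pM2l// exprn_gt0.
  have s2 : psi y ^+ 2 <= psi x ^+ 2 * C by rewrite -(ler_pM2r hy); apply: le_trans s1 _; rewrite mulrA.
  apply: le_trans s2 _; rewrite exprMn mulrC ler_pM2r ?exprn_gt0//.
  by rewrite expr2; nra.
have pyx : psi y <= (1 + C) * psi x.
  by rewrite -(@ler_pXn2r _ 2) ?nnegrE//; rewrite ?(ltW py)// mulr_ge0 ?(ltW px)//; lra.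
have slope : dp 1%N x * y - dp 1%N x * x <= psi y - psi x.
  apply: (@le_increment_of_derive _ x y (fun u => dp 1%N x * u) (fun=> dp 1%N x) psi (dp 1%N) xy).
  - by move=> u ux; rewrite -[X in is_derive _ _ _ X]mulr1; apply: is_deriveZ.
  - by move=> u ux; apply: psi_derive; lra.
  - by move=> u ux; apply: mono; rewrite ?in_itv/=; lra.
have gi := g_increment_le x y x0 xy y1.
have dp0 := dpsi_ge0 x x01.
have e1 : dp 1%N x * (g x - g y) <= dp 1%N x * (h x * (y - x)) by rewrite ler_wpM2l.
have e2 : h x * (dp 1%N x * (y - x)) <= h x * ((1 + C) * psi x).
  by rewrite ler_pM2l//; lra.
by move: e1 e2 => /=; rewrite gy; lra.
Qed.

(** The drop of [g] over [[x, q x]] is at least half of [g x] and at most [(q x - x) h x], whence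
    [1/x <= 2 q h/g]. For concave [psi] the slope over [[x / 2, x]] gives [psi'/psi <= 2/x], which
    reduces to the previous bound; the convex case is [dpsi_convex_bound]. *)
Lemma log_derivative_bound : exists (Q : nat) (T' C0 : R), [/\ (2 <= Q)%N, 0 < T' < 1, 0 <= C0,
   (forall x, 0 < x -> x <= T' -> 2 * Q%:R * g x <= g (x / Q%:R)) &
   forall x, 0 < x < T' -> x^-1 <= C0 * (h x / g x) /\
     `|dp 1%N x / psi x - x^-1| <= C0 * (h x / g x)].
Proof.
have [Q [t1 [Q2 t10 t11 t1t0 growth]]] := g_growth_ratio.
have C00 := HC.
have Q0 : (0 < Q)%N by exact: ltnW.
have q2 : 2 <= Q%:R :> R by rewrite (ler_nat _ 2 Q).
have [q qE] : exists q : R, q = Q%:R by exists Q%:R.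
rewrite -qE in q2 growth.
have [tau tauE] : exists tau, tau = t1 / q by exists (t1 / q).
have tau0 : 0 < tau by rewrite tauE divr_gt0//; lra.
have qtau : q * tau = t1 by rewrite tauE mulrC divfK// gt_eqF//; lra.
have taut : tau < t1 by nra.
have hlow x : 0 < x -> x <= tau -> g x <= 2 * q * x * h x.
  move=> x0 xt; have qx : x <= q * x by nra.
  have qx0 : 0 < q * x by lra.
  have qxt : q * x <= t1 by nra.
  have := growth (q * x) qx0 qxt; rewrite [q * x]mulrC mulfK; last by rewrite gt_eqF//; lra.
  rewrite [x * q]mulrC => G1.
  have gqx : 0 < g (q * x) by apply: Hg1pos; lra.
  have gx : 0 < g x by apply: Hg1pos; lra.
  have hx : 0 <= h x by apply: h_ge0; lra.
  have qx1 : q * x < 1 by lra.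
  have := g_increment_le x (q * x) x0 qx qx1.
  have : 0 <= h x * x by apply: mulr_ge0 => //; lra.
  have : 2 * g (q * x) <= 2 * q * g (q * x) by rewrite ler_pM2r//; lra.
  by move: G1 hx => /=; lra.
have hpos z : 0 < z -> z <= tau -> 0 < h z.
  move=> z0 zt; have := hlow z z0 zt; have gz : 0 < g z by apply: Hg1pos; lra.
  move=> hl; rewrite lt_neqAle h_ge0 ?andbT; last by lra.
  by apply/eqP => e; move: hl; rewrite -e mulr0; lra.
have gtau : 0 < g tau by apply: Hg1pos; lra.
(* [T'] is taken so small that [g] exceeds both [2 s0] and [2 g tau] on its left, as the convex case
   requires. *)
pose m := Num.max s0 (g tau).
have [n nm] : exists n, 2 * m / g tau < (2 * q) ^+ n by apply: exists_expr_gt; lra.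
rewrite ltr_pdivrMr// in nm.
rewrite qE in growth nm.
have [G1 /andP[T0 Tt]] := g_growth_iter Q t1 Q0 (ltW t11) growth n tau tau0 (ltW taut).
move: G1 T0 Tt; set T' := tau / _ => G1 T0 Tt.
have ms : s0 <= m by rewrite le_max lexx.
have mt : g tau <= m by rewrite le_max lexx orbT.
pose C2 := 4 * q + 2 * (1 + C).
exists Q, T', (C2 + 2 * q); split => //.
- by rewrite T0; lra.
- by rewrite /C2; lra.
- by move=> x x0 xT; apply: growth; lra.
move=> x /andP[x0 xT].
have xtau : x <= tau by lra.
have x01 : 0 < x < 1 by lra.
have gx : 0 < g x by apply: Hg1pos; lra.
have hx := hpos x x0 xtau.
have px : 0 < psi x by apply: Hppos; lra.
have dpx := dpsi_ge0 x x01.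
have hg0 : 0 <= h x / g x by rewrite divr_ge0// ltW.
have inv_le : x^-1 <= 2 * q * (h x / g x).
  rewrite mulrA ler_pdivlMr// mulrC ler_pdivrMr//.
  by have := hlow x x0 xtau; move=> /=; lra.
have xi : 0 < x^-1 by rewrite invr_gt0.
have log_le : dp 1%N x / psi x <= C2 * (h x / g x).
  case: Hm_p1 => mono.
    have gxT : g T' <= g x by apply: g_noninc => //; [exact: ltW|lra].
    have H : dp 1%N x * g x <= 2 * (1 + C) * psi x * h x.
      apply: (dpsi_convex_bound x tau) => //; [|exact: lt_trans taut t11|exact: lt_trans taut t1t0|lra|lra].
      by move=> u v uI vI; apply: mono; rewrite inE.
    have H2 : dp 1%N x / psi x <= 2 * (1 + C) * (h x / g x).
      by rewrite mulrA ler_pdivlMr// mulrAC ler_pdivrMr//; lra.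
    apply: le_trans H2 _; apply: ler_wpM2r => //.
    by rewrite /C2; lra.
  have x2 : x / 2 <= x by lra.
  have slope : dp 1%N x * x - dp 1%N x * (x / 2) <= psi x - psi (x / 2).
    apply: (@le_increment_of_derive _ (x / 2) x (fun u => dp 1%N x * u) (fun=> dp 1%N x) psi (dp 1%N) x2).
    - by move=> u ux; rewrite -[X in is_derive _ _ _ X]mulr1; apply: is_deriveZ.
    - by move=> u ux; apply: psi_derive; lra.
    - move=> u /andP[xu ux]; have u0 : 0 < u by apply: lt_le_trans xu; rewrite divr_gt0.
      have x1 : x <= 1 by case/andP: x01 => _ /ltW.
      by apply: mono; rewrite ?mem_itv01 ?u0 ?x0//= (le_trans ux).
  have p2 : 0 < psi (x / 2) by apply: Hppos; lra.
  have H2 : dp 1%N x / psi x <= 2 * x^-1.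
    by rewrite ler_pdivrMr// mulrAC ler_pdivlMr//; lra.
  apply: le_trans H2 _; apply: le_trans (_ : 2 * (2 * q * (h x / g x)) <= _).
    by rewrite ler_pM2l.
  rewrite mulrA; apply: ler_wpM2r => //.
  by rewrite /C2; lra.
have lp0 : 0 <= dp 1%N x / psi x by rewrite divr_ge0// ltW.
have c20 : 0 <= C2 * (h x / g x) by lra.
split; first by rewrite mulrDl; lra.
by rewrite mulrDl ler_norml; lra.
Qed.

Lemma Kphase_derive (beta x : R) : 0 < x < 1 ->
  is_derive x 1 (Kphase gam psi beta) (g x + beta * (dp 1%N x / psi x - x^-1)).
Proof.
move=> x01; have x0 : 0 < x by case/andP: x01.
have px : 0 < psi x by apply: Hppos; rewrite x0 ltW//; case/andP: x01.
have dlp : is_derive x 1 (fun z => ln (psi z)) (dp 1%N x / psi x).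
  rewrite mulrC; exact: (@is_derive1_comp _ (@ln R) psi x _ _ (is_derive1_ln px) (psi_derive x x01)).
exact: is_deriveD (gam_derive x x01) (is_deriveZ beta (is_deriveB dlp (is_derive1_ln x0))).
Qed.

(** The scales and [C0] are chosen before [beta]; only the perturbation constant [C0 * |beta|]
    depends on it. *)
Lemma admissible_of_hypotheses : exists (Q : nat) (T T' C0 : R),
  T < 1 /\ forall beta, admissible_phase Q T T' C0 (C0 * `|beta|) g h
    (Kphase gam psi beta) (fun x => g x + beta * (dp 1%N x / psi x - x^-1)).
Proof.
have [Q [T' [C0 [Q2 /andP[T0 T1] C00 growth logb]]]] := log_derivative_bound.
have Q0 : (0 < Q)%N by exact: ltnW.
have q2 : 2 <= Q%:R :> R by rewrite (ler_nat _ 2 Q).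
have gT : 0 < g T' by apply: Hg1pos; rewrite T0 ltW.
(* At [T = T' / Q^(m+1)] the product [T * g T] is at least [2^(m+1) T' g T'], which exceeds [2 Q]
   for this [m]; the exponent [m.+1] keeps [T < T'] even if [m = 0]. *)
have [m Hm] : exists m, 2 * Q%:R / (T' * g T') < 2 ^+ m by apply: exists_expr_gt; lra.
have [G1 /andP[z0 zT]] := g_growth_iter Q T' Q0 (ltW T1) growth m.+1 T' T0 (lexx _).
have qm0 : 0 < Q%:R ^+ m.+1 :> R by rewrite exprn_gt0//; lra.
have qm1 : 1 < Q%:R ^+ m.+1 :> R by rewrite exprn_egt1//; lra.
have zT' : T' / Q%:R ^+ m.+1 < T' by rewrite ltr_pdivrMr// ltr_pMr.
exists Q, (T' / Q%:R ^+ m.+1), T', C0; split; first by lra.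
move=> beta; split => //.
- move=> x xT; have x01 : 0 < x < 1 by lra.
  by rewrite opprK; exact: dg_derive.
- by move=> x xT; apply: Hg1pos; lra.
- by move=> x xT; apply: h_ge0; lra.
- by move=> x y x0 xy yT; apply: h_noninc => //; lra.
- by move=> x xT; apply: growth; lra.
- by move=> x xT; have [] := logb x xT.
- by move=> x xT; apply: Kphase_derive; lra.
- move=> x xT; have [_ lb] := logb x xT.
  rewrite addrC addKr normrM mulrAC [C0 * _ * _]mulrC.
  by rewrite ler_wpM2l.
- by rewrite mulr_ge0.
- by rewrite z0.
- have gTT : 0 < g (T' / Q%:R ^+ m.+1).
    by apply: lt_le_trans G1; rewrite mulr_gt0// exprn_gt0//; lra.
  rewrite lef_pV2 ?posrE; [|exact: mulr_gt0|by rewrite mulr_gt0//; lra].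
  apply: le_trans (_ : T' / Q%:R ^+ m.+1 * ((2 * Q%:R) ^+ m.+1 * g T') <= _); last first.
    by rewrite ler_pM2l.
  rewrite (_ : T' / Q%:R ^+ m.+1 * ((2 * Q%:R) ^+ m.+1 * g T') = 2 * (2 ^+ m * (T' * g T'))); last first.
    rewrite exprMn (exprS 2); field; exact: lt0r_neq0.
  rewrite ltr_pdivrMr ?mulr_gt0// in Hm.
  have : 0 <= 2 * Q%:R :> R by lra.
  by lra.
Qed.

End phase_from_hypotheses.

(** * The truncated kernel *)

Section truncated_kernel_weak_type.
Context {R : realType} {Q : nat} {T T' C0 b : R} {g h th th' : R -> R}.
Hypothesis adm : admissible_phase Q T T' C0 b g h th th'.
Variable eps : R.
Hypothesis eps0 : 0 < eps.

Local Notation q := (Q%:R : R).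
Local Notation sc := (scale Q T).
Local Notation mu := (@lebesgue_measure R).

Definition inverse_frequency (n : nat) : R := (g (sc n))^-1.

Local Notation delta := inverse_frequency.

(** Sum of the autocorrelation and translation constants, affine in [b]. The outer factor [q]
    converts [1 / l_(n+1)] into [1 / l_n]. *)
Definition kernel_constant : R :=
  q * (q * (4 * q ^+ 2 + 2 * q ^+ 2 * (4 * C0 + b) * (1 + 2 * q) * (q + 1)) + q)
  + (2 * C0 + b + 2).

Local Notation B := kernel_constant.

Let Q2 : (2 <= Q)%N := phase_ratio adm.
Let q2 : 2 <= q := q_ge2 adm.
Let T0 : 0 < T. Proof. by have /andP[] := phase_cut adm. Qed.
Let TT : T < T'. Proof. by have /andP[] := phase_cut adm. Qed.

Lemma scale_top : sc 0 = T.
Proof. by rewrite /scale expr0 divr1. Qed.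

Lemma scale_le_top n : sc n <= T.
Proof.
elim: n => [|n IH]; first by rewrite scale_top.
apply: le_trans IH; rewrite (scaleS Q T Q2 n) ler_peMl ?(ltW (scale_gt0 _ _ Q2 T0 _))//.
by have := q2; lra.
Qed.

Lemma scale_itv n : 0 < sc n < T'.
Proof. by rewrite scale_gt0//= (le_lt_trans (scale_le_top n)). Qed.

Lemma delta_gt0 n : 0 < delta n.
Proof. by rewrite invr_gt0 (phase_gt0 adm)// scale_itv. Qed.

Lemma delta_step n : 2 * q * delta n.+1 <= delta n.
Proof.
have q20 : 0 < 2 * q by have := q2; lra.
have := phase_growth adm _ (scale_itv n).
rewrite (_ : sc n / Q%:R = sc n.+1); last first.
  by rewrite (scaleS Q T Q2 n) mulrC mulKf// gt_eqF//; have := q2; lra.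
move=> G; rewrite -ler_pdivlMl// -invfM lef_pV2 ?posrE//.
  by rewrite (phase_gt0 adm)// scale_itv.
by rewrite mulr_gt0// (phase_gt0 adm)// scale_itv.
Qed.

Lemma delta_top : 2 * q * delta 0%N <= T.
Proof.
have := phase_cut_small adm; rewrite /delta scale_top invfM => H.
have q20 : 0 < 2 * q by have := q2; lra.
rewrite mulrC -ler_pdivlMr//.
by rewrite ler_pdivrMl// in H.
Qed.

Lemma delta_le_scale n : 2 * q * delta n <= sc n.
Proof.
case: n => [|n]; first by rewrite scale_top; exact: delta_top.
have q20 : 0 < 2 * q by have := q2; lra.
elim: n => [|n IH].
  apply: le_trans (delta_step 0) _.
  rewrite -(ler_pM2l q20); apply: le_trans delta_top _.
  rewrite -{1}scale_top (scaleS Q T Q2 0) -mulrA; have := mulr_ge0 (ltW (lt_le_trans (ltr0n _ 2) q2)) (ltW (scale_gt0 Q T Q2 T0 1)).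
  lra.
apply: le_trans (delta_step n.+1) _.
rewrite -(ler_pM2l q20); apply: le_trans IH _.
rewrite (scaleS Q T Q2 n.+1) -mulrA; have := mulr_ge0 (ltW (lt_le_trans (ltr0n _ 2) q2)) (ltW (scale_gt0 Q T Q2 T0 n.+2)).
lra.
Qed.

Lemma kernel_constant_ge0 : 0 <= B.
Proof.
have q0 : 0 <= q by have := q2; lra.
have C00 := phase_C0_ge0 adm; have b0 := phase_b_ge0 adm.
by rewrite !addr_ge0// !(mulr_ge0, addr_ge0)// ?addr_ge0 ?sqr_ge0// !mulr_ge0.
Qed.

(** One term of the profile suffices in each range: [rho = l_(n+1)] for
    [delta_(n+1) < u <= delta_n], [rho = T] for [delta_0 < u <= T], and for [u] up to [delta_(N+1)]
    the trivial bound [1 / eps <= 1 / l_(N+1)]. *)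
Lemma autocorr_le_profile (N : nat) (u : R) : 2 * sc N <= eps ->
  `|autocorr T th eps u| <= B * box_profile Q T N delta u.
Proof.
move=> Ne; wlog u0 : u / 0 <= u.
  move=> H; have [u0|u0] := leP 0 u; first exact: H.
  rewrite -(autocorrN adm)// -box_profileN; apply: H; lra.
have q0 : 0 < q by have := q2; lra.
have C00 := phase_C0_ge0 adm; have b0 := phase_b_ge0 adm.
pose K := q * (4 * q ^+ 2 + 2 * q ^+ 2 * (4 * C0 + b) * (1 + 2 * q) * (q + 1)) + q.
have K0 : q <= K.
  by rewrite /K lerDr !(mulr_ge0, addr_ge0) ?sqr_ge0 ?(ltW q0)//.
have BE : B = q * K + (2 * C0 + b + 2) by [].
have qK : K <= q * K by rewrite ler_peMl; have := q2; lra.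
have KB : q * K <= B by rewrite BE; lra.
have sinv n : 0 < (sc n)^-1 by rewrite invr_gt0 scale_gt0.
have term n : (n < N.+2)%N -> u <= box_radius T delta n ->
    (sc n)^-1 <= box_profile Q T N delta u.
  move=> nN un; rewrite /box_profile big_mkord (bigD1 (Ordinal nN))//=.
  rewrite (ger0_norm u0) un mulr1 lerDl; apply: sumr_ge0 => i _.
  by rewrite mulr_ge0// ltW.
have W0 : 0 <= box_profile Q T N delta u.
  by apply: sumr_ge0 => i _; rewrite mulr_ge0// ltW.
have [uT|Tu] := leP u T; last first.
  rewrite (autocorr_eq0 adm eps u)// ?normr0 ?mulr_ge0// ?kernel_constant_ge0//.
  by rewrite (ger0_norm u0).
have [uN|Nu] := leP u (delta N.+1).
  apply: le_trans (autocorr_le_inv adm eps u eps0) _.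
  have h1 : eps^-1 <= (sc N.+1)^-1.
    rewrite lef_pV2 ?posrE ?scale_gt0//; apply: le_trans Ne.
    rewrite (scaleS Q T Q2 N); have := scale_gt0 Q T Q2 T0 N.+1 => s0.
    have : sc N.+1 <= q * sc N.+1 by rewrite ler_peMl ?(ltW s0)//; have := q2; lra.
    have : 0 <= q * sc N.+1 by rewrite mulr_ge0// ltW.
    by lra.
  apply: le_trans h1 _; apply: le_trans (term N.+1 (ltnSn _) uN) _.
  by rewrite ler_peMl//; have := q2; lra.
have u0' : 0 < u by apply: lt_trans Nu; exact: delta_gt0.
have freq n : delta n <= u -> 1 <= u * g (sc n).
  move=> du; have gs : 0 < g (sc n) by rewrite (phase_gt0 adm)// scale_itv.
  by rewrite mulrC -ler_pdivrMl// mulr1.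
have [ud|du] := leP u (delta 0); last first.
  have ug : 1 <= u * g T by rewrite -scale_top; apply: freq; exact: ltW.
  have := autocorr_bound adm eps T u eps0 T0 (lexx _) u0' ug (or_introl erefl).
  rewrite -/K => ab; apply: le_trans ab _.
  have := term 0%N isT uT; rewrite scale_top => tm.
  apply: le_trans (_ : K * box_profile Q T N delta u <= _).
    by rewrite ler_wpM2l//; lra.
  by rewrite ler_wpM2r//; lra.
have ex : exists n, delta n.+1 < u by exists N.
have [n dn nmin] := ex_minnP ex.
have nN : (n <= N)%N by apply: nmin.
have un : u <= delta n.
  case: n dn nmin nN => // n dn nmin nN; rewrite leNgt; apply/negP => /nmin.
  by rewrite ltnn.
have s0 := scale_gt0 Q T Q2 T0 n.+1.
have ug := freq n.+1 (ltW dn).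
have ur : u <= sc n.+1 - sc n.+1 / q.
  apply: le_trans un _.
  have := delta_le_scale n; rewrite (scaleS Q T Q2 n) -mulrA mulrCA ler_pM2l// => h2.
  have h3 : sc n.+1 / q <= sc n.+1 / 2 by rewrite ler_pM2l// lef_pV2 ?posrE//.
  by lra.
have := autocorr_bound adm eps (sc n.+1) u eps0 s0 (scale_le_top _) u0' ug (or_intror ur).
rewrite -/K => ab; apply: le_trans ab _.
have nN2 : (n < N.+2)%N by rewrite ltnS (leq_trans nN).
have ub : u <= box_radius T delta n.
  by apply: le_trans un _; exact: (delta_le_box Q T delta Q2 delta_gt0 delta_top).
have tm := term n nN2 ub.
rewrite (_ : K / sc n.+1 = q * K * (sc n)^-1); last first.
  by rewrite (scaleS Q T Q2 n); field; rewrite !gt_eqF.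
apply: le_trans (_ : q * K * box_profile Q T N delta u <= _).
  by rewrite ler_wpM2l// mulr_ge0//; lra.
by rewrite ler_wpM2r.
Qed.

(** The companion [tr2] completes the autocorrelation; allowing both orders treats the real and the
    imaginary part of the kernel at once. *)
Lemma trunc_kernel_weak_type (tr1 tr2 : R -> R) (I : finType) (y c : I -> R) (a : R) :
  (tr1 = cos /\ tr2 = sin) \/ (tr1 = sin /\ tr2 = cos) -> 0 < a ->
  (mu [set x | (a < `|\sum_i c i * trunc_kernel T th tr1 eps (x - y i)|)%R] <=
    ((3 + (2 + 384 * q) * B) / a * \sum_i `|c i|)%:E)%E.
Proof.
move=> tr12 a0.
have cb (v : R) : `|cos v| <= 1 by rewrite ler_norml cos_geN1 cos_le1.
have sb (v : R) : `|sin v| <= 1 by rewrite ler_norml sin_geN1 sin_le1.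
have [tr' [dtr [tr1b tr'b]]] : exists tr' : R -> R, (forall v : R, is_derive v 1 tr1 (tr' v)) /\
    (forall v, `|tr1 v| <= 1) /\ (forall v, `|tr' v| <= 1).
  case: tr12 => -[-> _].
    exists (fun v => - sin v); split; first exact: is_derive_cos.
    by split=> // v; rewrite normrN.
  by exists cos; split; first exact: is_derive_sin.
have [tr2' [dtr2 tr2b]] : exists tr' : R -> R, (forall v : R, is_derive v 1 tr2 (tr' v)) /\
    (forall v, `|tr2 v| <= 1).
  case: tr12 => -[_ ->].
    by exists cos; split; first exact: is_derive_sin.
  by exists (fun v => - sin v); split; first exact: is_derive_cos.
have [n Hn] : exists n, 2 * T / eps < q ^+ n by apply: exists_expr_gt; have := q2; lra.
have Ne : 2 * sc n <= eps.
  rewrite /scale mulrA ler_pdivrMr; last by rewrite exprn_gt0//; have := q2; lra.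
  by rewrite [leRHS]mulrC -ler_pdivrMr// ltW.
have bound (tr : R -> R) : (forall v, `|tr v| <= 1) -> forall x,
    `|trunc_kernel T th tr eps x| <= eps^-1.
  move=> trb x; apply: le_trans (trunc_kernel_le tr trb eps x eps0) _.
  case: ifP => ex; last by rewrite invr_ge0 ltW.
  by rewrite lef_pV2 ?posrE// (lt_le_trans eps0).
have supp (tr : R -> R) x : ~~ (eps <= x <= T) -> trunc_kernel T th tr eps x = 0.
  by rewrite /trunc_kernel => /negbTE ->.
apply: (weak_type_point_masses Q T eps B y c a n delta _ (trunc_kernel T th tr2 eps)
  Q2 T0 a0 eps0 kernel_constant_ge0 Ne delta_gt0 delta_step delta_top).
- exact: (measurable_trunc_kernel adm tr1 tr' dtr).
- exact: (measurable_trunc_kernel adm tr2 tr2' dtr2).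
- exact: bound.
- exact: bound.
- exact: supp.
- exact: supp.
- move=> m s _ s0 sd.
  have sm := scale_gt0 Q T Q2 T0 m.
  have gs : 0 < g (sc m) by rewrite (phase_gt0 adm)// scale_itv.
  have ssc : s <= sc m.
    apply: le_trans sd _; apply: le_trans (delta_le_scale m).
    by rewrite ler_peMl ?(ltW (delta_gt0 _))//; have := q2; lra.
  have sg : s * g (sc m) <= 1 by rewrite -ler_pdivlMr// mul1r.
  apply: le_trans (trunc_kernel_modulus adm tr1 tr' dtr tr1b tr'b eps (sc m) s
    eps0 sm (scale_le_top m) s0 ssc sg) _.
  have q0 : 0 <= q by have := q2; lra.
  have C00 := phase_C0_ge0 adm; have b0 := phase_b_ge0 adm.
  rewrite lee_fin /B lerDr mulr_ge0// addr_ge0// mulr_ge0// addr_ge0 ?mulr_ge0 ?sqr_ge0 ?addr_ge0//.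
  by rewrite mulr_ge0.
move=> u; apply: le_trans (autocorr_le_profile n u Ne).
rewrite le_eqVlt; apply/orP; left; apply/eqP; congr `|_|.
by case: tr12 => -[-> ->] //; rewrite /autocorr; apply: eq_Rintegral => x _; rewrite addrC.
Qed.

End truncated_kernel_weak_type.

(** * From the truncated kernel to the kernel on [eps, 1] *)

Lemma continuous_trunc_kernel {R : realType} (T eps : R) (th tr : R -> R) (x : R) :
  0 < eps -> (forall x : R, eps < x < T -> {for x, continuous th}) -> continuous tr ->
  x != eps -> x != T -> {for x, continuous (trunc_kernel T th tr eps)}.
Proof.
move=> e0 cth ctr xe xT.
have [xin|xout] := boolP (eps < x < T).
  have c : {for x, continuous (fun v => tr (th v) / v)}.
    apply: continuousM.
      by apply: continuous_comp; [exact: cth|exact: ctr].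
    by apply: inv_continuous; rewrite gt_eqF//; lra.
  rewrite /prop_for /continuous_at /trunc_kernel /=; have /andP[/ltW -> /ltW ->] := xin.
  apply: cvg_trans c; apply: near_eq_cvg.
  have : \forall v \near x, v \in `]eps, T[ by apply: near_in_itvoo; rewrite in_itv.
  by apply: filterS => v; rewrite in_itv => /andP[/ltW -> /ltW ->].
have x_out : x < eps \/ T < x.
  by move: xout xe xT; rewrite negb_and -!leNgt !neq_lt => /orP[] ? /orP[] ? /orP[] ?; lra.
have near_out : \forall v \near x, trunc_kernel T th tr eps v = 0.
  case: x_out => h.
    have : \forall v \near x, v < eps by exact: lt_nbhsl.
    by apply: filterS => v ve; rewrite /trunc_kernel leNgt ve.
  have : \forall v \near x, T < v by exact: lt_nbhsr.
  by apply: filterS => v ve; rewrite /trunc_kernel (leNgt v) ve andbF.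
rewrite /prop_for /continuous_at (nbhs_singleton near_out).
apply: cvg_near_cst; exact: near_out.
Qed.

(** The change of kernel alters the sum by a function whose L^1 norm is at most [c0 * s] times the
    total mass. Both factors 2 come from splitting the threshold into halves. *)
Lemma weak_type_perturbation {R : realType} (k k' : R -> R) (c0 u s A : R)
    (I : finType) (y c : I -> R) (a : R) :
  measurable_fun setT k -> measurable_fun setT k' -> 0 <= c0 -> 0 <= s -> 0 < a ->
  (forall x, `|k' x - k x| <= c0 * \1_`[u, u + s] x) ->
  (forall a, 0 < a ->
    (@lebesgue_measure R [set x | (a < `|\sum_i c i * k (x - y i)|)%R] <=
      (A / a * \sum_i `|c i|)%:E)%E) ->
  (@lebesgue_measure R [set x | (a < `|\sum_i c i * k' (x - y i)|)%R] <=
      ((2 * A + 2 * (c0 * s)) / a * \sum_i `|c i|)%:E)%E.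
Proof.
move=> mk mk' c00 s0 a0 kk WP; pose mu := @lebesgue_measure R.
pose p i (x : R) := `|c i| * (c0 * \1_`[u, u + s] (x - y i)).
pose G (x : R) := \sum_i p i x.
have a20 : 0 < a / 2 by rewrite divr_gt0.
have mind : measurable_fun setT (fun x : R => c0 * \1_`[u, u + s] x).
  by apply: measurable_funM => //; exact: measurable_indic.
have mp i : measurable_fun setT (p i).
  by apply: measurable_funM => //; exact: (measurable_fun_shift _ _ mind).
have p0 i x : 0 <= p i x by rewrite !mulr_ge0// indicE.
have mG : measurable_fun setT G by exact: measurable_sum.
have intG : (\int[mu]_x (G x)%:E <= (c0 * s * \sum_i `|c i|)%:E)%E.
  have -> : (\int[mu]_x (G x)%:E = \sum_i \int[mu]_x (p i x)%:E)%E.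
    have mpE i : measurable_fun setT (fun x => (p i x)%:E) by exact/measurable_EFinP.
    rewrite -(ge0_integral_sum mu measurableT mpE); last by move=> i x _; rewrite lee_fin.
    by apply: eq_integral => x _; rewrite sumEFin.
  rewrite mulr_sumr -sumEFin; apply: lee_sum => i _.
  rewrite /p; under eq_integral do rewrite EFinM.
  have mE : measurable_fun setT (fun x : R => (c0 * \1_`[u, u + s] x)%:E).
    exact/measurable_EFinP.
  have mEs : measurable_fun setT (fun x : R => (c0 * \1_`[u, u + s] (x - y i))%:E).
    by apply/measurable_EFinP; exact: (measurable_fun_shift _ _ mind).
  rewrite ge0_integralZl//; last by move=> x _; rewrite lee_fin mulr_ge0// indicE.
  rewrite (ge0_integral_shift (fun x => (c0 * \1_`[u, u + s] x)%:E) (- y i) mE); last first.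
    by move=> x; rewrite lee_fin mulr_ge0// indicE.
  by rewrite integral_scaled_indic_itv// -EFinM lee_fin mulrC.
have := markov_real G (a / 2) _ mG (fun x => sumr_ge0 _ (fun i _ => p0 i x)) a20 intG.
have := WP (a / 2) a20.
set E1 := [set x | _]; set E2 := [set x | _]; set E := [set x | _] => h1 h2.
have mS (v : R -> R) (b : R) : measurable_fun setT v -> measurable [set x | (b < `|v x|)%R].
  move=> mv; rewrite -[X in measurable X]setTI; apply: measurable_fun_ltr => //.
  exact: measurableT_comp.
have mE1 : measurable E1.
  apply: mS; apply: measurable_sum => i; apply: measurable_funM => //.
  exact: measurable_fun_shift.
have mE : measurable E.
  apply: mS; apply: measurable_sum => i; apply: measurable_funM => //.
  exact: measurable_fun_shift.
have mE2 : measurable E2.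
  by rewrite -[X in measurable X]setTI; apply: measurable_fun_ler.
have sub : E `<=` E1 `|` E2.
  move=> x /= ax; rewrite /E1 /E2 /=; case: (ltP (a / 2) `|\sum_i c i * k (x - y i)|) => h.
    by left.
  right; suff sm : `|\sum_i c i * k' (x - y i)| <= `|\sum_i c i * k (x - y i)| + G x.
    by have := lt_le_trans ax sm; lra.
  have -> : \sum_i c i * k' (x - y i) = \sum_i c i * k (x - y i) +
      \sum_i c i * (k' (x - y i) - k (x - y i)).
    by rewrite -big_split /=; apply: eq_bigr => i _; ring.
  apply: le_trans (ler_normD _ _) _; rewrite lerD2l.
  apply: le_trans (ler_norm_sum _ _ _) _; apply: ler_sum => i _.
  by rewrite normrM ler_wpM2l.
apply: le_trans (_ : (mu (E1 `|` E2) <= _)%E).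
  by apply: le_measure; rewrite ?inE//; exact: measurableU.
apply: le_trans (_ : (mu E1 + mu E2 <= _)%E); first exact: measureU2.
apply: le_trans (leeD h1 h2) _; rewrite -EFinD lee_fin le_eqVlt; apply/orP; left; apply/eqP.
by field; rewrite gt_eqF.
Qed.

Lemma integrable_bounded_mul_reflect {R : realType} (k f : R -> R) (M x : R) :
  measurable_fun setT k -> (forall v, `|k v| <= M) ->
  (@lebesgue_measure R).-integrable setT (EFin \o f) ->
  (@lebesgue_measure R).-integrable setT (fun y : R => (k y * f (x - y))%:E).
Proof.
move=> mk kM intf; have mf : measurable_fun setT f by have /integrableP[/measurable_EFinP] := intf.
have mr : measurable_fun [set: R] (fun y : R => x - y).
  by apply: measurable_funB => //; exact: measurable_cst.
have mfx : measurable_fun setT (fun y : R => f (x - y)) by exact: measurableT_comp mf mr.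
have intfx : (@lebesgue_measure R).-integrable setT (fun y : R => (f (x - y))%:E).
  apply/integrableP; split; first exact/measurable_EFinP.
  have mabs : measurable_fun [set: R] (fun y : R => `|(f y)%:E|%E).
    by apply: measurableT_comp => //; exact/measurable_EFinP.
  have -> : (\int[@lebesgue_measure R]_(y in setT) `|(f (x - y))%:E| =
      \int[@lebesgue_measure R]_(y in setT) `|(f y)%:E|)%E.
    exact: (integral_reflect (fun y => `|(f y)%:E|%E) x mabs).
  by have /integrableP[] := intf.
apply: (le_integrable measurableT _ _ (integrableZl measurableT M (integrable_abse intfx))).
  by apply/measurable_EFinP; exact: measurable_funM.
move=> y _ /=; rewrite lee_fin !normrM normr_id ler_wpM2r//.
exact: le_trans (kM y) (ler_norm M).
Qed.

Lemma convolution_reflect {R : realType} (k f : R -> R) (x : R) :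
  measurable_fun setT k -> measurable_fun setT f ->
  \int[@lebesgue_measure R]_y (k y * f (x - y)) =
  \int[@lebesgue_measure R]_y (k (x - y) * f y).
Proof.
move=> mk mf; rewrite /Rintegral; congr fine.
have mr : measurable_fun [set: R] (fun y : R => x - y).
  by apply: measurable_funB => //; exact: measurable_cst.
rewrite -(integral_reflect (fun y => (k (x - y) * f y)%:E) x).
  by apply: eq_integral => y _; rewrite subKr.
apply/measurable_EFinP; apply: measurable_funM => //.
exact: measurableT_comp mk mr.
Qed.

Section truncated_convolution.
Context {R : realType} {Q : nat} {T T' C0 b : R} {g h th th' : R -> R}.
Hypothesis adm : admissible_phase Q T T' C0 b g h th th'.
Hypothesis cth : forall x : R, 0 < x < 1 -> {for x, continuous th}.
Hypothesis T1 : T < 1.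
Variable eps : R.
Hypothesis eps0 : 0 < eps.

Local Notation mu := (@lebesgue_measure R).

Definition weak_constant : R :=
  2 * (3 + (2 + 384 * Q%:R) * @kernel_constant R Q C0 b) + 2 * T^-1.

Lemma weak_constant_ge0 : 0 <= weak_constant.
Proof.
have /andP[/ltW T0 _] := phase_cut adm; have B0 := kernel_constant_ge0 adm.
by rewrite /weak_constant; move: kernel_constant B0 => B B0; rewrite !(addr_ge0, mulr_ge0) ?invr_ge0.
Qed.

Lemma trunc_kernel1_properties (tr : R -> R) : tr = cos \/ tr = sin ->
  [/\ measurable_fun setT (trunc_kernel 1 th tr eps),
      forall v, `|trunc_kernel 1 th tr eps v| <= eps^-1 &
      forall v, v != eps -> v != 1 -> {for v, continuous (trunc_kernel 1 th tr eps)}].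
Proof.
move=> tr12.
have ctr : continuous tr by case: tr12 => ->; [exact: continuous_cos|exact: continuous_sin].
have trb v : `|tr v| <= 1.
  by case: tr12 => ->; rewrite ler_norml ?cos_geN1 ?cos_le1 ?sin_geN1 ?sin_le1.
have cth' x : eps < x < 1 -> {for x, continuous th} by move=> xe; apply: cth; have := eps0; lra.
split.
- exact: measurable_trunc_kernel_continuous.
- move=> v; apply: le_trans (trunc_kernel_le tr trb eps v eps0) _.
  case: ifP => ev; last by rewrite invr_ge0 ltW.
  by rewrite lef_pV2 ?posrE// (lt_le_trans eps0).
by move=> v; exact: continuous_trunc_kernel.
Qed.

Lemma trunc_kernel_cut (tr : R -> R) (x : R) : (forall v, `|tr v| <= 1) ->
  `|trunc_kernel 1 th tr eps x - trunc_kernel T th tr eps x| <= T^-1 * \1_`[T, T + 1] x.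
Proof.
move=> trb; have /andP[T0 _] := phase_cut adm.
have r0 : 0 <= T^-1 * \1_`[T, T + 1] x by rewrite mulr_ge0 ?indicE// invr_ge0 ltW.
rewrite /trunc_kernel; case: (leP eps x) => /= [ex|_]; last by rewrite subrr normr0.
case: (leP x T) => [xT|Tx]; first by rewrite (le_trans xT (ltW T1)) subrr normr0.
case: (leP x 1) => [x1|_]; last by rewrite subrr normr0.
have x0 : 0 < x by exact: lt_trans Tx.
rewrite subr0 normrM indicE mem_set/=; last by rewrite in_itv/=; apply/andP; split; lra.
rewrite mulr1 normfV (gtr0_norm x0).
apply: le_trans (_ : x^-1 <= _); first by rewrite ler_piMl// invr_ge0 ltW.
by rewrite lef_pV2 ?posrE// ltW.
Qed.

Lemma truncated_convolution_weak_type (tr f : R -> R) (a : R) :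
  tr = cos \/ tr = sin -> 0 < a -> mu.-integrable setT (EFin \o f) ->
  (mu [set x | (a < `|\int[mu]_y (trunc_kernel 1 th tr eps y * f (x - y))|)%R] <=
    (weak_constant / a)%:E * \int[mu]_y `|f y|%:E)%E.
Proof.
move=> tr12 a0 intf; have /andP[T0 _] := phase_cut adm.
have mf : measurable_fun setT f by have /integrableP[/measurable_EFinP] := intf.
have [mk kM kc] := trunc_kernel1_properties tr tr12.
have [tr2 tr22] : exists tr2 : R -> R, (tr = cos /\ tr2 = sin) \/ (tr = sin /\ tr2 = cos).
  by case: tr12 => ->; [exists sin; left|exists cos; right].
have trb v : `|tr v| <= 1.
  by case: tr12 => ->; rewrite ler_norml ?cos_geN1 ?cos_le1 ?sin_geN1 ?sin_le1.
have mkT : measurable_fun setT (trunc_kernel T th tr eps).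
  case: tr12 => ->.
    by apply: (measurable_trunc_kernel adm cos (fun v => - sin v)) => // v; exact: is_derive_cos.
  by apply: (measurable_trunc_kernel adm sin cos) => // v; exact: is_derive_sin.
under eq_set do rewrite (convolution_reflect _ _ _ mk mf).
apply: (weak_type_of_point_masses _ f _ eps 1 mk kM kc intf) => //.
  exact: weak_constant_ge0.
move=> n y c d d0; rewrite /weak_constant -[T^-1]mulr1.
apply: (weak_type_perturbation (trunc_kernel T th tr eps) _ _ T) => //.
- by rewrite invr_ge0 ltW.
- by move=> x; exact: trunc_kernel_cut.
by move=> e e0; exact: (trunc_kernel_weak_type adm eps eps0 tr tr2).
Qed.

Lemma measurable_truncated_convolution (tr f : R -> R) :
  tr = cos \/ tr = sin -> mu.-integrable setT (EFin \o f) ->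
  measurable_fun setT (fun x : R => \int[mu]_y (trunc_kernel 1 th tr eps y * f (x - y))).
Proof.
move=> tr12 intf.
have mf : measurable_fun setT f by have /integrableP[/measurable_EFinP] := intf.
have [mk kM kc] := trunc_kernel1_properties tr tr12.
rewrite (_ : (fun _ => _) =
    fun x : R => \int[mu]_y (trunc_kernel 1 th tr eps (x - y) * f y)); last first.
  by apply/funext => x; exact: convolution_reflect.
apply: measurable_fun_cvg; last first.
  by move=> x _; exact: (grid_convolution_cvg _ f _ eps 1 mk kM kc intf x).
move=> n; apply: measurable_sum => j; apply: measurable_funM => //.
exact: measurable_fun_shift.
Qed.

End truncated_convolution.

Lemma weak_constant_le {R : realType} (Q : nat) (T C0 v : R) : 0 <= C0 -> 0 <= v -> 0 < T ->
  @weak_constant R Q T C0 (C0 * v) <= @weak_constant R Q T C0 C0 * (1 + v).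
Proof.
move=> C00 v0 T0; rewrite /weak_constant /kernel_constant.
have : 0 <= (Q%:R : R) by []; move: (Q%:R : R) => q q0.
have : 0 <= T^-1 by rewrite invr_ge0 ltW.
move: (T^-1) => r r0; rewrite -subr_ge0.
set X := (X in 0 <= X).
(* [weak_constant] is affine in its last argument, so the difference can be displayed with
   nonnegative coefficients only. *)
suff -> : X = (2 * (3 + (2 + 384 * q) * (q * (q * (4 * q ^+ 2 + 8 * q ^+ 2 * C0 * (1 + 2 * q) * (q + 1)) + q)
  + 2 * C0 + 2)) + 2 * r) * v +
  2 * ((2 + 384 * q) * (q * (q * (2 * q ^+ 2 * C0 * (1 + 2 * q) * (q + 1))) + C0)).
  rewrite !(addr_ge0, mulr_ge0, sqr_ge0)//.
by rewrite /X; ring.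
Qed.

Theorem mainTheorem2 (R : realType) (gam psi : R -> R) (dg dp : nat -> R -> R)
  (t0 s0 C : R)
  (* regularity: gamma in C^3((0,1]), psi in C^2([0,1]) *)
  (Hg : is_Ck_on `]0, 1] `]0, 1[ 3 gam dg)
  (Hp : is_Ck_on `[0, 1] `]0, 1[ 2 psi dp)
  (Hglim : (fun t => `|gam t|) @ at_right 0 --> +oo)
  (Hppos : forall t : R, 0 < t <= 1 -> 0 < psi t)
  (Hplim : psi @ at_right 0 --> 0)
  (Ht0 : 0 < t0) (Hs0 : 0 < s0) (HC : 0 < C)
  (* (a.1) *)
  (Hm_g : monotone_on `]0, 1] gam)
  (Hm_p : monotone_on `]0, 1] psi)
  (Hm_g1 : monotone_on `]0, 1] (dg 1%N))
  (Hm_g2 : monotone_on `]0, 1] (dg 2%N))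
  (Hm_p1 : monotone_on `]0, 1] (dp 1%N))
  (Hg1pos : forall t : R, 0 < t <= 1 -> 0 < dg 1%N t)
  (Hg1dec : {in `]0, 1] &, {homo dg 1%N : x y / x < y >-> y < x}})
  (* (a.2) *)
  (Ha2 : forall t : R, 0 < t < t0 -> t <= 1 ->
     `|dp 1%N t / psi t| <= 2^-1 * `|dg 3%N t / dg 2%N t|)
  (* (a.3), with gamma'^{-1} written out: t1 = gamma'^{-1}(s), t2 = gamma'^{-1}(2s) *)
  (Ha3 : forall s t1 t2 : R, s0 < s -> 0 < t1 <= 1 -> 0 < t2 <= 1 ->
     dg 1%N t1 = s -> dg 1%N t2 = 2 * s ->
     `|dg 2%N t2| <= C * `|dg 2%N t1|)
  (* (a.4) *)
  (Ha4 : exists eps0 A0 : R, 0 < eps0 /\ 1 + eps0 < A0 /\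
     forall t : R, 0 < t < t0 -> (1 + eps0) * t <= 1 ->
       A0 * dg 1%N ((1 + eps0) * t) <= dg 1%N t)
  (* (a.5) *)
  (Ha5 : exists lam : R, 2^-1 < lam < 1 /\
     forall t : R, 0 < t < t0 -> t <= 1 ->
       `|dg 2%N t| <= C * powR (dg 1%N t) (2 * lam)) :
  exists A : R, forall (eps beta : R) (fr fi : R -> R) (alpha : R),
    0 < eps -> 0 < alpha ->
    (@lebesgue_measure R).-integrable setT (fun x => (fr x)%:E) ->
    (@lebesgue_measure R).-integrable setT (fun x => (fi x)%:E) ->
    ((@lebesgue_measure R) [set x : R | (alpha < Tabs gam psi eps beta fr fi x)%R]
     <= (A * (1 + `|beta|) / alpha)%:E *
        \int[@lebesgue_measure R]_(x in setT) (Num.sqrt (fr x ^+ 2 + fi x ^+ 2))%:E)%E.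
Proof.
have [Q [T [T' [C0 [T1 adm]]]]] := admissible_of_hypotheses gam psi dg dp t0 s0 C
  Hg Hp Hppos Hplim Ht0 HC Hm_p Hm_g2 Hm_p1 Hg1pos Hg1dec Ha2 Ha3 Ha4.
have /andP[T0 _] := phase_cut (adm 0); have C00 := phase_C0_ge0 (adm 0).
pose D := @weak_constant R Q T C0 C0.
(* Real and imaginary parts of kernel and function give four real convolutions, each taken at height
   [alpha / 4], whence 4 times 4. *)
exists (16 * D) => eps beta fr fi alpha eps0 alpha0 ifr ifi.
set mu := @lebesgue_measure R.
pose E := @weak_constant R Q T C0 (C0 * `|beta|).
have DE : E <= D * (1 + `|beta|) by exact: weak_constant_le.
have E0 : 0 <= E by exact: weak_constant_ge0 (adm beta).
have cth (x : R) : 0 < x < 1 -> {for x, continuous (Kphase gam psi beta)}.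
  move=> x01; exact: is_derive_continuous (Kphase_derive gam psi dg dp Hg Hp Hppos beta x x01).
have a40 : 0 < alpha / 4 by rewrite divr_gt0.
have mfr : measurable_fun setT fr by have /integrableP[/measurable_EFinP] := ifr.
have mfi : measurable_fun setT fi by have /integrableP[/measurable_EFinP] := ifi.
pose S := (\int[mu]_(x in setT) (Num.sqrt (fr x ^+ 2 + fi x ^+ 2))%:E)%E.
have msqrt (v : R -> R) : measurable_fun setT v -> measurable_fun setT (fun x => Num.sqrt (v x)).
  by move=> mv; apply: measurableT_comp => //; apply: continuous_measurable_fun; exact: sqrt_continuous.
have mS : measurable_fun setT (fun x => (Num.sqrt (fr x ^+ 2 + fi x ^+ 2))%:E).
  apply/measurable_EFinP; apply: msqrt.
  by apply: measurable_funD; exact: measurable_funX.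
have leS (f : R -> R) : measurable_fun setT f ->
    (forall x, f x ^+ 2 <= fr x ^+ 2 + fi x ^+ 2) -> (\int[mu]_x `|f x|%:E <= S)%E.
  move=> mf fle; apply: ge0_le_integral => //.
  - by apply/measurable_EFinP; exact: measurableT_comp.
  - by move=> x _; rewrite lee_fin -sqrtr_sqr ler_wsqrtr.
have [tc ts] : ((cos : R -> R) = cos \/ (cos : R -> R) = sin) /\
  ((sin : R -> R) = cos \/ (sin : R -> R) = sin) by split; [left|right].
pose U (tr f : R -> R) (x : R) :=
  \int[mu]_y (trunc_kernel 1 (Kphase gam psi beta) tr eps y * f (x - y)).
have weakU tr f : tr = cos \/ tr = sin -> mu.-integrable setT (EFin \o f) ->
    (forall x, f x ^+ 2 <= fr x ^+ 2 + fi x ^+ 2) ->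
    (mu [set x | (alpha / 4 < `|U tr f x|)%R] <= (E / (alpha / 4))%:E * S)%E.
  move=> htr intf fle.
  have mf : measurable_fun setT f by have /integrableP[/measurable_EFinP] := intf.
  apply: le_trans (truncated_convolution_weak_type (adm beta) cth T1 eps eps0 tr f _ htr a40 intf) _.
  rewrite lee_wpmul2l ?lee_fin ?divr_ge0 ?(ltW alpha0)//.
  exact: leS.
have measU tr f : tr = cos \/ tr = sin -> mu.-integrable setT (EFin \o f) ->
    measurable [set x | (alpha / 4 < `|U tr f x|)%R].
  move=> htr intf; rewrite -[X in measurable X]setTI; apply: measurable_fun_ltr => //.
  apply: measurableT_comp => //.
  exact: (measurable_truncated_convolution cth eps eps0 tr f htr intf).
have int_term tr f x : tr = cos \/ tr = sin -> mu.-integrable setT (EFin \o f) ->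
    mu.-integrable setT
      (EFin \o (fun y => trunc_kernel 1 (Kphase gam psi beta) tr eps y * f (x - y))).
  move=> htr intf; have [mk kM _] := trunc_kernel1_properties cth eps eps0 tr htr.
  exact: integrable_bounded_mul_reflect mk kM intf.
(* [trunc_kernel 1] with [cos] and [sin] unfolds to [Kre] and [Kim], so only linearity of the
   integral is at stake. *)
have TreE x : Tre gam psi eps beta fr fi x = U cos fr x - U sin fi x.
  by rewrite /U -RintegralB//; exact: int_term.
have TimE x : Tim gam psi eps beta fr fi x = U cos fi x + U sin fr x.
  by rewrite /U -RintegralD//; exact: int_term.
have fle1 x : fr x ^+ 2 <= fr x ^+ 2 + fi x ^+ 2 by rewrite lerDl sqr_ge0.
have fle2 x : fi x ^+ 2 <= fr x ^+ 2 + fi x ^+ 2 by rewrite lerDr sqr_ge0.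
pose V tr f := [set x | (alpha / 4 < `|U tr f x|)%R].
have m1 : measurable (V cos fr) by exact: measU.
have m2 : measurable (V sin fi) by exact: measU.
have m3 : measurable (V cos fi) by exact: measU.
have m4 : measurable (V sin fr) by exact: measU.
have mUr tr f : tr = cos \/ tr = sin -> mu.-integrable setT (EFin \o f) ->
    measurable_fun setT (U tr f).
  by move=> htr intf; exact: (measurable_truncated_convolution cth eps eps0 tr f htr intf).
have mTabs : measurable [set x : R | (alpha < Tabs gam psi eps beta fr fi x)%R].
  rewrite -[X in measurable X]setTI; apply: measurable_fun_ltr => //.
  rewrite (_ : Tabs _ _ _ _ _ _ = fun x => Num.sqrt ((U cos fr x - U sin fi x) ^+ 2 +
      (U cos fi x + U sin fr x) ^+ 2)); last by apply/funext => x; rewrite /Tabs TreE TimE.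
  apply: msqrt; apply: measurable_funD; apply: measurable_funX.
    by apply: measurable_funB; exact: mUr.
  by apply: measurable_funD; exact: mUr.
have sub : [set x : R | (alpha < Tabs gam psi eps beta fr fi x)%R] `<=`
    (V cos fr `|` V sin fi) `|` (V cos fi `|` V sin fr).
  move=> x /=; rewrite /Tabs TreE TimE /V /= => ax.
  case: (ltP (alpha / 4) `|U cos fr x|) => h1; first by left; left.
  case: (ltP (alpha / 4) `|U sin fi x|) => h2; first by left; right.
  case: (ltP (alpha / 4) `|U cos fi x|) => h3; first by right; left.
  case: (ltP (alpha / 4) `|U sin fr x|) => h4; first by right; right.
  exfalso; move: ax; apply/negP; rewrite -leNgt.
  have n1 := ler_normB (U cos fr x) (U sin fi x).
  have n2 := ler_normD (U cos fi x) (U sin fr x).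
  apply: le_trans (_ : Num.sqrt (alpha ^+ 2) <= _); last by rewrite sqrtr_sqr gtr0_norm.
  apply: ler_wsqrtr; rewrite -(real_normK (num_real (_ - _))) -(real_normK (num_real (_ + _))).
  move: n1 n2; set p := `|_ - _|; set q := `|U cos fi x + _| => n1 n2.
  have p0 : 0 <= p := normr_ge0 _; have q0 : 0 <= q := normr_ge0 _.
  have pa : p <= alpha / 2 by lra.
  have qa : q <= alpha / 2 by lra.
  by clear -p0 q0 pa qa alpha0; move: p q p0 q0 pa qa => p q; nra.
apply: le_trans (le_measure mu _ _ sub) _; rewrite ?inE//.
  by do !apply: measurableU.
apply: le_trans (measureU2 mu (measurableU _ _ m1 m2) (measurableU _ _ m3 m4)) _.
apply: le_trans (leeD (measureU2 mu m1 m2) (measureU2 mu m3 m4)) _.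
have S0 : (0 <= S)%E by apply: integral_ge0 => x _; rewrite lee_fin sqrtr_ge0.
have e0 : 0 <= E / (alpha / 4) by rewrite divr_ge0// ltW.
apply: le_trans (leeD (leeD (weakU cos fr tc ifr fle1) (weakU sin fi ts ifi fle2))
  (leeD (weakU cos fi tc ifi fle2) (weakU sin fr ts ifr fle1))) _.
rewrite -!ge0_muleDl ?adde_ge0 ?lee_fin// -!EFinD lee_wpmul2r// lee_fin.
rewrite (_ : _ + _ = 16 * E / alpha); last by field; rewrite gt_eqF.
by rewrite ler_pM2r ?invr_gt0// -mulrA ler_pM2l.
Qed.
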